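(* Let $w$ be an arbitrary nonempty word. (1) If $w$ is not spherical, then the $\Delta$-complex $\Delta_w$ is contractible. (2) Assume $w$ is spherical, and let $v=a_1^2\dots a_t^2$ be its fundamental subword. Then there exists a strong deformation retraction from $\Delta_w$ to the subcomplex $\Delta_v$. In particular, as a topological space $\Delta_w$ is homotopy equivalent to a $(2t-1)$-sphere.
   Context: Notation: $[n]=\{1,\dots,n\}$. A word $w$ in an alphabet (set) $S$ is a finite ordered tuple of elements of $S$, called letters, written $w=a_1\dots a_n$; repetitions are allowed. Its length is $l(w)=n$ and its support is $\mathrm{supp}(w)=\{a_1,\dots,a_n\}$. Power notation denotes repetition of letters, e.g. $a^2=aa$. For $I=\{i_1<\dots<i_k\}\subseteq[n]$ let $w_I:=a_{i_1}\dots a_{i_k}$; the words of this form are the subwords of $w$ (different $I$ giving the same word give the same subword). For a word $w$ of length $n\ge 1$, the scrambled simplex $\Delta_w$ is the $\Delta$-complex (semisimplicial set) whose set $S_l$ of $l$-simplices ($l\geq 0$) is the set of all subwords of $w$ of length $l+1$, and whose boundary map $B_f:S_l\to S_m$, for an order-preserving injection $f:[m+1]\hookrightarrow[l+1]$, sends $u_1\dots u_{l+1}$ to $u_{f(1)}\dots u_{f(m+1)}$. The same symbol denotes its geometric realization. If $v$ is a subword of $w$, then $\Delta_v$ is a subcomplex of $\Delta_w$ in the obvious way. A word is circular if it is of the form $ava$, where $a$ is a letter and $v$ is a (possibly empty) word with $a\notin\mathrm{supp}(v)$. A word is spherical if it is a concatenation of circular words (the empty word counts as spherical, being the concatenation of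 the empty set of circular words). Every spherical word has a unique decomposition $w=a_1v_1a_1\,a_2v_2a_2\dots a_tv_ta_t$ with each $a_iv_ia_i$ circular (i.e. $a_i\notin\mathrm{supp}(v_i)$; the letters $a_i$ need not be distinct), and the fundamental subword of $w$ is then $a_1^2a_2^2\dots a_t^2$. *)

(* Defs.v *)
From HB Require Import structures.
From Stdlib Require Import Relation_Operators.
From mathcomp Require Import all_boot all_order all_algebra generic_quotient.
From mathcomp Require Import all_classical all_reals.
From mathcomp Require Import topology normedtype.

Set Implicit Arguments.
Unset Strict Implicit.
Unset Printing Implicit Defensive.

Import Order.TTheory GRing.Theory Num.Theory.
Import numFieldNormedType.Exports.

Local Open Scope classical_set_scope.
Local Open Scope ring_scope.
Local Open Scope quotient_scope.

Definition homotopic (R : realType) (X Y : topologicalType) (f g : X -> Y) :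
    Prop :=
  exists H : X * R -> Y,
    [/\ {within [set: X] `*` `[0, 1], continuous H},
        forall x, H (x, 0) = f x & forall x, H (x, 1) = g x].

Definition contractible (R : realType) (X : topologicalType) : Prop :=
  exists x0 : X, homotopic R idfun (fun _ : X => x0).

Definition homotopy_equivalent (R : realType) (X Y : topologicalType) : Prop :=
  exists (f : X -> Y) (g : Y -> X),
    [/\ continuous f, continuous g,
        homotopic R (g \o f) idfun & homotopic R (f \o g) idfun].

Definition strong_deformation_retract (R : realType) (X : topologicalType)
    (A : set X) : Prop :=
  exists H : X * R -> X,
    [/\ {within [set: X] `*` `[0, 1], continuous H},
        forall x, H (x, 0) = x,
        forall x, A (H (x, 1)) &
        forall a s, A a -> 0 <= s <= 1 -> H (a, s) = a].

(** The [n]-sphere in [R^(n+1)], with the Euclidean norm: the library norm on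
    matrices is the sup norm, hence the explicit sum of squares. *)
Definition unit_sphere (R : realType) (n : nat) : set 'rV[R]_n.+1 :=
  [set x | \sum_i x 0 i ^+ 2 = 1].
Arguments unit_sphere : clear implicits.

Definition sphere (R : realType) (n : nat) : topologicalType :=
  set_type (unit_sphere R n).

(** Order-preserving injections from [m] to [l] (as initial segments of the
    natural numbers starting at 0). *)
Record ordinj (m l : nat) := OrdInj {
  ordinj_fun :> 'I_m -> 'I_l;
  ordinj_homo : {homo ordinj_fun : i j / (i < j)%N} }.

Definition ordinj_id (n : nat) : ordinj n n :=
  @OrdInj n n id (fun _ _ lt_ij => lt_ij).

Definition ordinj_comp (k m l : nat) (f : ordinj m l) (g : ordinj k m) :
    ordinj k l :=
  @OrdInj k l (f \o g)
    (fun _ _ lt_ij => ordinj_homo f (ordinj_homo g lt_ij)).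

Record delta_complex := DeltaComplex {
  simplex :> nat -> choiceType;
  face : forall l m : nat, ordinj m.+1 l.+1 -> simplex l -> simplex m;
  face_id : forall l (s : simplex l), face (ordinj_id l.+1) s = s;
  face_comp : forall l m k (f : ordinj m.+1 l.+1) (g : ordinj k.+1 m.+1)
    (s : simplex l), face (ordinj_comp f g) s = face g (face f s) }.

Record subcomplex (K : delta_complex) := Subcomplex {
  subcomplex_mem :> forall l : nat, set (K l);
  subcomplex_face : forall l m (f : ordinj m.+1 l.+1) (s : K l),
    subcomplex_mem s -> subcomplex_mem (face f s) }.

Definition barycentric (R : realType) (n : nat) : set 'rV[R]_n.+1 :=
  [set x | (forall i, 0 <= x 0 i) /\ \sum_i x 0 i = 1].
Arguments barycentric : clear implicits.

Definition std_simplex (R : realType) (n : nat) : topologicalType :=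
  set_type (barycentric R n).

Definition coords (R : realType) (n : nat) (x : std_simplex R n) :
    'rV[R]_n.+1 :=
  set_val x.

Section Coface.
Context {R : realType}.

(** The affine map between standard simplices which sends the vertex [e_i] to
    the vertex [e_(f i)]. *)
Definition coface_row (m l : nat) (f : ordinj m.+1 l.+1) (x : 'rV[R]_m.+1) :
    'rV[R]_l.+1 :=
  \row_j \sum_(i | f i == j) x 0 i.

Lemma coface_subproof m l (f : ordinj m.+1 l.+1) (x : std_simplex R m) :
  coface_row f (coords x) \in barycentric R l.
Proof.
have [x_ge0 x_sum1] := set_valP x.
apply/mem_set; split=> [j|]; first by rewrite mxE sumr_ge0.
rewrite -[RHS]x_sum1 (partition_big f xpredT)//=.
by apply: eq_bigr => j _; rewrite mxE.
Qed.

Definition coface m l (f : ordinj m.+1 l.+1) (x : std_simplex R m) :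
    std_simplex R l :=
  exist _ (coface_row f (coords x)) (coface_subproof f x).

End Coface.

Section Realization.
Variables (R : realType) (K : delta_complex).

(** The disjoint union of one standard simplex for each simplex of [K]. *)
Definition cells : Type :=
  {c : {l : nat & K l} & std_simplex R (tag c)}.

HB.instance Definition _ := Topological.on cells.

Definition cell_point l (s : K l) (x : std_simplex R l) : cells :=
  existT (fun c : {l : nat & K l} => std_simplex R (tag c)) (existT _ l s) x.

Inductive face_glue : cells -> cells -> Prop :=
  FaceGlue l m (f : ordinj m.+1 l.+1) (s : K l) (x : std_simplex R m) :
    face_glue (cell_point (face f s) x) (cell_point s (coface f x)).

Let glued (p q : cells) : bool := `[< clos_refl_sym_trans _ face_glue p q >].

Let glued_refl : reflexive glued.
Proof. by move=> p; apply/asboolP; exact: rst_refl. Qed.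

Let glued_sym : symmetric glued.
Proof.
by move=> p q; apply/idP/idP => /asboolP pq; apply/asboolP; exact: rst_sym.
Qed.

Let glued_trans : transitive glued.
Proof.
move=> q p r /asboolP pq /asboolP qr; apply/asboolP.
exact: rst_trans pq qr.
Qed.

Definition glued_rel := EquivRel glued glued_refl glued_sym glued_trans.

Definition realization : Type := {eq_quot glued_rel}.

HB.instance Definition _ := Quotient.on realization.
HB.instance Definition _ :=
  Topological.copy realization (quotient_topology {eq_quot glued_rel}).

Definition realization_point l (s : K l) (x : std_simplex R l) : realization :=
  \pi_realization (cell_point s x).

(** The closed subspace of the realization of [K] that is the realization of
    the subcomplex [L]. *)
Definition subrealization (L : subcomplex K) : set realization :=
  [set p | exists l (s : K l) (x : std_simplex R l),
    L l s /\ p = realization_point s x].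

End Realization.
Arguments subrealization R {K} L.

Section Words.
Variable S : choiceType.
Implicit Types (a : S) (u v w : seq S) (d : seq (S * seq S)).

Definition circular w : Prop :=
  exists a v, a \notin v /\ w = a :: rcons v a.

Definition spherical w : Prop :=
  exists cs : seq (seq S), (forall c, c \in cs -> circular c) /\ w = flatten cs.

(** [d] lists the pairs [(a_i, v_i)] of the decomposition of [w] into the
    circular words [a_i v_i a_i]. *)
Definition circular_decomposition w d : Prop :=
  (forall p, p \in d -> p.1 \notin p.2) /\
  w = flatten [seq p.1 :: rcons p.2 p.1 | p <- d].

Definition fundamental_subword d : seq S :=
  flatten [seq [:: p.1; p.1] | p <- d].

Lemma sphericalP w : spherical w <-> exists d, circular_decomposition w d.
Proof.
split=> [[cs [cs_circ ->]]|[d [d_notin ->]]]; last first.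
  exists [seq p.1 :: rcons p.2 p.1 | p <- d]; split=> // c /mapP[p pd ->].
  by exists p.1, p.2; split=> //; exact: d_notin.
elim: cs cs_circ => [|c cs IH] cs_circ; first by exists [::].
have [|d [d_notin dE]] := IH.
  by move=> c' c'cs; apply: cs_circ; rewrite inE c'cs orbT.
have [a [v [av cE]]] := cs_circ c (mem_head _ _).
exists ((a, v) :: d); split=> [p|/=]; last by rewrite cE dE.
by rewrite inE => /predU1P[->//|/d_notin].
Qed.

Lemma circular_decomposition_uniq w d d' :
  circular_decomposition w d -> circular_decomposition w d' -> d = d'.
Proof.
elim: d d' w => [|[a v] d IH] [|[a' v'] d'] w [dN dE] [d'N d'E] //;
  try by move: d'E; rewrite dE.
have av : a \notin v by apply: (dN (a, v)); rewrite mem_head.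
have av' : a' \notin v' by apply: (d'N (a', v')); rewrite mem_head.
move: d'E; rewrite dE /= => -[aa']; rewrite -{}aa' in av' *.
rewrite !cat_rcons => E.
have vv' : size v = size v'.
  have := congr1 (index a) E.
  by rewrite !index_cat (negbTE av) (negbTE av') /= eqxx !addn0.
move/eqP: E; rewrite eqseq_cat// => /andP[/eqP-> /eqP[E]].
congr (_ :: _); apply: (IH d' (flatten [seq p.1 :: rcons p.2 p.1 | p <- d])).
  by split=> // p pd; apply: dN; rewrite inE pd orbT.
by split=> // p pd; apply: d'N; rewrite inE pd orbT.
Qed.

Lemma fundamental_subseq w d :
  circular_decomposition w d -> subseq (fundamental_subword d) w.
Proof.
case=> _ ->; elim: d => [|[a v] d IH] //.
apply: (@cat_subseq _ [:: a; a] _ (a :: rcons v a)) => //=.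
by rewrite eqxx -cats1 suffix_subseq.
Qed.

Definition subtuple m l (f : ordinj m l) (u : l.-tuple S) : m.-tuple S :=
  [tuple tnth u (f i) | i < m].

Lemma subtuple_subseq m l (f : ordinj m l) (u : l.-tuple S) :
  subseq (subtuple f u) u.
Proof.
rewrite /subtuple /= -[X in subseq _ X](map_tnth_enum u).
rewrite (map_comp (tnth u) f) map_subseq//.
have enum_sorted n : sorted (fun i j : 'I_n => (i < j)%N) (enum 'I_n).
  by have := iota_ltn_sorted 0 n; rewrite -val_enum_ord sorted_map.
suff -> : map f (enum 'I_m) = [seq j <- enum 'I_l | j \in map f (enum 'I_m)].
  exact: filter_subseq.
have ltn_tr : transitive (fun i j : 'I_l => (i < j)%N).
  by move=> ? ? ?; exact: ltn_trans.
apply: (irr_sorted_eq ltn_tr) => [i|||i]; first exact: ltnn.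
- rewrite sorted_map; apply: sub_sorted (enum_sorted m) => i j.
  exact: ordinj_homo.
- exact: (sorted_filter ltn_tr).
- by rewrite mem_filter mem_enum andbT.
Qed.

Variable w : seq S.

Definition subword (l : nat) : Type := {u : l.+1.-tuple S | subseq u w}.

HB.instance Definition _ l := Choice.on (subword l).

Lemma subword_face_subproof l m (f : ordinj m.+1 l.+1) (u : subword l) :
  subseq (subtuple f (val u)) w.
Proof. exact: subseq_trans (subtuple_subseq f (val u)) (valP u). Qed.

Definition subword_face l m (f : ordinj m.+1 l.+1) (u : subword l) :
    subword m :=
  exist _ (subtuple f (val u)) (subword_face_subproof f u).

Lemma subword_face_id l (u : subword l) : subword_face (ordinj_id l.+1) u = u.
Proof. by apply/val_inj/eq_from_tnth => i; rewrite tnth_mktuple. Qed.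

Lemma subword_face_comp l m k (f : ordinj m.+1 l.+1) (g : ordinj k.+1 m.+1)
    (u : subword l) :
  subword_face (ordinj_comp f g) u = subword_face g (subword_face f u).
Proof. by apply/val_inj/eq_from_tnth => i; rewrite !tnth_mktuple. Qed.

Definition scrambled_simplex : delta_complex :=
  @DeltaComplex (fun l => subword l : choiceType) subword_face
    subword_face_id subword_face_comp.

Lemma scrambled_sub_subproof v l m (f : ordinj m.+1 l.+1) (u : subword l) :
  subseq (val u) v -> subseq (val (subword_face f u)) v.
Proof. exact/subseq_trans/subtuple_subseq. Qed.

(** The scrambled simplex on a subword [v] of [w], as a subcomplex. *)
Definition scrambled_subcomplex v : subcomplex scrambled_simplex :=
  @Subcomplex scrambled_simplex
    (fun l => [set u : subword l | subseq (val u) v])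
    (@scrambled_sub_subproof v).

End Words.

(* Main.v *)
From HB Require Import structures.
From Stdlib Require Import Relation_Operators.
Require Import Defs.
From mathcomp Require Import all_boot all_order all_algebra generic_quotient.
From mathcomp Require Import all_classical all_reals topology normedtype.
From mathcomp Require Import realfun.
From mathcomp Require Import lra zify.

Set Implicit Arguments.
Unset Strict Implicit.
Unset Printing Implicit Defensive.

Import Order.TTheory GRing.Theory Num.Theory.
Import numFieldNormedType.Exports.

Local Open Scope classical_set_scope.
Local Open Scope ring_scope.

(** A point of the realization is given by a subword of [w] and positive
    barycentric coordinates on its letters, that is, by a list of pairs
    (letter, positive weight) of total weight one; a letter disappears when
    its weight reaches zero. Without the normalization such lists form the
    open cone over the realization, with the empty list as its apex. The proof
    works in these cones. Its maps and homotopies send the apex, and nothing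
    else, to the apex ([cone_map], [cone_homot]); so they induce maps and
    homotopies of realizations, while weights may be moved and decreased
    without renormalizing. Weighted words carry the final topology for the
    parametrizations [cell] of cones over simplices, and [cont_on_cells]
    allows continuity, also that of homotopies, to be checked on these
    parametrizations.

    Three deformations do the geometric work. Decreasing all weights except
    that of a leading letter, to which weight is added, retracts the complex
    of [a v a x] to that of [a a x], and that of [a v] to the vertex [a], when
    [a] is not in [v] ([cone_equiv_front_push]). Next, the complex of [a a x]
    is not the join of a circle with that of [x] if [a] occurs in [x]: for
    [a a a] it is the dunce hat, which is contractible but does not collapse.
    Still, [a] may be replaced by a letter [b] that does not occur in [x].
    Indeed the union of the complexes of [a b a x] and [b a b x] retracts to
    the second one by moving weight from a leading [a] to a [b] behind it, and
    then to that of [b b x]; by symmetry it is also equivalent to that of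
    [a a x] ([cone_equiv_join]). Finally, for such a [b] the complex of
    [b b x] is the join of the circle [b b] with that of [x], so an
    equivalence for [x] gives one for [b b x] ([cone_equiv_circle_join]). To
    have a new letter [b] at hand, the letters of [w] are embedded in an
    option type.

    Removing circular words from the left end of a spherical word thus leads
    to its fundamental subword ([cone_equiv_spherical]). In a word that is not
    spherical, what remains at some stage is a nonempty word [a v] with [a]
    not in [v], whose complex is a cone, and the join of a circle with a point
    is contractible ([cone_equiv_not_spherical]). The open cone over the
    circle [b b] is the plane, so every circular word adds two dimensions to
    the Euclidean space that is equivalent to the open cone over the complex
    ([sphere_like_spherical]), and removing the apex on both sides leaves a
    sphere.

    These equivalences say that an inclusion of realizations is a homotopy
    equivalence. A small truncation of the weights deforms a neighbourhood of
    a subcomplex into it with the subcomplex fixed, and for an inclusion with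
    such a neighbourhood a homotopy equivalence can be corrected to a strong
    deformation retraction ([strong_retraction]). *)

(** * Continuity on subsets and constrained homotopies *)

Section Continuity.
Implicit Types T U V W : topologicalType.

(** Unlike continuity for a subspace topology, this leaves the domain type
    unchanged, so that functions on various subsets compose without coercions. *)
Definition cont_on T U (A : set T) (f : T -> U) : Prop :=
  forall x, A x -> f @ within A (nbhs x) --> f x.

Lemma cont_on_sub T U (A B : set T) (f : T -> U) :
  A `<=` B -> cont_on B f -> cont_on A f.
Proof.
move=> AB cf x Ax O nO; have := cf x (AB _ Ax) O nO.
by apply: (@filterS _ (nbhs x)) => y + Ay; apply; exact: AB.
Qed.

Lemma cont_on_comp T U V (A : set T) (B : set U) (f : T -> U) (g : U -> V) :
  cont_on A f -> (forall x, A x -> B (f x)) -> cont_on B g -> cont_on A (g \o f).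
Proof.
move=> cf AB cg x Ax O nO.
have /(cf x Ax) := cg (f x) (AB _ Ax) O nO.
by apply: (@filterS _ (nbhs x)) => y + Ay; apply => //; exact: AB.
Qed.

Lemma cont_onT T U (A : set T) (f : T -> U) : continuous f -> cont_on A f.
Proof.
by move=> cf x _ O /cf; apply: (@filterS _ (nbhs x)) => y + _; apply.
Qed.

Lemma cont_on_setT T U (f : T -> U) : cont_on setT f -> continuous f.
Proof.
by move=> cf x O /(cf x I); apply: (@filterS _ (nbhs x)) => y; apply.
Qed.

Lemma cont_on_within T U (A : set T) (f : T -> U) :
  cont_on A f -> {within A, continuous f}.
Proof. by move=> cf; apply/subspace_continuousP. Qed.

Lemma cont_on_pair T U V (A : set T) (f : T -> U) (g : T -> V) :
  cont_on A f -> cont_on A g -> cont_on A (fun x => (f x, g x)).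
Proof.
move=> cf cg x Ax; apply: cvg_pair.
- exact: cf.
- exact: cg.
Qed.

Lemma continuous_fst T U : continuous (@fst T U).
Proof. by move=> x; exact: cvg_fst. Qed.

Lemma continuous_snd T U : continuous (@snd T U).
Proof. by move=> x; exact: cvg_snd. Qed.

Lemma continuous_pair T U V (f : T -> U) (g : T -> V) (x : T) :
  {for x, continuous f} -> {for x, continuous g} ->
  {for x, continuous (fun y => (f y, g y))}.
Proof. by move=> cf cg; apply: cvg_pair; [exact: cf|exact: cg]. Qed.

Lemma continuous_lift_fst T U V (Y : T -> U) (x : T * V) :
  {for x.1, continuous Y} -> {for x, continuous (fun y => (Y y.1, y.2))}.
Proof.
move=> cY; apply: continuous_pair; last exact: continuous_snd.
exact: (continuous_comp (@continuous_fst _ _ x) cY).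
Qed.

Lemma near_all T (t : T) (f : T -> Prop) :
  (forall x, f x) -> \forall x \near t, f x.
Proof. by move=> h; exact: (@nearW _ (nbhs t)). Qed.

Lemma near_forall T (I : finType) (f : I -> T -> Prop) (t : T) :
  (forall i, \forall x \near t, f i x) -> \forall x \near t, forall i, f i x.
Proof. exact: (@filter_forall T I f (nbhs t)). Qed.

Lemma cont_on_eq T U (A : set T) (f g : T -> U) :
  (forall x, A x -> f x = g x) -> cont_on A f -> cont_on A g.
Proof.
move=> fg cf x Ax O; rewrite -fg// => /(cf x Ax).
by apply: (@filterS _ (nbhs x)) => y + Ay => /(_ Ay); rewrite /= fg.
Qed.

(** The pasting lemma for the two relatively closed pieces where [p] is
    nonpositive and nonnegative. *)
Lemma cont_on_glue (R : realType) T U (A : set T) (p : T -> R) (f1 f2 : T -> U) :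
  cont_on A p ->
  cont_on [set x | A x /\ p x <= 0] f1 -> cont_on [set x | A x /\ 0 <= p x] f2 ->
  (forall x, A x -> p x = 0 -> f1 x = f2 x) ->
  cont_on A (fun x => if p x <= 0 then f1 x else f2 x).
Proof.
move=> cp c1 c2 e x Ax O /= nO.
have n1 : p x <= 0 -> \forall y \near x, A y -> p y <= 0 -> O (f1 y).
  move=> p0; move: nO; rewrite p0 => /(c1 x (conj Ax p0)).
  by apply: (@filterS _ (nbhs x)) => y + Ay py; apply.
have n2 : 0 <= p x -> \forall y \near x, A y -> 0 <= p y -> O (f2 y).
  move=> p0; have : nbhs (f2 x) O.
    by move: nO; case: ifP => // q0; rewrite e//; apply/eqP; rewrite eq_le q0.
  move=> /(c2 x (conj Ax p0)).
  by apply: (@filterS _ (nbhs x)) => y + Ay py; apply.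
have [p0|p0|p0] := ltgtP (p x) 0.
- have := cp x Ax _ (lt_nbhsl p0); have := n1 (ltW p0).
  apply: (@filterS2 _ (nbhs x)) => y m1 m2 Ay /=.
  by rewrite (ltW (m2 Ay)); apply: m1 => //; exact: ltW (m2 Ay).
- have := cp x Ax _ (lt_nbhsr p0); have := n2 (ltW p0).
  apply: (@filterS2 _ (nbhs x)) => y m1 m2 Ay /=.
  by rewrite leNgt (m2 Ay : 0 < p y) /=; apply: m1 => //; exact: ltW (m2 Ay).
- have := n1 (eq_ind_r (fun z => z <= 0) (lexx _) p0).
  have := n2 (eq_ind_r (fun z => 0 <= z) (lexx _) p0).
  apply: (@filterS2 _ (nbhs x)) => y m2 m1 Ay /=.
  case: ifPn => [py|]; first exact: m1.
  by rewrite -ltNge => /ltW py; exact: m2.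
Qed.

End Continuity.

Section RealValued.
Variables (R : realType) (T : topologicalType) (f g : T -> R) (x : T).
Hypotheses (cf : {for x, continuous f}) (cg : {for x, continuous g}).

Lemma contD : {for x, continuous (fun y => f y + g y)}.
Proof. exact: (@cvgD _ _ _ (nbhs x) _ f g _ _ cf cg). Qed.

Lemma contN : {for x, continuous (fun y => - f y)}.
Proof. exact: (@cvgN _ _ _ (nbhs x) _ f _ cf). Qed.

Lemma contB : {for x, continuous (fun y => f y - g y)}.
Proof. exact: (@cvgB _ _ _ (nbhs x) _ f g _ _ cf cg). Qed.

Lemma contM : {for x, continuous (fun y => f y * g y)}.
Proof. exact: (@cvgM _ _ (nbhs x) _ f g _ _ cf cg). Qed.

Lemma cont_max : {for x, continuous (fun y => Num.max (f y) (g y))}.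
Proof. exact: (continuous_max cf cg). Qed.

Lemma cont_min : {for x, continuous (fun y => Num.min (f y) (g y))}.
Proof. exact: (continuous_min cf cg). Qed.

End RealValued.

Lemma cont_sum (R : realType) (T : topologicalType) (I : Type) (r : seq I)
    (F : I -> T -> R) (x : T) :
  (forall i, {for x, continuous (F i)}) ->
  {for x, continuous (fun y => \sum_(i <- r) F i y)}.
Proof.
move=> cF; elim: r => [|i r IH].
  have -> : (fun y => \sum_(i <- [::]) F i y) = cst (0 : R).
    by apply/funext => y; rewrite big_nil.
  exact: cst_continuous.
have -> : (fun y => \sum_(j <- i :: r) F j y) =
    (fun y => F i y + \sum_(j <- r) F j y).
  by apply/funext => y; rewrite big_cons.
exact: contD.
Qed.

Lemma near_eq_continuous (T U : topologicalType) (f g : T -> U) (x : T) :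
  (\forall y \near x, f y = g y) -> {for x, continuous g} ->
  {for x, continuous f}.
Proof.
move=> fg cg O nO; have fgx : f x = g x by exact: nbhs_singleton fg.
move: nO; rewrite fgx => /cg.
by apply: (@filterS2 _ (nbhs x) _ _ _ _ _ fg) => y /= ->.
Qed.

Lemma continuous_set_type (T U : topologicalType) (B : set U)
    (f : T -> set_type B) (x : T) :
  {for x, continuous (fun y => set_val (f y))} -> {for x, continuous f}.
Proof.
move=> cf O [V [[W oW <-] /= Wx]] VO.
have := cf W (open_nbhs_nbhs (conj oW Wx)).
by apply: (@filterS _ (nbhs x)) => y /= Wy; exact: VO.
Qed.

Section Homotopy.
Variable R : realType.

(** Retraction of the line to the unit interval. It allows all homotopies to
    have the whole line as parameter space. *)
Definition clip (s : R) : R := Num.max 0 (Num.min 1 s).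

Lemma clip_ge0 s : 0 <= clip s.
Proof. by rewrite /clip le_max lexx. Qed.

Lemma clip_le1 s : clip s <= 1.
Proof. by rewrite /clip ge_max ler01 ge_min lexx. Qed.

Lemma clip0 : clip 0 = 0.
Proof. by rewrite /clip /Num.min ltNge ler01 /= maxxx. Qed.

Lemma clip1 : clip 1 = 1.
Proof. by rewrite /clip minxx /Num.max ltr01. Qed.

Lemma continuous_clip : continuous clip.
Proof.
move=> s; apply: continuous_max; first exact: cvg_cst.
by apply: continuous_min; [exact: cvg_cst|exact: cvg_id].
Qed.

(** The constraint [C x y] says where the point [x] is allowed to travel.
    Taking for it [True], membership in a set, or [A x -> y = x] gives free
    homotopies, homotopies inside a subset and homotopies relative to [A]. *)
Definition homot (T U : topologicalType) (A : set T) (C : T -> U -> Prop)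
    (f g : T -> U) : Prop :=
  exists H : T * R -> U,
    [/\ cont_on (A `*` setT) H, forall x s, A x -> C x (H (x, s)),
        forall x, A x -> H (x, 0) = f x & forall x, A x -> H (x, 1) = g x].

Section HomotopyTheory.
Variables (T U : topologicalType).
Implicit Types (A : set T) (C : T -> U -> Prop) (f g h : T -> U).

Lemma cont_on_slice A (H : T * R -> U) (m : T -> R) :
  cont_on (A `*` setT) H -> cont_on A m -> cont_on A (fun x => H (x, m x)).
Proof.
move=> cH cm.
apply: (@cont_on_comp _ _ _ _ (A `*` setT) (fun x => (x, m x)) H) cH => //.
by apply: cont_on_pair => //; apply: cont_onT => ?; exact: cvg_id.
Qed.

Lemma cont_on_reparam A (H : T * R -> U) (r : T * R -> R) :
  cont_on (A `*` setT) H -> cont_on (A `*` setT) r ->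
  cont_on (A `*` setT) (fun y => H (y.1, r y)).
Proof.
move=> cH cr.
apply: (@cont_on_comp _ _ _ _ (A `*` setT) (fun y => (y.1, r y)) H) => //.
by apply: cont_on_pair => //; apply: cont_onT => ?; exact: cvg_fst.
Qed.

Lemma homot_contl A C f g : homot A C f g -> cont_on A f.
Proof.
move=> [H [cH _ H0 _]]; apply: (@cont_on_eq _ _ _ (fun x => H (x, 0))) => //.
by apply: cont_on_slice => //; apply: cont_onT => ?; exact: cvg_cst.
Qed.

Lemma homot_contr A C f g : homot A C f g -> cont_on A g.
Proof.
move=> [H [cH _ _ H1]]; apply: (@cont_on_eq _ _ _ (fun x => H (x, 1))) => //.
by apply: cont_on_slice => //; apply: cont_onT => ?; exact: cvg_cst.
Qed.

Lemma homot_constr A C f g x : homot A C f g -> A x -> C x (g x).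
Proof. by move=> [H [_ CH _ H1]] Ax; rewrite -H1//; exact: CH. Qed.

Lemma homot_constl A C f g x : homot A C f g -> A x -> C x (f x).
Proof. by move=> [H [_ CH H0 _]] Ax; rewrite -H0//; exact: CH. Qed.

Lemma homot_refl A C f :
  cont_on A f -> (forall x, A x -> C x (f x)) -> homot A C f f.
Proof.
move=> cf Cf; exists (f \o fst); split => //.
- apply: cont_on_comp cf => [|[x s] []//].
  by apply: cont_onT => ?; exact: cvg_fst.
- by move=> x s; exact: Cf.
Qed.

Lemma homot_sym A C f g : homot A C f g -> homot A C g f.
Proof.
move=> [H [cH CH H0 H1]]; exists (fun y => H (y.1, 1 - y.2)); split => /=.
- apply: cont_on_reparam => //; apply: cont_onT => y.
  by apply: cvgB; [exact: cvg_cst|exact: cvg_snd].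
- by move=> x s Ax; exact: CH.
- by move=> x Ax; rewrite subr0 H1.
- by move=> x Ax; rewrite subrr H0.
Qed.

Lemma homot_trans A C f g h :
  homot A C f g -> homot A C g h -> homot A C f h.
Proof.
move=> [H [cH CH H0 H1]] [K [cK CK K0 K1]].
exists (fun y => if y.2 * 2 - 1 <= 0 then H (y.1, clip (y.2 * 2))
                 else K (y.1, clip (y.2 * 2 - 1))); split => /=.
- have c2 : continuous (fun y : T * R => y.2 * 2).
    by move=> y; apply: cvgM; [exact: cvg_snd|exact: cvg_cst].
  have c3 : continuous (fun y : T * R => y.2 * 2 - 1).
    by move=> y; apply: cvgB; [exact: c2|exact: cvg_cst].
  apply: cont_on_glue; first exact: cont_onT.
  + apply: (@cont_on_sub _ _ _ (A `*` setT)); first by move=> y [].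
    apply: cont_on_reparam => //; apply: cont_onT => y.
    exact: (continuous_comp (c2 y) (@continuous_clip _)).
  + apply: (@cont_on_sub _ _ _ (A `*` setT)); first by move=> y [].
    apply: cont_on_reparam => //; apply: cont_onT => y.
    exact: (continuous_comp (c3 y) (@continuous_clip _)).
  + move=> [x s] [Ax _] /= e.
    have -> : s * 2 = 1 by lra.
    by rewrite subrr clip0 clip1 H1// K0.
- by move=> x s Ax; case: ifP => _; [exact: CH|exact: CK].
- by move=> x Ax; rewrite mul0r sub0r oppr_le0 ler01 clip0 H0.
- move=> x Ax; rewrite mul1r.
  have -> : 2 - 1 = 1 :> R by lra.
  by rewrite leNgt ltr01 /= clip1 K1.
Qed.

Lemma homot_sub A B C D f g :
  B `<=` A -> (forall x y, B x -> C x y -> D x y) ->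
  homot A C f g -> homot B D f g.
Proof.
move=> BA CD [H [cH CH H0 H1]]; exists H; split.
- by apply: cont_on_sub cH => -[x s] [/BA].
- by move=> x s Bx; apply: CD => //; exact/CH/BA.
- by move=> x /BA; exact: H0.
- by move=> x /BA; exact: H1.
Qed.

Lemma homot_eq A C f g f' g' :
  (forall x, A x -> f x = f' x) -> (forall x, A x -> g x = g' x) ->
  homot A C f g -> homot A C f' g'.
Proof.
move=> ff' gg' [H [cH CH H0 H1]]; exists H; split => // x Ax.
- by rewrite H0// ff'.
- by rewrite H1// gg'.
Qed.

End HomotopyTheory.

Lemma homot_pre (T U V : topologicalType) (A : set T) (B : set U)
    (C : U -> V -> Prop) (D : T -> V -> Prop) (p : T -> U) (f g : U -> V) :
  cont_on A p -> (forall x, A x -> B (p x)) ->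
  (forall x y, A x -> C (p x) y -> D x y) ->
  homot B C f g -> homot A D (f \o p) (g \o p).
Proof.
move=> cp AB CD [H [cH CH H0 H1]].
exists (fun y => H (p y.1, y.2)); split => /=.
- apply: (@cont_on_comp _ _ _ _ (B `*` setT) (fun y => (p y.1, y.2)) H) => //.
  + apply: cont_on_pair; last by apply: cont_onT => ?; exact: cvg_snd.
    apply: cont_on_comp cp => [|[x s] []//].
    by apply: cont_onT => ?; exact: cvg_fst.
  + by move=> [x s] [/AB].
- by move=> x s Ax; apply: CD => //; exact/CH/AB.
- by move=> x /AB; exact: H0.
- by move=> x /AB; exact: H1.
Qed.

Lemma homot_post (T U V : topologicalType) (A : set T) (B : set U)
    (C : T -> U -> Prop) (D : T -> V -> Prop) (q : U -> V) (f g : T -> U) :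
  cont_on B q -> (forall x y, A x -> C x y -> B y) ->
  (forall x y, A x -> C x y -> D x (q y)) ->
  homot A C f g -> homot A D (q \o f) (q \o g).
Proof.
move=> cq CB CD [H [cH CH H0 H1]].
exists (q \o H); split => /=.
- apply: cont_on_comp cH _ cq => -[x s] [Ax _].
  exact: CB (CH x s Ax).
- by move=> x s Ax; apply: (CD x _ Ax); exact: CH.
- by move=> x Ax; rewrite H0.
- by move=> x Ax; rewrite H1.
Qed.

End Homotopy.

(** * The space of weighted words *)

Section WeightedWords.
Variables (R : realType) (L : choiceType).
Implicit Types (a b c : L) (u v w : seq L).

Definition wword : Type := seq (L * R).
HB.instance Definition _ := Choice.on wword.

(** All weights live in one space of sequences, whatever the length of the
    word; the coordinates beyond the length are ignored. *)
Definition weights : topologicalType := prod_topology (fun _ : nat => R).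

Implicit Types (e o : wword) (x y : nat -> R).

(** Letters whose weight is not positive are absent from the support of a
    point. Nonpositive weights are admitted in [o] so that weights can be
    decreased freely and cleaned afterwards. *)
Definition clean o : wword := [seq p <- o | 0 < p.2].

Definition word o : seq L := [seq p.1 | p <- o].

Fixpoint weigh u x : wword :=
  if u is a :: u' then (a, x 0%N) :: weigh u' (fun i => x i.+1) else [::].

(** The parametrization of the cone over the simplex [u]. It identifies all
    faces of [u] that spell the same subword, which is what the realization
    does. *)
Definition cell u x : wword := clean (weigh u x).

(** The final topology for all maps [cell u], as an analogue of the weak
    topology of a complex: simplices of all words are glued at the same time. *)
Definition word_open : set_system wword :=
  [set O | forall u, open [set x : weights | O (cell u x)]].

Lemma word_openT : word_open setT.
Proof. by move=> u; rewrite (_ : [set _ | _] = setT) //; exact: openT. Qed.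

Lemma word_openI : setI_closed word_open.
Proof. by move=> O O' oO oO' u; exact: openI (oO u) (oO' u). Qed.

Lemma word_openU (I : Type) (f : I -> set wword) :
  (forall i, word_open (f i)) -> word_open (\bigcup_i f i).
Proof.
move=> of_ u; rewrite (_ : [set _ | _] = \bigcup_i [set x : weights | f i (cell u x)]).
  by apply: bigcup_open => i _; exact: of_.
by apply/seteqP; split=> x [i _ ?]; exists i.
Qed.

HB.instance Definition _ :=
  isOpenTopological.Build wword word_openT word_openI word_openU.

Lemma cell_continuous u : continuous (cell u : weights -> wword).
Proof. by apply/continuousP => O oO; exact: oO. Qed.

Lemma coord_continuous i : continuous (fun x : weights => (x : nat -> R) i).
Proof. exact: (@proj_continuous nat (fun _ => R) i). Qed.

Lemma cvg_weights (T : topologicalType) (f : T -> weights) (t : T) :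
  (forall i, {for t, continuous (fun t' => (f t' : nat -> R) i)}) ->
  {for t, continuous f}.
Proof. by move=> h; apply/(@pointwise_cvgP nat R _ (f t)). Qed.

Definition shift_weights x : nat -> R := fun i => x i.+1.

Lemma shift_weights_continuous : continuous (shift_weights : weights -> weights).
Proof.
by move=> x; apply: cvg_weights => i; exact: (@coord_continuous i.+1 x).
Qed.

Definition cons_weights (r : R) x : nat -> R :=
  fun i => if i is j.+1 then x j else r.

Lemma cons_weights_continuous (T : topologicalType) (t : T) (f : T -> R)
    (X : T -> weights) :
  {for t, continuous f} -> {for t, continuous X} ->
  {for t, continuous (fun t' => cons_weights (f t') (X t') : weights)}.
Proof.
move=> cf cX; apply: cvg_weights => -[|i] //.
exact: (continuous_comp cX (@coord_continuous i _)).
Qed.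

(** A list that depends continuously on a parameter and always spells the same
    word. Such families are what remains of a formula after composition with
    [cell u], and [cont_family_clean] makes them continuous. *)
Definition cont_family (T : topologicalType) (t : T) (o : T -> wword) : Prop :=
  exists u (X : T -> weights),
    {for t, continuous X} /\ forall t', o t' = weigh u (X t').

Lemma cont_family_clean (T : topologicalType) (t : T) (o : T -> wword) :
  cont_family t o -> {for t, continuous (fun t' => clean (o t') : wword)}.
Proof.
move=> [u [X [cX oE]]].
have -> : (fun t' => clean (o t') : wword) = (cell u : weights -> wword) \o X.
  by apply/funext => t' /=; rewrite oE.
exact: continuous_comp cX (@cell_continuous u _).
Qed.

Lemma cont_family_weigh (T : topologicalType) (t : T) u (X : T -> weights) :
  {for t, continuous X} -> cont_family t (fun t' => weigh u (X t')).
Proof. by move=> cX; exists u, X. Qed.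

Lemma cont_family_nil (T : topologicalType) (t : T) : cont_family t (fun _ => [::]).
Proof. by exists [::], (fun=> fun=> 0); split=> //; exact: cvg_cst. Qed.

Lemma cont_family_cons (T : topologicalType) (t : T) a (f : T -> R) (o : T -> wword) :
  {for t, continuous f} -> cont_family t o -> cont_family t (fun t' => (a, f t')
    :: o t').
Proof.
move=> cf [u [X [cX oE]]].
exists (a :: u), (fun t' => cons_weights (f t') (X t')).
split; last by move=> t' /=; rewrite oE.
exact: cons_weights_continuous.
Qed.

Lemma weigh_shift u x d :
  [seq (p.1, p.2 - d) | p <- weigh u x] = weigh u (fun i => x i - d).
Proof. by elim: u x => //= a u IH x; rewrite IH. Qed.

Lemma cont_family_shift (T : topologicalType) (t : T) (d : T -> R) (o : T -> wword) :
  {for t, continuous d} -> cont_family t o ->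
  cont_family t (fun t' => [seq (p.1, p.2 - d t') | p <- o t']).
Proof.
move=> cd [u [X [cX oE]]].
exists u, (fun t' i => (X t' : nat -> R) i - d t'); split.
  apply: cvg_weights => i; apply: cvgB => //.
  exact: (continuous_comp cX (@coord_continuous i _)).
by move=> t'; rewrite oE weigh_shift.
Qed.

Lemma clean_id o : clean (clean o) = clean o.
Proof. by rewrite /clean filter_id. Qed.

Lemma clean_subword o : subseq (word (clean o)) (word o).
Proof. by apply: map_subseq; exact: filter_subseq. Qed.

Lemma word_weigh u x : word (weigh u x) = u.
Proof. by elim: u x => //= a u IH x; rewrite IH. Qed.

Lemma word_cell u x : subseq (word (cell u x)) u.
Proof. by rewrite -{2}(word_weigh u x); exact: clean_subword. Qed.

Lemma clean_cell u x : clean (cell u x) = cell u x.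
Proof. exact: clean_id. Qed.

Lemma weigh_word e : weigh (word e) (fun i => nth 0 [seq p.2 | p <- e] i) = e.
Proof. by elim: e => //= -[a t] e IH /=; rewrite IH. Qed.

(** A complex whose simplices are words is given by the set of its simplices,
    which is closed under subwords. *)
Definition down (P : pred (seq L)) := forall u v, subseq u v -> P v -> P u.

(** The open cone over the complex with simplices [P]; the apex is the empty
    list, so [P] is expected to hold of the empty word. *)
Definition cone (P : pred (seq L)) : set wword := [set e | clean e = e /\ P (word e)].

Lemma cone_cell P u x : down P -> P u -> cone P (cell u x).
Proof. by move=> dP Pu; split; [exact: clean_cell|exact: dP (word_cell u x) Pu]. Qed.

(** The cone over a face sits in the cone over the simplex with the other
    weights equal to zero. *)
Lemma cell_subseq u v : subseq u v ->
  exists Y : weights -> weights, continuous Y /\ forall x, cell v (Y x) = cell u x.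
Proof.
elim: v u => [|b v IH] [|a u] //=; first by exists id; split; [move=> x O|].
  move=> _; exists (fun _ => (fun _ => 0) : weights); split; first exact:
    cst_continuous.
  move=> x.
  rewrite /cell /= ltxx; elim: v {IH} => //= c v ->; by rewrite ltxx.
case: eqP => [<- /IH[Y [cY YE]]|_ /IH[Y [cY YE]]].
  exists (fun x => cons_weights ((x : nat -> R) 0%N) (Y (shift_weights x))); split.
    move=> x; apply: (@cons_weights_continuous _ x
      (fun x : weights => (x : nat -> R) 0%N) (Y \o shift_weights)).
      exact: coord_continuous.
    exact: (continuous_comp (@shift_weights_continuous x) (cY _)).
  by move=> x; have := YE (shift_weights x); rewrite /cell /= => ->.
exists (fun x => cons_weights 0 (Y x)); split.
  move=> x; apply: (@cons_weights_continuous _ x (fun=> 0) Y _ (cY x)).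
  exact: (@cst_continuous _ _ 0 x).
by move=> x; have := YE x; rewrite /cell /= ltxx => ->.
Qed.

(** The parametrization of a simplex can be read on the face [m] wherever the
    weights outside [m] are not positive. This gives a continuous
    reparametrization in the direction opposite to [cell_subseq]. *)
Lemma cell_mask v (m : bitseq) :
  size m = size v ->
  exists Y : weights -> weights, continuous Y /\
    forall x, (forall i, (i < size v)%N -> ~~ nth false m i -> x i <= 0) ->
      cell (mask m v) (Y x) = cell v x.
Proof.
elim: v m => [|b v IH] [|[] m] //=.
- by move=> _; exists id; split; [move=> x O|].
- move=> [/IH[Y [cY YE]]].
  exists (fun x => cons_weights ((x : nat -> R) 0%N) (Y (shift_weights x))); split.
    move=> x; apply: (@cons_weights_continuous _ x
      (fun x : weights => (x : nat -> R) 0%N) (Y \o shift_weights)).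
      exact: coord_continuous.
    exact: (continuous_comp (@shift_weights_continuous x) (cY _)).
  move=> x h; have := YE (shift_weights x).
  rewrite /cell /= => -> // i iv mi; exact: h i.+1 _ _.
- move=> [/IH[Y [cY YE]]].
  exists (Y \o shift_weights); split.
    by move=> x; exact: (continuous_comp (@shift_weights_continuous x) (cY _)).
  move=> x h; have := YE (shift_weights x).
  rewrite /cell /= => -> //; last by move=> i iv mi; exact: h i.+1 _ _.
  by rewrite ltNge (h 0%N).
Qed.

Lemma cell_surj e u : clean e = e -> subseq (word e) u -> exists x, cell u x = e.
Proof.
move=> ce /cell_subseq[Y [_ YE]].
by exists (Y (fun i => nth 0 [seq p.2 | p <- e] i)); rewrite YE /cell weigh_word.
Qed.

Lemma word_cell_mask v x :
  word (cell v x) = mask [seq 0 < x i | i <- iota 0 (size v)] v.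
Proof.
elim: v x => //= b v IH x; rewrite /cell /=.
have -> : [seq 0 < x i | i <- iota 1 (size v)]
        = [seq 0 < x i.+1 | i <- iota 0 (size v)].
  by rewrite (iotaDl 1 0) -map_comp.
by have := IH (shift_weights x); rewrite /cell; case: ifP => /= _ ->.
Qed.

(** Two difficulties are met here. A final topology need not be compatible
    with the product by the line; and a neighbourhood in the space of all
    weighted words has to be tested on the parametrizations of all words,
    where [F] is known only on the faces in [P]. An explicit tube is used: the
    line is replaced by a compact segment, and a point of a cell lies on
    finitely many faces only, so that finitely many conditions on the weights
    suffice. *)
Lemma cont_on_cells P (O : set wword) (U : topologicalType) (F : wword * R -> U) :
  down P -> open O ->
  (forall u, P u -> exists v, [/\ P v, subseq u v &
     forall (x : weights) z, O (cell v x) ->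
       {for (x, z), continuous (fun y : weights * R => F (cell v y.1, y.2))}]) ->
  cont_on ((cone P `&` O) `*` setT) F.
Proof.
move=> dP oO hF [e0 z0] [[[/= ce0 Pe0] Oe0] _] N nN.
have cF u (x : weights) z : P u -> O (cell u x) ->
    {for (x, z), continuous (fun y : weights * R => F (cell u y.1, y.2))}.
  move=> /hF[v [Pv uv cv]] Ox.
  (* Continuity on the parametrization of a simplex is inherited by its faces,
     so a cofinal family of simplices suffices in the hypothesis. *)
  have [Y [cY YE]] := cell_subseq uv.
  have -> : (fun y : weights * R => F (cell u y.1, y.2)) =
      (fun y : weights * R => F (cell v y.1, y.2)) \o (fun y : weights * R =>
        (Y y.1, y.2)).
    by apply/funext => y /=; rewrite YE.
  have cvx : {for (Y x, z), continuous (fun y : weights * R => F (cell v y.1, y.2))}.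
    by apply: cv; rewrite YE.
  exact: (continuous_comp (@continuous_lift_fst _ _ _ Y (x, z) (cY x)) cvx).
pose N' := interior N.
have N'F : N' (F (e0, z0)) by [].
have oN' : open N' by exact: open_interior.
have [x0 x0E] := cell_surj ce0 (subseq_refl _).
have cz : {for z0, continuous (fun z => F (e0, z))}.
  have -> : (fun z => F (e0, z)) =
     (fun y : weights * R => F (cell (word e0) y.1, y.2)) \o (fun z => (x0, z)).
    by apply/funext => z /=; rewrite x0E.
  have c0 : {for z0, continuous (fun z : R => (x0 : weights, z))}.
    by apply: continuous_pair; [exact: cst_continuous|move=> ?].
  have c1 : {for (x0 : weights, z0),
      continuous (fun y : weights * R => F (cell (word e0) y.1, y.2))}.
    by apply: cF => //; rewrite x0E.
  exact: (continuous_comp c0 c1).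
have /nbhs_ballP[eps eps0 epsN] : \forall z \near z0, N' (F (e0, z)).
  exact: (cz N' (open_nbhs_nbhs (conj oN' N'F))).
pose J := `[z0 - eps / 2, z0 + eps / 2]%classic.
have cJ : compact J by exact: segment_compact.
have nJ : nbhs z0 J.
  apply/nbhs_ballP; exists (eps / 2) => /=; first by rewrite divr_gt0.
  by move=> z /= /ltW; rewrite /J /= in_itv /= ler_distlC.
have JN z : J z -> N' (F (e0, z)).
  rewrite /J /= in_itv /= -ler_distlC => Jz; apply: epsN => /=.
  by apply: le_lt_trans Jz _; rewrite ltr_pdivrMr// ltr_pMr// ltr1n.
(* The tube around the segment [J]. Words of [O] outside the cone belong to
   [V] by convention: openness of [V] has to be tested on every
   parametrization, also of words that are not in [P]. *)
pose V : set wword := [set e | O e /\ (cone P e -> forall z, J z -> N' (F (e, z)))].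
have oV : open V.
  move=> v; rewrite openE => x [/= Ox Vx]; rewrite /interior.
  have nearO : \forall x' \near x, O (cell v x').
    by apply: cell_continuous; exact: open_nbhs_nbhs.
  have nearpos : \forall x' \near x, forall i : 'I_(size v),
      0 < (x : nat -> R) i -> 0 < (x' : nat -> R) i.
    suff h (i : 'I_(size v)) : \forall x' \near x,
        0 < (x : nat -> R) i -> 0 < (x' : nat -> R) i.
      exact: (near_forall h).
    have [xi|xi] := ltP 0 ((x : nat -> R) i); last first.
      by apply: (@near_all _ x).
    have := @coord_continuous i x _ (lt_nbhsr xi).
    by apply: (@filterS _ (nbhs x)) => x' /= ? _.
  (* For each face [m] in [P] that contains the point [x], a neighbourhood of
     [x] in which points of this face are in the tube; there are finitely many
     [m]. *)
  have nearm : \forall x' \near x, forall m : (size v).-tuple bool,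
      P (mask m v) -> (forall i, (i < size v)%N -> ~~ nth false m i ->
         (x : nat -> R) i <= 0) ->
      (forall i, (i < size v)%N -> ~~ nth false m i -> (x' : nat -> R) i <= 0) ->
      forall z, J z -> N' (F (cell v x', z)).
    suff h (m : (size v).-tuple bool) : \forall x' \near x,
      P (mask m v) -> (forall i, (i < size v)%N -> ~~ nth false m i ->
         (x : nat -> R) i <= 0) ->
      (forall i, (i < size v)%N -> ~~ nth false m i -> (x' : nat -> R) i <= 0) ->
      forall z, J z -> N' (F (cell v x', z)).
      exact: (near_forall h).
    have [Pm|nPm] := boolP (P (mask m v)); last by apply: (@near_all _ x).
    have [xm|nxm] := pselect (forall i, (i < size v)%N -> ~~ nth false m i ->
         (x : nat -> R) i <= 0); last by apply: (@near_all _ x).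
    have [Y [cY YE]] := cell_mask (size_tuple m).
    have : \forall x' \near x, J `<=` (fun z => N' (F (cell (mask m v) (Y x'), z))).
      have cover : near_covering J by apply/compact_near_coveringP.
      apply: (cover _ (nbhs x)) => z Jz.
      have c1 : {for (x, z), continuous
          (fun y : weights * R => F (cell (mask m v) (Y y.1), y.2))}.
        have -> : (fun y : weights * R => F (cell (mask m v) (Y y.1), y.2)) =
          (fun y : weights * R => F (cell (mask m v) y.1, y.2)) \o
            (fun y : weights * R => (Y y.1, y.2)) by [].
        have cm : {for (Y x, z), continuous
            (fun y : weights * R => F (cell (mask m v) y.1, y.2))}.
          by apply: cF => //; rewrite YE.
        exact: (continuous_comp (@continuous_lift_fst _ _ _ Y (x, z) (cY x)) cm).
      have c2 : {for (z, x), continuous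
          (fun y : R * weights => F (cell (mask m v) (Y y.2), y.1))}.
        have -> : (fun y : R * weights => F (cell (mask m v) (Y y.2), y.1)) =
          (fun y : weights * R => F (cell (mask m v) (Y y.1), y.2)) \o
            (fun y : R * weights => (y.2, y.1)) by [].
        have cs : {for (z, x), continuous (fun y : R * weights => (y.2, y.1))}.
          by apply: continuous_pair;
            [exact: continuous_snd|exact: continuous_fst].
        exact: (continuous_comp cs c1).
      apply: c2; apply: open_nbhs_nbhs; split=> //=.
      rewrite YE//; apply: Vx => //; split; first exact: clean_cell.
      by rewrite -YE//; exact: dP (word_cell _ _) Pm.
    by apply: (@filterS _ (nbhs x)) => x' h _ _ x'm z /h; rewrite YE.
  move: nearO nearpos nearm.
  apply: (@filterS3 _ (nbhs x)) => x' Ox' px' mx'; split=> //=.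
  move=> [_ Px'].
  (* The face spanned by the positive weights of [x']; it contains [x], since
     positive weights of [x] have stayed positive. *)
  pose m := map_tuple (fun i => 0 < (x' : nat -> R) i) (iota_tuple (size v) 0).
  have mE i : (i < size v)%N -> nth false m i = (0 < (x' : nat -> R) i).
    by move=> iv; rewrite /= (nth_map 0%N) ?size_iota// nth_iota.
  apply: (mx' m).
  - by move: Px'; rewrite word_cell_mask.
  - move=> i iv; rewrite mE// leNgt; apply: contra => xi.
    exact: (px' (Ordinal iv)).
  - by move=> i iv; rewrite mE// leNgt.
have Ve0 : V e0 by split=> // _ z; exact: JN.
have nV : nbhs e0 V by exact: open_nbhs_nbhs.
exists (V, J) => //= -[e z] [/= [Oe Ve] Jz] [[[ce Pe] _] _].
by apply: interior_subset; apply: Ve.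
Qed.

End WeightedWords.

(** * Truncation, cones over families of words and their equivalences *)

Section Truncation.
Variables (R : realType) (L : choiceType).
Implicit Types (a b c : L) (u v w : seq L) (P Q S : pred (seq L)).
Implicit Types (e o : wword R L) (d : R).

Definition shift d o : wword R L := [seq (p.1, p.2 - d) | p <- o].

Definition trunc d o : wword R L := clean (shift d o).

(** The least [d] for which subtracting [d] from all weights leaves a word in
    [P] (see [trunc_in]), for weights that are not negative. Either the first
    letter disappears too, which costs at least its weight, or it is kept, and
    then the rest has to be followed through in the words that may come after
    it. In contrast to a definition as an infimum, this is visibly continuous
    in the weights. *)
Fixpoint trunc_dist P o : R :=
  if o is (a, t) :: o' then
    let d := Num.max t (trunc_dist P o') in
    if P [:: a] then Num.min d (trunc_dist (fun u => P (a :: u)) o') else d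
  else 0.

Lemma down_cons P a : down P -> down (fun u => P (a :: u)).
Proof. by move=> dP u v uv; apply: dP; rewrite /= eqxx. Qed.

Lemma trunc_dist_ge0 P o : 0 <= trunc_dist P o.
Proof.
elim: o P => //= -[a t] o IH P.
by case: ifP => _; rewrite ?le_min ?le_max ?IH ?orbT.
Qed.

Lemma trunc_dist_anti P Q o : (forall u, P u -> Q u) ->
  trunc_dist Q o <= trunc_dist P o.
Proof.
elim: o P Q => //= -[a t] o IH P Q PQ.
have h : Num.max t (trunc_dist Q o) <= Num.max t (trunc_dist P o).
  by rewrite ge_max !le_max lexx (IH P Q) ?orbT.
have h' : trunc_dist (fun u => Q (a :: u)) o <= trunc_dist (fun u => P (a :: u)) o.
  by apply: IH => u; exact: PQ.
case: ifP => [Qa|/negbT nQa].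
  case: ifP => _; last by rewrite ge_min h.
  by rewrite le_min !ge_min h h' orbT.
by rewrite (negbTE (contra (PQ _) nQa)).
Qed.

(** Needed for [trunc_dist] to be computed on any parametrization of a point;
    a letter of nonpositive weight can always be dropped, by monotonicity in
    the family. *)
Lemma trunc_dist_clean P o : down P -> trunc_dist P (clean o) = trunc_dist P o.
Proof.
elim: o P => //= -[a t] o IH P dP; rewrite /= /clean /=.
have [t0|t0] := ltP 0 t; rewrite -/(clean o).
  by rewrite /= !IH//; exact: down_cons.
rewrite IH//.
have -> : Num.max t (trunc_dist P o) = trunc_dist P o.
  by apply/max_idPr; exact: le_trans t0 (trunc_dist_ge0 _ _).
case: ifP => // _; apply/esym/min_idPl; apply: trunc_dist_anti => u.
by apply: dP; exact: subseq_cons.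
Qed.

Lemma trunc_dist_in P o : down P -> P (word o) -> trunc_dist P o = 0.
Proof.
elim: o P => //= -[a t] o IH P dP /= Po.
have Pa : P [:: a] by apply: dP Po; rewrite /= eqxx sub0seq.
rewrite Pa (IH (fun u => P (a :: u))) //; last exact: down_cons.
by apply/min_idPr; rewrite le_max trunc_dist_ge0 orbT.
Qed.

Lemma trunc_in P o d : down P -> P [::] -> trunc_dist P o <= d -> P (word (trunc d o)).
Proof.
elim: o P => //= -[a t] o IH P dP P0.
have hd : Num.max t (trunc_dist P o) <= d -> P (word (trunc d ((a, t) :: o))).
  rewrite ge_max => /andP[td od]; rewrite /trunc /= subr_gt0 ltNge td /=.
  exact: IH.
case: ifP => [Pa|_ //]; rewrite ge_min => /orP[//|od].
have /IH : down (fun u => P (a :: u)) by exact: down_cons.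
move=> /(_ Pa od) Pw; rewrite /trunc /=; case: ifP => //= _.
by apply: dP Pw; exact: subseq_cons.
Qed.

Lemma clean_pos e : clean e = e -> forall p, p \in e -> 0 < p.2.
Proof. by move=> ce p; rewrite -ce mem_filter => /andP[]. Qed.

Lemma pos_clean e : (forall p, p \in e -> 0 < p.2) -> clean e = e.
Proof. by move=> h; apply/all_filterP/allP => p /h. Qed.

Lemma clean_cons a t o :
  clean ((a, t) :: o) = if 0 < t then (a, t) :: clean o else clean o.
Proof. by []. Qed.

Lemma clean_cat o o' : clean (o ++ o') = clean o ++ clean o'.
Proof. exact: filter_cat. Qed.

Lemma shift0 o : shift 0 o = o.
Proof. by elim: o => //= -[a t] o IH; rewrite /shift /= subr0; congr (_ :: _). Qed.

Lemma word_shift d o : word (shift d o) = word o.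
Proof. by rewrite /word /shift -map_comp. Qed.

Lemma trunc_cons a t o d :
  trunc d ((a, t) :: o) = if d < t then (a, t - d) :: trunc d o else trunc d o.
Proof. by rewrite /trunc /shift /clean /= subr_gt0. Qed.

Lemma trunc_clean d o : 0 <= d -> trunc d (clean o) = trunc d o.
Proof.
move=> d0; elim: o => [//|[a t] o IH]; rewrite clean_cons trunc_cons.
have [t0|t0] := ltP 0 t; first by rewrite trunc_cons IH.
by rewrite IH ltNge (le_trans t0 d0).
Qed.

Lemma word_trunc d o : subseq (word (trunc d o)) (word o).
Proof. by rewrite -(word_shift d o); exact: clean_subword. Qed.

Lemma trunc_dist_continuous P u : continuous (fun x : weights R =>
  trunc_dist P (weigh u x)).
Proof.
elim: u P => [|a u IH] P x; first exact: (@cst_continuous _ _ (0 : R) x).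
have cm Q : {for x, continuous
    (fun x' : weights R => trunc_dist Q (weigh u (shift_weights x')))}.
  exact: (continuous_comp (@shift_weights_continuous R x) (IH Q _)).
have cmax : {for x, continuous (fun x' : weights R =>
    Num.max ((x' : nat -> R) 0%N) (trunc_dist P (weigh u (shift_weights x'))))}.
  exact: (continuous_max (@coord_continuous R 0%N x) (cm P)).
rewrite /=; case: (P [:: a]); last exact: cmax.
exact: (continuous_min cmax (cm _)).
Qed.

Lemma cont_family_trunc_dist (T : topologicalType) (t : T) P (o : T -> wword R L) :
  cont_family t o -> {for t, continuous (fun t' => trunc_dist P (o t'))}.
Proof.
move=> [u [X [cX oE]]].
have -> : (fun t' => trunc_dist P (o t')) =
    (fun x : weights R => trunc_dist P (weigh u x)) \o X.
  by apply/funext => t'; rewrite /= (oE t').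
exact: continuous_comp cX (@trunc_dist_continuous P u _).
Qed.

Lemma cone_sub P Q : (forall u, P u -> Q u) -> @cone R L P `<=` @cone R L Q.
Proof. by move=> PQ e [ce /PQ]. Qed.

Lemma down_subseq w : down (fun u => subseq u w).
Proof. by move=> u v; exact: subseq_trans. Qed.

Definition subwords w : pred (seq L) := fun u => subseq u w.

(** The complex of a single word is a quotient of one simplex, so one
    parametrization suffices. *)
Lemma cont_on_cylinder (U : topologicalType) w (F : wword R L * R -> U) :
  (forall x z, {for (x, z), continuous
     (fun y : weights R * R => F (cell w y.1, y.2))}) ->
  cont_on (cone (subwords w) `*` setT) F.
Proof.
move=> cF; rewrite -[cone _]setIT; apply: cont_on_cells; [exact:
  down_subseq|exact: openT|].
by move=> u uw; exists w; split=> //; exact: subseq_refl.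
Qed.

Lemma cont_on_cell (U : topologicalType) w (O : set (wword R L))
    (F : wword R L -> U) :
  open O ->
  (forall x, O (cell w x) ->
     {for x, continuous (fun x : weights R => F (cell w x))}) ->
  cont_on (cone (subwords w) `&` O) F.
Proof.
move=> oO cF.
have c : cont_on ((cone (subwords w) `&` O) `*` setT) (fun y : wword R L * R => F y.1).
  apply: cont_on_cells => // [u v|u uw]; first exact: down_subseq.
  exists w; split=> //; first exact: subseq_refl.
  move=> x z Ox.
  exact: (continuous_comp (@continuous_fst _ _ (x, z)) (cF x Ox)).
apply: (@cont_on_comp _ _ _ _ _ (fun e => (e, 0 : R)) _ _ (fun _ Ae => conj Ae I) c).
apply: cont_on_pair; first by apply: cont_onT => e O'.
exact/cont_onT/cst_continuous.
Qed.

(** Preserving the apex in both directions is what makes a map of open cones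
    descend to realizations after normalization of the total weight. *)
Definition cone_rel Q : wword R L -> wword R L -> Prop :=
  fun e e' => cone Q e' /\ (e' = [::] <-> e = [::]).

Definition cone_homot P Q (f g : wword R L -> wword R L) : Prop :=
  homot R (cone P) (cone_rel Q) f g.

Definition cone_map P Q (f : wword R L -> wword R L) : Prop :=
  cont_on (cone P) f /\ forall e, cone P e -> cone_rel Q e (f e).

Lemma cone_homot_mapl P Q f g : cone_homot P Q f g -> cone_map P Q f.
Proof.
by move=> fg; split=> [|e Ae]; [exact: homot_contl fg|exact: homot_constl fg Ae].
Qed.

Lemma cone_map_id P Q : (forall u, P u -> Q u) -> cone_map P Q id.
Proof.
move=> PQ; split; first by apply: cont_onT => e O.
by move=> e Ae; split=> //; exact: cone_sub PQ _ Ae.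
Qed.

Lemma cone_homot_refl P Q f : cone_map P Q f -> cone_homot P Q f f.
Proof. by move=> [cf hf]; exact: homot_refl. Qed.

Lemma cone_homot_sym P Q f g : cone_homot P Q f g -> cone_homot P Q g f.
Proof. exact: homot_sym. Qed.

Lemma cone_homot_trans P Q f g h : cone_homot P Q f g -> cone_homot P Q g h ->
  cone_homot P Q f h.
Proof. exact: homot_trans. Qed.

Lemma cone_homot_sub P P' Q Q' f g :
  (forall u, P' u -> P u) -> (forall u, Q u -> Q' u) ->
  cone_homot P Q f g -> cone_homot P' Q' f g.
Proof.
move=> PP QQ; apply: homot_sub; first exact: cone_sub.
by move=> e e' _ [Ae' ?]; split=> //; exact: cone_sub QQ _ Ae'.
Qed.

Lemma cone_homot_pre P P' Q f g p :
  cone_map P' P p -> cone_homot P Q f g -> cone_homot P' Q (f \o p) (g \o p).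
Proof.
move=> [cp hp]; apply: (homot_pre cp) => [e /hp[]//|e e' Ae [Ae' z]].
by split=> //; rewrite z; have [_ ->] := hp e Ae.
Qed.

Lemma cone_homot_post P Q Q' f g q :
  cone_map Q Q' q -> cone_homot P Q f g -> cone_homot P Q' (q \o f) (q \o g).
Proof.
move=> [cq hq]; apply: (homot_post cq) => [e e' _ []//|e e' Ae [Ae' z]].
by have [Aq zq] := hq _ Ae'; split=> //; rewrite zq.
Qed.

Lemma cone_map_comp P Q Q' f g : cone_map P Q f -> cone_map Q Q' g ->
  cone_map P Q' (g \o f).
Proof.
by move=> /cone_homot_refl cf cg; exact: cone_homot_mapl (cone_homot_post cg cf).
Qed.

Lemma cone_map_sub P P' Q Q' f :
  (forall u, P' u -> P u) -> (forall u, Q u -> Q' u) ->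
  cone_map P Q f -> cone_map P' Q' f.
Proof.
by move=> PP QQ /cone_homot_refl cf; exact: cone_homot_mapl (cone_homot_sub PP QQ cf).
Qed.

(** The inclusion of the subcomplex [Q] is a homotopy equivalence, [j] being
    an inverse. *)
Definition cone_equiv P Q : Prop :=
  (forall u, Q u -> P u) /\
  exists j, [/\ cone_map P Q j, cone_homot P P id j & cone_homot Q Q id j].

Lemma cone_equiv_refl P : cone_equiv P P.
Proof.
split=> //; exists id; have h : cone_map P P id by exact: cone_map_id.
by split=> //; exact: cone_homot_refl.
Qed.

Lemma cone_equiv_trans P Q S : cone_equiv P Q -> cone_equiv Q S -> cone_equiv P S.
Proof.
move=> [QP [j [cj Pj Qj]]] [SQ [k [ck Qk Sk]]].
split=> [u /SQ/QP//|]; exists (k \o j); split; first exact: cone_map_comp cj ck.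
  apply: cone_homot_trans Pj _.
  by apply: cone_homot_sub (cone_homot_pre cj Qk).
apply: cone_homot_trans Sk _.
by apply: cone_homot_sub (cone_homot_post ck Qj).
Qed.

(** The other half of two-out-of-three is [cone_equiv_cancelr]; with
    [cone_equiv_trans] they let equivalences pass along zigzags of inclusions. *)
Lemma cone_equiv_cancell P Q S :
  (forall u, S u -> Q u) -> cone_equiv P Q -> cone_equiv P S -> cone_equiv Q S.
Proof.
move=> SQ [QP [j [cj Pj Qj]]] [SP [k [ck Pk Sk]]].
have ckQ : cone_map Q S k by exact: cone_map_sub ck.
split=> //; exists k; split=> //.
apply: cone_homot_trans (Qj) _.
apply: (@cone_homot_trans _ _ _ (j \o k)).
  by apply: cone_homot_sub (cone_homot_post cj Pk).
have ckQQ : cone_map Q Q k by exact: cone_map_sub ckQ.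
exact: cone_homot_sym (cone_homot_pre ckQQ Qj).
Qed.

Lemma cone_equiv_cancelr P Q S :
  (forall u, Q u -> P u) -> cone_equiv P S -> cone_equiv Q S -> cone_equiv P Q.
Proof.
move=> QP [SP [k [ck Pk Sk]]] [SQ [j [cj Qj Sj]]].
split=> //; exists k; split=> //; first exact: cone_map_sub ck.
apply: cone_homot_trans (Qj) _.
apply: (@cone_homot_trans _ _ _ (k \o j)).
  by apply: cone_homot_sub (cone_homot_pre cj Sk).
have ckQQ : cone_map Q Q k by exact: cone_map_sub ck.
exact: cone_homot_sym (cone_homot_post ckQQ Qj).
Qed.

Lemma cone_equiv_sdr P Q (H : wword R L * R -> wword R L) :
  (forall u, Q u -> P u) ->
  cont_on (cone P `*` setT) H ->
  (forall e s, cone P e -> cone_rel P e (H (e, s))) ->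
  (forall e, cone P e -> H (e, 0) = e) ->
  (forall e, cone P e -> cone Q (H (e, 1))) ->
  (forall e s, cone Q e -> H (e, s) = e) ->
  cone_equiv P Q.
Proof.
move=> QP cH hH H0 H1 HQ; split=> //.
have hP : cone_homot P P id (fun e => H (e, 1)) by exists H.
exists (fun e => H (e, 1)); split=> //.
  split; first exact: homot_contr hP.
  by move=> e Ae; split; [exact: H1|exact: (hH e 1 Ae).2].
apply: (@homot_eq _ _ _ _ _ id id) => //; first by move=> e /HQ ->.
exact: cone_homot_refl (cone_map_id _).
Qed.

End Truncation.

(** * Pushing weight to the front of a word *)

Arguments clean : simpl never.

Section Collapses.
Variables (R : realType) (L : choiceType).
Implicit Types (a b c : L) (u v w q : seq L).
Implicit Types (e o r : wword R L) (d s t : R).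

(** The weight of a leading letter [c], zero if there is none, and the rest.
    It treats a point whose word does not begin with [c] as having a leading
    [c] of weight zero. *)
Definition split_head c e : R * wword R L :=
  if e is (a, t) :: e' then if a == c then (t, e') else (0, e) else (0, [::]).

Lemma split_head_cons c t e : split_head c ((c, t) :: e) = (t, e).
Proof. by rewrite /split_head eqxx. Qed.

Lemma split_head_cases c e :
  split_head c e = (0, e) \/ exists t e', e = (c, t) :: e'.
Proof.
case: e => [|[a t] e]; first by left.
by rewrite /split_head; case: eqP => [->|_]; [right; exists t, e|left].
Qed.

Lemma split_head_word c e v :
  subseq (word e) (c :: v) -> subseq (word (split_head c e).2) v.
Proof.
case: e => [|[a t] e] /=; first by rewrite sub0seq.
by case: eqP.
Qed.

Lemma split_head_ge0 c e : clean e = e -> 0 <= (split_head c e).1.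
Proof.
case: e => [|[a t] e] //= /clean_pos h; case: eqP => //= _.
by apply: ltW; apply: (h (a, t)); rewrite mem_head.
Qed.

Lemma split_head_clean c e :
  clean e = e -> clean ((c, (split_head c e).1) :: (split_head c e).2) = e.
Proof.
case: e => [|[a t] e] /= ce; first by rewrite clean_cons ltxx.
case: eqP => [<- //|_] /=; by rewrite clean_cons ltxx.
Qed.

Lemma split_head_sub c e : subseq (word (split_head c e).2) (word e).
Proof.
case: e => [|[a t] e] //; rewrite /split_head.
by case: eqP => _; [exact: subseq_cons|exact: subseq_refl].
Qed.

(** All weights except that of the leading [c] decrease until the rest is a
    subword of [q]. The weight of [c] grows by the same amount, so that the
    list never becomes empty. *)
Definition front_push c q (y : wword R L * R) : wword R L :=
  let r := (split_head c y.1).2 in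
  let d := clip y.2 * trunc_dist (subwords q) r in
  clean ((c, (split_head c y.1).1 + d) :: shift d r).

Lemma clean_shift_clean p d o :
  0 <= d -> clean (p :: shift d (clean o)) = clean (p :: shift d o).
Proof.
move=> d0; case: p => a t; rewrite !clean_cons.
by rewrite -!/(trunc d _) trunc_clean.
Qed.

(** Reading [front_push] on the parametrization is delicate where the weight
    of the first letter vanishes: the cleaned word may then begin with another
    occurrence of [c], which [split_head] takes for the leading one. By the
    hypothesis the rest is then already a subword of [q], and nothing moves. *)
Lemma front_push_cell c q v (x : weights R) s :
  (forall u, subseq (c :: u) v -> subseq (c :: u) q) ->
  let o := weigh v (shift_weights x) in
  let d := clip s * trunc_dist (subwords q) o in
  front_push c q (cell (c :: v) x, s) =
    clean ((c, Num.max 0 ((x : nat -> R) 0%N) + d) :: shift d o).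
Proof.
move=> hq o d; rewrite /front_push /=.
have d0 : 0 <= d by rewrite mulr_ge0 ?clip_ge0 ?trunc_dist_ge0.
have dE : clip s * trunc_dist (subwords q) (clean o)
  = d by rewrite trunc_dist_clean//; exact: down_subseq.
have -> : cell (c :: v) x = if 0 < (x : nat -> R) 0%N
    then (c, (x : nat -> R) 0%N) :: clean o else clean o by [].
have [x0|x0] := ltP 0 ((x : nat -> R) 0%N).
  by rewrite split_head_cons /= dE clean_shift_clean.
rewrite add0r.
have [Es|[t [o' E]]] := split_head_cases c (clean o).
  by rewrite Es /= dE clean_shift_clean// add0r.
have wo : subseq (c :: word o') q.
  apply: hq; rewrite -[_ :: _]/(word ((c, t) :: o')) -E.
  exact: word_cell.
have d_0 : d = 0.
  by rewrite -dE E trunc_dist_in ?mulr0//; exact: down_subseq.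
have do'_0 : trunc_dist (subwords q) o' = 0.
  apply: trunc_dist_in; first exact: down_subseq.
  by apply: subseq_trans wo; exact: subseq_cons.
rewrite E split_head_cons /= do'_0 mulr0 addr0 d_0 !shift0.
by rewrite -E clean_id clean_cons ltxx.
Qed.

Lemma clip_snd_continuous (T : topologicalType) (y : T * R) :
  {for y, continuous (fun y : T * R => clip y.2)}.
Proof. exact: (continuous_comp (@continuous_snd _ _ y) (@continuous_clip R _)). Qed.

Lemma pos_coord_continuous i (y : weights R * R) :
  {for y, continuous (fun y : weights R * R => Num.max 0 ((y.1 : nat -> R) i))}.
Proof.
have c1 : {for y, continuous (fun y : weights R * R => (y.1 : nat -> R) i)}.
  exact: (continuous_comp (@continuous_fst _ _ y) (@coord_continuous R i _)).
exact: (continuous_max (@cst_continuous _ _ (0 : R) y) c1).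
Qed.

Lemma shift_weights_fst_continuous (y : weights R * R) :
  {for y, continuous (fun y : weights R * R => shift_weights y.1 : weights R)}.
Proof.
exact: (continuous_comp (@continuous_fst _ _ y) (@shift_weights_continuous R _)).
Qed.

(** The hypothesis says that any subword of [v] beginning with [c] is already
    a subword of [q]. Two occurrences of [c] that could serve as the leading
    one thus never compete, and the push is well defined on words. *)
Theorem cone_equiv_front_push c v q :
  subseq q v -> (forall u, subseq (c :: u) v -> subseq (c :: u) q) ->
  cone_equiv R (subwords (c :: v)) (subwords (c :: q)).
Proof.
move=> qv hq; apply: (@cone_equiv_sdr _ _ _ _ (front_push c q)).
- by move=> u h; apply: subseq_trans h _; rewrite /= eqxx.
- apply: cont_on_cylinder => x z.
  have -> : (fun y : weights R * R => front_push c q (cell (c :: v) y.1, y.2)) =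
    (fun y : weights R * R =>
       let d := clip y.2 * trunc_dist (subwords q) (weigh v (shift_weights y.1)) in
       clean ((c, Num.max 0 ((y.1 : nat -> R) 0%N) + d) ::
              shift d (weigh v (shift_weights y.1))) : wword R L).
    by apply/funext => y; rewrite front_push_cell.
  have cd : {for (x, z), continuous (fun y : weights R * R =>
       clip y.2 * trunc_dist (subwords q) (weigh v (shift_weights y.1)))}.
    apply: (contM (@clip_snd_continuous _ (x, z))).
    exact: (cont_family_trunc_dist (P := subwords q)
      (cont_family_weigh v (@shift_weights_fst_continuous (x, z)))).
  apply: cont_family_clean; apply: cont_family_cons.
    exact: (contD (@pos_coord_continuous 0 (x, z)) cd).
  exact: cont_family_shift cd (cont_family_weigh v (@shift_weights_fst_continuous (x, z))).
- move=> e s [ce we]; rewrite /front_push /=; set r := (split_head c e).2.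
  have tau0 : 0 <= (split_head c e).1 by exact: split_head_ge0.
  set d := _ * _.
  have d0 : 0 <= d by rewrite mulr_ge0 ?clip_ge0 ?trunc_dist_ge0.
  split; first split.
  + exact: clean_id.
  + apply: (@subseq_trans _ (word ((c, (split_head c e).1 + d) :: shift d r))).
      exact: clean_subword.
    rewrite /= eqxx -/(word (shift d r)) word_shift; exact: split_head_word.
  + have [dz|dz] := eqVneq d 0.
      by rewrite dz addr0 shift0 split_head_clean.
    have dp : 0 < d by rewrite lt_neqAle eq_sym dz.
    rewrite clean_cons ltr_wpDl//; split=> // e0.
    by move: dz; rewrite /d /r e0 /= mulr0 eqxx.
- move=> e [ce we]; rewrite /front_push /= clip0 mul0r addr0 shift0.
  exact: split_head_clean.
- move=> e [ce we]; rewrite /front_push /= clip1 mul1r.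
  split; first exact: clean_id.
  set r := (split_head c e).2; set d := trunc_dist _ _.
  have rq : subseq (word (trunc d r)) q.
    by apply: (@trunc_in R L (subwords q)) => //; [exact: down_subseq|exact: sub0seq].
  rewrite clean_cons -/(trunc d r); case: ifP => _.
    by rewrite /= /subwords /= eqxx.
  exact: subseq_trans rq (subseq_cons _ _).
- move=> e s [ce we]; rewrite /front_push /=.
  rewrite (@trunc_dist_in R L (subwords q)) ?mulr0 ?addr0 ?shift0 ?split_head_clean//.
    exact: down_subseq.
  exact: split_head_word.
Qed.

End Collapses.

(** * Replacing a leading double letter *)

Section Exchange.
Variables (R : realType) (L : choiceType).
Implicit Types (a b c : L) (u v w q x : seq L).
Implicit Types (e o r : wword R L) (d s t : R).

(** Every simplex of the complexes of [a a x] and [b b x] is in this one,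
    which is symmetric in [a] and [b]. *)
Definition join_cx a b x : pred (seq L) :=
  fun u => subwords (a :: b :: a :: x) u || subwords (b :: a :: b :: x) u.

Lemma down_join_cx a b x : down (join_cx a b x).
Proof.
move=> u v uv /orP[h|h]; apply/orP; [left|right]; exact: subseq_trans h.
Qed.

(** The weight of a leading [a] is moved to a [b] behind it, and at the same
    time the weights of the rest are decreased, until either the leading [a]
    is used up or the rest is a subword of [x]; in both cases the result is a
    subword of [b a b x]. *)
Definition second_push a b x (y : wword R L * R) : wword R L :=
  if y.1 is (a', t) :: e then
    if a' == a then
      let r := (split_head b e).2 in
      let d := clip y.2 * Num.min t (trunc_dist (subwords x) r) in
      clean ((a, t - d) :: (b, (split_head b e).1 + d) :: shift d r)
    else y.1
  else y.1.

Lemma second_push_cons a b x t e s :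
  let r := (split_head b e).2 in
  let d := clip s * Num.min t (trunc_dist (subwords x) r) in
  second_push a b x ((a, t) :: e, s) =
    clean ((a, t - d) :: (b, (split_head b e).1 + d) :: shift d r).
Proof. by rewrite /second_push /= eqxx. Qed.

Lemma second_push_no_head a b x e s :
  split_head a e = (0, e) -> second_push a b x (e, s) = e.
Proof.
case: e => [//|[a' t] e]; rewrite /split_head /second_push /=.
by case: eqP => // -> [_ /(congr1 size) /= /eqP];
  rewrite -[X in X == _]addn0 -addn1 eqn_add2l.
Qed.

Lemma second_push_fix a b x t e s :
  clean ((a, t) :: e) = (a, t) :: e -> subseq (word (split_head b e).2) x ->
  second_push a b x ((a, t) :: e, s) = (a, t) :: e.
Proof.
move=> ce wx; rewrite second_push_cons.
have t0 : 0 < t by apply: (clean_pos ce (p := (a, t))); rewrite mem_head.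
have ce' : clean e = e by move: ce; rewrite clean_cons t0 => -[].
have -> : trunc_dist (subwords x) (split_head b e).2 = 0 :> R.
  by apply: trunc_dist_in => //; exact: down_subseq.
have -> : Num.min t 0 = 0 by apply/min_idPr; exact: ltW.
by rewrite mulr0 subr0 addr0 shift0 clean_cons t0 split_head_clean.
Qed.

Lemma clean_shift_clean2 p p' d o : 0 <= d ->
  clean (p :: p' :: shift d (clean o)) = clean (p :: p' :: shift d o).
Proof.
by move=> d0; case: p => a t; rewrite !(@clean_cons _ _ a) clean_shift_clean.
Qed.

(** As for [front_push], the cleaned word may begin with another [a], or have
    another [b] in second position, when the corresponding weights vanish;
    then the rest is a subword of [x] and the push does nothing. *)
Lemma second_push_cell a b x (X : weights R) s :
  a != b ->
  let o := weigh (a :: x) (shift_weights (shift_weights X)) in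
  let d := clip s * Num.min (Num.max 0 ((X : nat -> R) 0%N))
    (trunc_dist (subwords x) o) in
  second_push a b x (cell (a :: b :: a :: x) X, s) =
    clean ((a, (X : nat -> R) 0%N - d)
      :: (b, Num.max 0 ((X : nat -> R) 1%N) + d) :: shift d o).
Proof.
move=> ab o d.
have d0 : 0 <= d.
  by rewrite mulr_ge0 ?clip_ge0// le_min le_max lexx trunc_dist_ge0.
have cE : cell (a :: b :: a :: x) X = clean ((a, (X : nat -> R) 0%N)
    :: (b, (X : nat -> R) 1%N) :: o) by [].
have neg t o' : t <= 0 -> clean ((b, t) :: o') = clean ((b, 0) :: o').
  by move=> t0; rewrite !clean_cons ltxx ltNge t0.
have wo : subseq (word (clean o)) (a :: x) by exact: word_cell.
have [X0|X0] := ltP 0 ((X : nat -> R) 0%N); last first.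
  have dz : d = 0.
    rewrite /d; have -> : Num.max 0 ((X : nat -> R) 0%N) = 0 by apply/max_idPl.
    have -> : Num.min 0 (trunc_dist (subwords x) o) = 0 by apply/min_idPl; exact:
      trunc_dist_ge0.
    by rewrite mulr0.
  rewrite cE dz subr0 addr0 shift0 !(@clean_cons _ _ a) ltNge X0 /=.
  have [X1|X1] := ltP 0 ((X : nat -> R) 1%N).
    rewrite !(@clean_cons _ _ b) X1 second_push_no_head//.
    by rewrite /split_head eq_sym (negbTE ab).
  rewrite !(@clean_cons _ _ b) ltxx ltNge X1 /=.
  have [h|[t [e E]]] := split_head_cases a (clean o); first exact: second_push_no_head.
  rewrite E second_push_fix -?E ?clean_id//.
  move: wo; rewrite E /= eqxx => h.
  by apply: subseq_trans h; exact: split_head_sub.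
have mX : Num.max 0 ((X : nat -> R) 0%N) = (X : nat -> R) 0%N.
  by apply/max_idPr; exact: ltW.
rewrite cE !(@clean_cons _ _ a) X0 second_push_cons.
have -> : clean ((b, (X : nat -> R) 1%N) :: o)
        = if 0 < (X : nat -> R) 1%N then (b, (X : nat -> R) 1%N) :: clean o
          else clean o by rewrite clean_cons.
have dE : clip s * Num.min ((X : nat -> R) 0%N) (trunc_dist (subwords x) (clean o)) = d.
  by rewrite /d mX trunc_dist_clean//; exact: down_subseq.
clearbody d o.
have [X1|X1] := ltP 0 ((X : nat -> R) 1%N).
  by rewrite split_head_cons /= dE clean_shift_clean2.
rewrite add0r.
have [Es|[t [e E]]] := split_head_cases b (clean o).
  by rewrite Es /= dE add0r clean_shift_clean2.
have wx : subseq (word ((b, t) :: e)) x.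
  by move: wo; rewrite E /= eq_sym (negbTE ab).
have dz : d = 0.
  rewrite -dE E trunc_dist_in//; last exact: down_subseq.
  have -> : Num.min ((X : nat -> R) 0%N) 0 = 0 by apply/min_idPr; exact: ltW.
  by rewrite mulr0.
rewrite E split_head_cons /= trunc_dist_in; [|exact: down_subseq|].
  have -> : Num.min ((X : nat -> R) 0%N) 0 = 0 by apply/min_idPr; exact: ltW.
  rewrite mulr0 dz subr0 !addr0 !shift0 -E !(@clean_cons _ _ a) clean_id.
  by rewrite (@clean_cons _ _ b) ltxx.
by apply: subseq_trans wx; exact: subseq_cons.
Qed.

Lemma split_head_ncons c u e : subseq (word e) (c :: u) -> split_head c e = (0, e) ->
  subseq (word e) u.
Proof. by move=> /split_head_word h E; rewrite E in h. Qed.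

Lemma second_push_id a b x e s : a != b ->
  cone (subwords (b :: a :: b :: x)) e -> second_push a b x (e, s) = e.
Proof.
move=> ab [ce we].
have [h|[t [e' E]]] := split_head_cases a e; first exact: second_push_no_head.
rewrite E in we ce *; apply: second_push_fix => //; apply: split_head_word.
by move: we; rewrite /subwords /= (negbTE ab) eqxx.
Qed.

Lemma join_cases a b x e : a != b -> cone (join_cx a b x) e ->
  cone (subwords (b :: a :: b :: x)) e \/
  exists t e', e = (a, t) :: e' /\ subseq (word (split_head b e').2) (a :: x).
Proof.
move=> ab [ce /orP[we|]]; last by left.
have [h|[t [e' E]]] := split_head_cases a e.
  left; split=> //; have h1 := split_head_ncons we h.
  by apply: subseq_trans h1 _; rewrite /= !eqxx; exact: subseq_cons.
right; exists t, e'; split=> //; apply: split_head_word.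
by move: we; rewrite E /subwords /= eqxx.
Qed.

Lemma second_push_cone_rel a b x e s : a != b ->
  cone (join_cx a b x) e -> cone_rel (join_cx a b x) e (second_push a b x (e, s)).
Proof.
move=> ab Ae; have [hb|[t [e' [E wr]]]] := join_cases ab Ae.
  by rewrite second_push_id.
rewrite E in Ae *; case: Ae => ce we; rewrite second_push_cons.
set r := (split_head b e').2 in wr *; set d := clip s * _.
have t0 : 0 < t by apply: (clean_pos ce (p := (a, t))); rewrite mem_head.
have ce' : clean e' = e' by move: ce; rewrite clean_cons t0 => -[].
have d0 : 0 <= d.
  by rewrite mulr_ge0 ?clip_ge0// le_min trunc_dist_ge0 (ltW t0).
split; first split; first exact: clean_id.
- apply/orP; left; rewrite /subwords.
  apply: (@subseq_trans _ (a :: b :: word r)); last by rewrite /= !eqxx.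
  apply: (subseq_trans (clean_subword _)).
  by rewrite /= !eqxx -/(word (shift d r)) word_shift.
- split=> // e0; exfalso.
  have [dz|dz] := eqVneq d 0.
    by move: e0; rewrite dz subr0 addr0 shift0 clean_cons t0.
  have dp : 0 < d by rewrite lt_neqAle eq_sym dz.
  move: e0; rewrite clean_cons; case: ifP => // _.
  by rewrite clean_cons ltr_wpDl//; exact: split_head_ge0.
Qed.

Lemma second_push_end a b x e : a != b ->
  cone (join_cx a b x) e -> cone (subwords (b :: a :: b :: x))
    (second_push a b x (e, 1)).
Proof.
move=> ab Ae; have [hb|[t [e' [E wr]]]] := join_cases ab Ae.
  by rewrite second_push_id.
rewrite E second_push_cons clip1 mul1r.
set r := (split_head b e').2 in wr *; split; first exact: clean_id.
(* If the weight [t] of the leading [a] is used up first, a subword of [b a x]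
   remains; otherwise the rest has become a subword of [x]. *)
have [td|dt] := leP t (trunc_dist (subwords x) r).
  rewrite clean_cons subrr ltxx /subwords.
  apply: (@subseq_trans _ (b :: a :: x)).
    apply: (subseq_trans (clean_subword _)).
    by rewrite /= eqxx -/(word (shift t r)) word_shift.
  by rewrite /= !eqxx; exact: subseq_cons.
set d := trunc_dist _ _.
have rx : subseq (word (trunc d r)) x.
  by apply: (@trunc_in R L (subwords x)) => //; [exact: down_subseq|exact: sub0seq].
apply: (@subseq_trans _ (a :: b :: word (trunc d r))); last first.
  by rewrite /= (negbTE ab) !eqxx.
rewrite clean_cons; case: ifP => _; rewrite clean_cons; case: ifP => _.
- exact: subseq_refl.
- by rewrite /= eqxx; exact: subseq_cons.
- exact: subseq_cons.
- exact: subseq_trans (subseq_cons _ b) (subseq_cons _ a).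
Qed.

Lemma shift_weights2_fst_continuous (y : weights R * R) :
  {for y, continuous
    (fun y : weights R * R => shift_weights (shift_weights y.1) : weights R)}.
Proof.
exact: (continuous_comp (@shift_weights_fst_continuous R y)
  (@shift_weights_continuous R _)).
Qed.

Lemma second_push_cont_on a b x : a != b ->
  cont_on (cone (join_cx a b x) `*` setT) (second_push a b x).
Proof.
move=> ab.
have cc := @cont_on_cells R L (join_cx a b x) setT _ (second_push a b x).
rewrite setIT in cc; apply: cc; [exact: down_join_cx|exact: openT|].
move=> u /orP[uv|uv].
  exists (a :: b :: a :: x); split=> //.
    by apply/orP; left; exact: subseq_refl.
  move=> X z _.
  pose o (y : weights R * R) := weigh (a :: x) (shift_weights (shift_weights y.1)).
  pose d (y : weights R * R) := clip y.2 *
    Num.min (Num.max 0 ((y.1 : nat -> R) 0%N)) (trunc_dist (subwords x) (o y)).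
  have -> : (fun y : weights R * R =>
      second_push a b x (cell (a :: b :: a :: x) y.1, y.2)) =
    (fun y => clean ((a, (y.1 : nat -> R) 0%N - d y)
      :: (b, Num.max 0 ((y.1 : nat -> R) 1%N) + d y) :: shift (d y) (o y))
      : wword R L).
    by apply/funext => y; rewrite second_push_cell.
  have fo : cont_family (X, z) o by exact: (cont_family_weigh (a :: x)
    (@shift_weights2_fst_continuous (X, z))).
  have cd : {for (X, z), continuous d}.
    apply: (contM (@clip_snd_continuous R _ (X, z))).
    exact: (cont_min (@pos_coord_continuous R 0%N (X, z)) (cont_family_trunc_dist fo)).
  apply: cont_family_clean; apply: cont_family_cons.
    apply: contB cd.
    exact: (continuous_comp (@continuous_fst _ _ (X, z)) (@coord_continuous R 0%N _)).
  apply: cont_family_cons; last exact: cont_family_shift cd fo.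
  exact: (contD (@pos_coord_continuous R 1%N (X, z)) cd).
exists (b :: a :: b :: x); split=> //.
  by apply/orP; right; exact: subseq_refl.
move=> X z _.
have -> : (fun y : weights R * R =>
    second_push a b x (cell (b :: a :: b :: x) y.1, y.2)) =
  (fun y => clean (weigh (b :: a :: b :: x) y.1) : wword R L).
  apply/funext => y; apply: second_push_id => //.
  by apply: cone_cell; [exact: down_subseq|exact: subseq_refl].
apply: cont_family_clean; exact: (cont_family_weigh _ (@continuous_fst _ _ (X, z))).
Qed.

Theorem cone_equiv_second_push a b x : a != b ->
  cone_equiv R (join_cx a b x) (subwords (b :: a :: b :: x)).
Proof.
move=> ab; apply: (@cone_equiv_sdr _ _ _ _ (second_push a b x)).
- by move=> u h; apply/orP; right.
- exact: second_push_cont_on.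
- by move=> e s; exact: second_push_cone_rel.
- move=> e Ae; have [hb|[t [e' [E wr]]]] := join_cases ab Ae.
    by rewrite second_push_id.
  case: Ae => + _; rewrite E => ce.
  rewrite second_push_cons clip0 mul0r subr0 addr0 shift0.
  have t0 : 0 < t by apply: (clean_pos ce (p := (a, t))); rewrite mem_head.
  by move: (ce); rewrite !(@clean_cons _ _ a) t0 => -[ce']; rewrite split_head_clean.
- by move=> e; exact: second_push_end.
- by move=> e s; exact: second_push_id.
Qed.

(** In [a b x] all subwords beginning with [b] are subwords of [b x]; so
    [front_push] retracts [b a b x], where [second_push] ends, to [b b x]. *)
Theorem cone_equiv_join a b x : a != b -> cone_equiv R (join_cx a b x)
  (subwords (b :: b :: x)).
Proof.
move=> ab; apply: cone_equiv_trans (cone_equiv_second_push x ab) _.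
apply: cone_equiv_front_push; first exact: subseq_cons.
by move=> u; rewrite /= eq_sym (negbTE ab) eqxx.
Qed.

Lemma join_cxC a b x : join_cx a b x = join_cx b a x.
Proof. by apply/funext => u; rewrite /join_cx orbC. Qed.

(** The equivalence for [b] is carried to [a] through the complexes [join_cx],
    which contain the double words of both letters. The point is that [b] can
    be taken outside [x] while [a] cannot. *)
Lemma cone_equiv_double a b x y : a != b -> subseq y x ->
  cone_equiv R (subwords (b :: b :: x)) (subwords (b :: b :: y)) ->
  cone_equiv R (subwords (a :: a :: x)) (subwords (a :: a :: y)).
Proof.
move=> ab yx bxy.
have ba : b != a by rewrite eq_sym.
have Kyx u : join_cx a b y u -> join_cx a b x u.
  case/orP => h; apply/orP; [left|right]; apply: subseq_trans h _;
  by rewrite /= !eqxx.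
have Kx := cone_equiv_join x ba; rewrite join_cxC in Kx.
have Ky := cone_equiv_join y ba; rewrite join_cxC in Ky.
have KK : cone_equiv R (join_cx a b x) (join_cx a b y).
  apply: (cone_equiv_cancelr Kyx _ (cone_equiv_join y ab)).
  exact: cone_equiv_trans (cone_equiv_join x ab) bxy.
apply: (cone_equiv_cancell _ Kx (cone_equiv_trans KK Ky)).
by move=> u h; apply: subseq_trans h _; rewrite /= !eqxx.
Qed.

End Exchange.

(** * Joining with a circle *)

Section CircleJoin.
Variables (R : realType) (L : choiceType) (b : L).
Implicit Types (a c : L) (u v w x y : seq L).
Implicit Types (e o r : wword R L) (d s t : R).

Definition heads e : wword R L := [seq p <- e | p.1 == b].
Definition tails e : wword R L := [seq p <- e | p.1 != b].

Lemma word_heads e : word (heads e) = [seq a <- word e | a == b].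
Proof. by rewrite /word filter_map. Qed.

Lemma word_tails e : word (tails e) = [seq a <- word e | a != b].
Proof. by rewrite /word filter_map. Qed.

Lemma heads_clean e : clean (heads e) = heads (clean e).
Proof.
by rewrite /clean /heads -!filter_predI; apply: eq_filter => p /=; rewrite andbC.
Qed.

Lemma tails_clean e : clean (tails e) = tails (clean e).
Proof.
by rewrite /clean /tails -!filter_predI; apply: eq_filter => p /=; rewrite andbC.
Qed.

Lemma filter_notin x : b \notin x -> [seq a <- x | a != b] = x.
Proof.
move=> bx; apply/all_filterP/allP => a ax.
by apply: contra bx => /eqP <-.
Qed.

Lemma filter_notin0 x : b \notin x -> [seq a <- x | a == b] = [::].
Proof.
move=> bx; apply/eqP; rewrite -(negbK (_ == _)) -has_filter; apply/hasPn => a ax.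
by apply: contra bx => /eqP <-.
Qed.

Lemma heads_cons t e : heads ((b, t) :: e) = (b, t) :: heads e.
Proof. by rewrite /heads /= eqxx. Qed.

Lemma tails_cons t e : tails ((b, t) :: e) = tails e.
Proof. by rewrite /tails /= eqxx. Qed.

Lemma tails_sub x e : b \notin x ->
  subseq (word e) (b :: b :: x) -> subseq (word (tails e)) x.
Proof.
move=> bx we; rewrite word_tails.
have -> : x = [seq a <- [:: b, b & x] | predC1 b a].
  by rewrite /= eqxx /= -[LHS](filter_notin bx).
rewrite subseq_filter filter_all /=.
exact: subseq_trans (filter_subseq _ _) we.
Qed.

Lemma heads_sub x e : b \notin x ->
  subseq (word e) (b :: b :: x) -> subseq (word (heads e)) [:: b; b].
Proof.
move=> bx we; rewrite word_heads.
have -> : [:: b; b] = [seq a <- [:: b, b & x] | pred1 b a].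
  by rewrite /= eqxx -[[seq _ <- x | _]]/[seq a <- x | a == b] filter_notin0.
rewrite subseq_filter filter_all /=.
exact: subseq_trans (filter_subseq _ _) we.
Qed.

(** A simplex of the complex of [b b x] is a simplex of the circle [b b]
    followed by one of the complex of [x], in a unique way because [b] does
    not occur in [x]. *)
Lemma heads_tails x e : b \notin x ->
  subseq (word e) (b :: b :: x) -> heads e ++ tails e = e.
Proof.
move=> bx.
have h0 e' : subseq (word e') x -> heads e' = [::] /\ tails e' = e'.
  move=> we'; have be : b \notin word e' by apply: contra bx; exact: mem_subseq.
  split.
    have := congr1 size (word_heads e'); rewrite filter_notin0// /word size_map.
    by move=> /size0nil.
  apply/all_filterP/allP => p pe; apply: contra be => /eqP <-.
  exact: map_f.
have h1 e' : subseq (word e') (b :: x) -> heads e' ++ tails e' = e'.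
  case: e' => [//|[a t] e'] we'; have [ab|ab] := eqVneq a b.
    have /h0[hd0 tl0] : subseq (word e') x by move: we'; rewrite ab /= eqxx.
    by rewrite ab heads_cons tails_cons hd0 tl0.
  have /h0[-> ->//] : subseq (word ((a, t) :: e')) x.
  by move: we'; rewrite /= (negbTE ab).
case: e => [//|[a t] e] we; have [ab|ab] := eqVneq a b.
  have /h1 e_eq : subseq (word e) (b :: x) by move: we; rewrite ab /= eqxx.
  by rewrite ab heads_cons tails_cons /= e_eq.
apply: h1; have := we; rewrite -[word _]/(a :: word e).
by rewrite {1}/subseq -/subseq (negbTE ab).
Qed.

Lemma clean_cons_clean p o : clean (p :: clean o) = clean (p :: o).
Proof. by case: p => a t; rewrite !clean_cons clean_id. Qed.

(** The join of the identity of the circle [b b] with [f]. *)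
Definition lift_tails (f : wword R L -> wword R L) e : wword R L :=
  heads e ++ f (tails e).

Definition cons_b (y : wword R L * R) : wword R L := clean ((b, y.2) :: y.1).

(** Adding a letter in front is jointly continuous in its weight and in the
    rest of the word, for all words at once: the homotopies to be joined are
    not known on parametrizations. *)
Lemma cons_b_cont_on : cont_on (cone predT `*` setT) cons_b.
Proof.
have cc := @cont_on_cells R L predT setT _ cons_b.
rewrite setIT in cc; apply: cc; [by []|exact: openT|].
move=> u _; exists u; split=> //.
move=> X z _.
have -> : (fun y : weights R * R => cons_b (cell u y.1, y.2)) =
    (fun y : weights R * R => clean ((b, y.2) :: weigh u y.1) : wword R L).
  by apply/funext => y; rewrite /cons_b !clean_cons clean_id.
apply: cont_family_clean; apply: cont_family_cons; first exact: continuous_snd.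
exact: (cont_family_weigh u (@continuous_fst _ _ (X, z))).
Qed.

Lemma cont_on_cons_b (T : topologicalType) (B : set T) (f : T -> R) (g : T ->
  wword R L) :
  cont_on B f -> cont_on B g -> (forall k, B k -> clean (g k) = g k) ->
  cont_on B (fun k => clean ((b, f k) :: g k) : wword R L).
Proof.
move=> cf cg hg.
apply: (@cont_on_comp _ _ _ _ (cone predT `*` setT) (fun k => (g k, f k)) cons_b).
- exact: cont_on_pair.
- by move=> k Bt; split=> //; split=> //; exact: hg.
- exact: cons_b_cont_on.
Qed.

Lemma cell_bbE x (X : weights R) :
  cell (b :: b :: x) X = clean ((b, (X : nat -> R) 0%N) ::
    clean ((b, (X : nat -> R) 1%N) ::
      cell x (shift_weights (shift_weights X)))).
Proof.
by rewrite [in RHS]/cell (clean_cons_clean (b, (X : nat -> R) 1%N))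
  clean_cons_clean.
Qed.

Lemma heads_tails_cell x (X : weights R) : b \notin x ->
  heads (cell x X) = [::] /\ tails (cell x X) = cell x X.
Proof.
move=> bx; have nb : b \notin word (cell x X).
  by apply: contra bx; apply: mem_subseq; exact: word_cell.
split.
  apply/eqP; rewrite -(negbK (_ == _)) -has_filter; apply/hasPn => p pe.
  by apply: contra nb => /eqP <-; exact: map_f.
apply/all_filterP/allP => p pe; apply: contra nb => /eqP <-.
exact: map_f.
Qed.

Lemma heads_cell x (X : weights R) : b \notin x ->
  heads (cell (b :: b :: x) X) =
  clean [:: (b, (X : nat -> R) 0%N); (b, (X : nat -> R) 1%N)].
Proof.
move=> /heads_tails_cell bx; rewrite cell_bbE.
rewrite !(@clean_cons _ _ b ((X : nat -> R) 0%N)) !clean_id.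
rewrite !(@clean_cons _ _ b ((X : nat -> R) 1%N)) clean_cell.
by do 2 case: ifP => _; rewrite 2?heads_cons (bx _).1.
Qed.

Lemma tails_cell x (X : weights R) : b \notin x ->
  tails (cell (b :: b :: x) X) = cell x (shift_weights (shift_weights X)).
Proof.
move=> /heads_tails_cell bx; rewrite cell_bbE.
rewrite !(@clean_cons _ _ b ((X : nat -> R) 0%N)) !clean_id.
rewrite !(@clean_cons _ _ b ((X : nat -> R) 1%N)) clean_cell.
by do 2 case: ifP => _; rewrite 2?tails_cons (bx _).2.
Qed.

Lemma lift_tails_cell f x (X : weights R) :
  b \notin x -> (forall X', clean (f (cell x X')) = f (cell x X')) ->
  lift_tails f (cell (b :: b :: x) X) =
  clean ((b, (X : nat -> R) 0%N) :: clean ((b, (X : nat -> R) 1%N) ::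
     f (cell x (shift_weights (shift_weights X))))).
Proof.
move=> bx hf; rewrite /lift_tails heads_cell// tails_cell//.
rewrite !(@clean_cons _ _ b ((X : nat -> R) 0%N)) !clean_id.
rewrite !(@clean_cons _ _ b ((X : nat -> R) 1%N)) hf.
by do 2 case: ifP.
Qed.

Lemma lift_tails_cone_homot x y f g : b \notin x ->
  cone_homot (subwords x) (subwords y) f g ->
  cone_homot (subwords (b :: b :: x)) (subwords (b :: b :: y)) (lift_tails f)
    (lift_tails g).
Proof.
move=> bx [H [cH hH H0 H1]].
have At e : cone (subwords (b :: b :: x)) e -> cone (subwords x) (tails e).
  by move=> [ce we]; split; [rewrite tails_clean ce|exact: tails_sub].
exists (fun y : wword R L * R => lift_tails (fun e => H (e, y.2)) y.1); split.
- apply: cont_on_cylinder => X z.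
  have Hc X' s : clean (H (cell x X', s)) = H (cell x X', s).
    have [[//]] := hH (cell x X') s (cone_cell _ (@down_subseq L x) (subseq_refl x)).
  have -> : (fun y : weights R * R =>
      lift_tails (fun e => H (e, y.2)) (cell (b :: b :: x) y.1)) =
    (fun y : weights R * R => clean ((b, (y.1 : nat -> R) 0%N) :: clean ((b,
      (y.1 : nat -> R) 1%N) ::
     H (cell x (shift_weights (shift_weights y.1)), y.2)) : wword R L) : wword R L).
    by apply/funext => -[X' s]; rewrite lift_tails_cell.
  apply: cont_on_setT.
  have coord i : cont_on setT (fun y : weights R * R => (y.1 : nat -> R) i).
    apply: cont_onT => Y.
    exact: (continuous_comp (@continuous_fst _ _ Y) (@coord_continuous R i _)).
  apply: cont_on_cons_b (coord 0%N) _ _; last by move=> t _; exact: clean_id.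
  apply: cont_on_cons_b (coord 1%N) _ _ => //.
  apply: (@cont_on_comp _ _ _ _ (cone (subwords x) `*` setT)
    (fun y : weights R * R => (cell x (shift_weights (shift_weights y.1)), y.2)) H)
    => //.
    apply: cont_on_pair; last exact/cont_onT/continuous_snd.
    apply: cont_onT => Y.
    exact: (continuous_comp (@shift_weights2_fst_continuous R Y)
      (@cell_continuous R L x _)).
  move=> Y _; split=> //=; apply: cone_cell; first exact: down_subseq.
  exact: subseq_refl.
- move=> e s Ae; have [ce we] := Ae.
  have [[cH' wH] zH] := hH (tails e) s (At _ Ae).
  have eE := heads_tails bx we.
  split; first split.
  + by rewrite /lift_tails clean_cat heads_clean ce cH'.
  + rewrite /lift_tails /word map_cat /subwords -[[:: b, b & y]]/([:: b; b] ++ y).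
    by apply: cat_subseq => //; exact: heads_sub we.
  + have cat0 (o o' : wword R L) : o ++ o' = [::] <-> o = [::] /\ o' = [::].
      by split=> [|[-> ->//]]; case: o.
    have e0 : e = [::] <-> heads e = [::] /\ tails e = [::].
      by rewrite -{1}eE; exact: cat0.
    rewrite /lift_tails; split.
      by move=> /(cat0 _ _).1[h0 h1]; apply/e0; split=> //; apply/zH.
    by move=> /e0[h0 h1]; apply/cat0; split=> //; apply/zH.
- by move=> e Ae; rewrite /lift_tails /= H0//; exact: At.
- by move=> e Ae; rewrite /lift_tails /= H1//; exact: At.
Qed.

Lemma lift_tails_id x e : b \notin x -> cone (subwords (b :: b :: x)) e ->
  lift_tails id e = e.
Proof. by move=> bx [_ we]; rewrite /lift_tails (heads_tails bx we). Qed.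

Lemma cone_equiv_circle_join x y : b \notin x ->
  cone_equiv R (subwords x) (subwords y) -> cone_equiv R (subwords (b :: b :: x))
    (subwords (b :: b :: y)).
Proof.
move=> bx [yx [j [cj xj yj]]].
have yx' : subseq y x by apply: yx; exact: subseq_refl.
have by_ : b \notin y by apply: contra bx; exact: mem_subseq.
split; first by move=> u h; apply: subseq_trans h _; rewrite /= !eqxx.
exists (lift_tails j); split.
- exact: cone_homot_mapl (lift_tails_cone_homot bx (cone_homot_refl cj)).
- apply: homot_eq (lift_tails_cone_homot bx xj) => // e; exact: lift_tails_id.
- apply: homot_eq (lift_tails_cone_homot by_ yj) => // e; exact: lift_tails_id.
Qed.

End CircleJoin.

(** * Collapsing a circle joined with a point *)

Section RightCone.
Variables (R : realType) (L : choiceType) (b c : L).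
Hypothesis bc : b != c.
Implicit Types (a : L) (e o : wword R L) (s : R).

(** Points of the realization are the weighted words of mass one. *)
Definition mass e : R := \sum_(p <- e) p.2.

(** The linear contraction of the complex of [b b c] to its cone point [c],
    which keeps the mass constant. *)
Definition right_push (y : wword R L * R) : wword R L :=
  clean (rcons [seq (p.1, (1 - clip y.2) * p.2) | p <- heads b y.1]
    (c, mass (tails b y.1) + clip y.2 * mass (heads b y.1))).

Lemma mass_clean o : mass (clean o) = \sum_(p <- o) Num.max 0 p.2.
Proof.
rewrite /mass; elim: o => [|[a t] o IH]; first by rewrite !big_nil.
rewrite big_cons clean_cons -IH /=; have [t0|t0] := ltP 0 t.
  by rewrite big_cons.
by rewrite add0r.
Qed.

Lemma scale_clean (k : R) o : 0 <= k ->
  clean [seq (p.1, k * p.2) | p <- clean o] =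
  clean [seq (p.1, k * Num.max 0 p.2) | p <- o].
Proof.
move=> k0; elim: o => [//|[a t] o IH].
rewrite clean_cons /= [RHS]clean_cons; have [t0|t0] := ltP 0 t.
  by rewrite /= clean_cons IH.
by rewrite mulr0 ltxx.
Qed.

Lemma right_push_cell (X : weights R) s :
  right_push (cell [:: b; b; c] X, s) =
  let m i := Num.max 0 ((X : nat -> R) i) in
  clean [:: (b, (1 - clip s) * m 0%N); (b, (1 - clip s) * m 1%N);
    (c, m 2 + clip s * (m 0%N + m 1%N))].
Proof.
rewrite /right_push /= /cell -heads_clean -tails_clean -cats1 clean_cat.
have -> : heads b (weigh [:: b; b; c] X) =
    [:: (b, (X : nat -> R) 0%N); (b, (X : nat -> R) 1%N)].
  by rewrite /heads /= !eqxx eq_sym (negbTE bc).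
have -> : tails b (weigh [:: b; b; c] X) = [:: (c, (X : nat -> R) 2)].
  by rewrite /tails /= !eqxx eq_sym bc.
rewrite scale_clean ?subr_ge0 ?clip_le1// !mass_clean !big_cons !big_nil /=.
by rewrite !addr0 -clean_cat.
Qed.

Lemma clean_positive o : clean [seq (p.1, Num.max 0 p.2) | p <- o] = clean o.
Proof.
elim: o => [//|[a t] o IH]; rewrite /= !clean_cons IH.
by have [t0|t0] := ltP 0 t; rewrite ?ltxx ?t0.
Qed.

Lemma cell_bbcE (X : weights R) : cell [:: b; b; c] X =
  let m i := Num.max 0 ((X : nat -> R) i) in
  clean [:: (b, m 0%N); (b, m 1%N); (c, m 2)].
Proof. by rewrite /cell -clean_positive. Qed.

Lemma clean3_nil a a' a'' (t t' t'' : R) :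
  clean [:: (a, t); (a', t'); (a'', t'')] = [::] :> wword R L <->
  [/\ t <= 0, t' <= 0 & t'' <= 0].
Proof.
rewrite !clean_cons.
by have [h|h] := ltP 0 t; have [h'|h'] := ltP 0 t';
  have [h''|h''] := ltP 0 t''; split=> // -[].
Qed.

Theorem cone_equiv_right_push : cone_equiv R (subwords [:: b; b; c]) (subwords [:: c]).
Proof.
have bn : b \notin [:: c] by rewrite inE.
apply: (@cone_equiv_sdr _ _ _ _ right_push).
- by move=> u h; apply: subseq_trans h (suffix_subseq [:: b; b] [:: c]).
- apply: cont_on_cylinder => X z.
  have -> : (fun y : weights R * R => right_push (cell [:: b; b; c] y.1, y.2)) =
   (fun y : weights R * R =>
  let m i := Num.max 0 ((y.1 : nat -> R) i) in
  clean [:: (b, (1 - clip y.2) * m 0%N); (b, (1 - clip y.2) * m 1%N);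
    (c, m 2 + clip y.2 * (m 0%N + m 1%N))] : wword R L).
    by apply/funext => y; rewrite right_push_cell.
  have cp i := @pos_coord_continuous R i (X, z).
  have cs := @clip_snd_continuous R _ (X, z).
  have cs' := contB (@cst_continuous _ _ (1 : R) (X, z)) cs.
  apply: cont_family_clean; apply: cont_family_cons; first exact: (contM cs' (cp _)).
  apply: cont_family_cons; first exact: (contM cs' (cp _)).
  apply: cont_family_cons; last exact: cont_family_nil.
  exact: (contD (cp _) (contM cs (contD (cp _) (cp _)))).
- move=> e s [ce we]; have [X <-] := cell_surj ce we.
  rewrite right_push_cell cell_bbcE /=.
  have m_ge0 i : 0 <= Num.max 0 ((X : nat -> R) i) by rewrite le_max lexx.
  move: (m_ge0 0%N) (m_ge0 1%N) (m_ge0 2) (clip_ge0 s) (clip_le1 s).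
  set m0 := Num.max 0 _; set m1 := Num.max 0 _; set m2 := Num.max 0 _.
  set t := clip s => h0 h1 h2 t0 t1.
  split; first by split; [exact: clean_id|exact: clean_subword].
  rewrite !clean3_nil; split=> -[g0 g1 g2]; last first.
    have -> : m0 = 0 by apply/eqP; rewrite eq_le h0 g0.
    have -> : m1 = 0 by apply/eqP; rewrite eq_le h1 g1.
    by rewrite !mulr0 addr0 mulr0 addr0 g2.
  (* If everything vanishes, then either the factor [1 - t] of the weights of
     [b] is positive or the weight received by [c] is. *)
  have [t12|t12] := leP t (1 / 2).
    have p1 : 0 < 1 - t by lra.
    rewrite !pmulr_rle0// in g0 g1; split=> //.
    by have := mulr_ge0 t0 (addr_ge0 h0 h1); lra.
  have g3 := mulr_ge0 t0 (addr_ge0 h0 h1).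
  have g4 : t * (m0 + m1) <= 0 by lra.
  by rewrite pmulr_rle0 in g4; [split; lra|lra].
- move=> e [ce we]; have [X <-] := cell_surj ce we.
  by rewrite right_push_cell cell_bbcE /= clip0 subr0 !mul1r mul0r addr0.
- move=> e [ce we]; have [X <-] := cell_surj ce we.
  rewrite right_push_cell /= clip1 subrr !mul0r !(@clean_cons _ _ b) !ltxx.
  by split; [exact: clean_id|exact: clean_subword].
- move=> e s [ce we]; have [X <-] := cell_surj ce we.
  have -> : cell [:: c] X = cell [:: b; b; c]
     (cons_weights 0 (cons_weights 0 X) : weights R).
    by rewrite cell_bbcE /= maxxx !(@clean_cons _ _ b) ltxx /cell -clean_positive.
  by rewrite right_push_cell cell_bbcE /= maxxx addr0 !mulr0 addr0.
Qed.

End RightCone.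

(** * Equivalences between subword cones *)

Section Words.
Variables (R : realType) (L : choiceType) (b : L).
Implicit Types (a c : L) (u v w x y q : seq L).

(** A subword beginning with [a] can only begin after [v]. *)
Lemma subseq_skip a u v w : a \notin v ->
  subseq (a :: u) (v ++ w) -> subseq (a :: u) w.
Proof.
elim: v => [//|c v IH]; rewrite inE negb_or => /andP[ac av].
rewrite cat_cons.
rewrite -[subseq _ _]/(subseq (if a == c then u else a :: u) (v ++ w)).
by rewrite (negbTE ac); exact: IH.
Qed.

Lemma cone_equiv_cone a v : a \notin v -> cone_equiv R (subwords (a :: v))
  (subwords [:: a]).
Proof.
move=> av; apply: cone_equiv_front_push; first exact: sub0seq.
by move=> u /mem_subseq/(_ a); rewrite mem_head (negbTE av) => /(_ isT).
Qed.

Lemma cone_equiv_circular a v x : a \notin v ->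
  cone_equiv R (subwords (a :: v ++ a :: x)) (subwords (a :: a :: x)).
Proof.
move=> av; apply: cone_equiv_front_push; first exact: suffix_subseq.
move=> u; exact: subseq_skip.
Qed.

Lemma cone_equiv_suffix a x y : a != b -> b \notin x -> subseq y x ->
  cone_equiv R (subwords x) (subwords y) -> cone_equiv R (subwords (a :: a :: x))
    (subwords (a :: a :: y)).
Proof.
by move=> ab bx yx h; apply: cone_equiv_double ab yx _; exact: cone_equiv_circle_join.
Qed.

(** The complex of [b b c] is a cone with apex [c], at the right end; that of
    [a a c] is treated through it, since [a] may be equal to [c]. *)
Lemma cone_equiv_double_letter a c : a != b -> b != c ->
  cone_equiv R (subwords [:: a; a; c]) (subwords [:: c]).
Proof.
move=> ab bc; have ba : b != a by rewrite eq_sym.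
have Ka := cone_equiv_join R [:: c] ba; rewrite join_cxC in Ka.
have Kc := cone_equiv_trans (cone_equiv_join R [:: c] ab) (cone_equiv_right_push R bc).
apply: cone_equiv_cancell Ka Kc.
by move=> u h; apply: subseq_trans h (suffix_subseq [:: a; a] [:: c]).
Qed.

Lemma cone_equiv_spherical w d : b \notin w -> circular_decomposition w d ->
  cone_equiv R (subwords w) (subwords (fundamental_subword d)).
Proof.
elim: d w => [|[a v] d IH] w bw [dN wE].
  by rewrite wE; exact: cone_equiv_refl.
set w' := flatten [seq p.1 :: rcons p.2 p.1 | p <- d].
have {}wE : w = a :: v ++ a :: w' by rewrite wE /= cat_rcons.
have dN' p : p \in d -> p.1 \notin p.2 by move=> pd; apply: dN; rewrite inE pd orbT.
have av : a \notin v by apply: (dN (a, v)); rewrite mem_head.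
move: bw; rewrite wE inE mem_cat inE !negb_or => /and3P[ba bv /andP[_ bw']].
apply: cone_equiv_trans (cone_equiv_circular w' av) _.
have cd : circular_decomposition w' d by split.
apply: cone_equiv_suffix; [by rewrite eq_sym|exact: bw'| |exact: IH].
exact: fundamental_subseq cd.
Qed.

(** Induction on the length. A word [a v] with [a] not in [v] is a cone.
    Otherwise the word is [a v1 a v2] with [a] not in [v1], and [v2] is again
    not spherical; so [v2] can be replaced by a single letter [c] in [a a v2]. *)
Lemma cone_equiv_not_spherical w : b \notin w -> ~ spherical w ->
  exists2 c, c \in w & cone_equiv R (subwords w) (subwords [:: c]).
Proof.
have [n] := ubnP (size w); elim: n w => // n IH [|a v] sw bw not_sph.
  by exfalso; apply: not_sph; exists [::].
have [av|av] := boolP (a \in v); last first.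
  by exists a; [rewrite mem_head|exact: cone_equiv_cone].
have [v1' [v2' [av1 vE]]] : exists v1' v2', a \notin v1' /\ v = v1' ++ a :: v2'.
  exists (take (index a v) v), (drop (index a v).+1 v).
  have iv : (index a v < size v)%N by rewrite index_mem.
  split; last first.
    by rewrite -{1}(cat_take_drop (index a v) v) (drop_nth a iv) nth_index// -index_mem.
  by rewrite in_take_leq ?ltnn// ltnW.
move: bw; rewrite vE inE mem_cat inE !negb_or => /and3P[ba bv1 /andP[_ bv2]].
have [|||c cv2 hc] := IH v2' => //.
- by move: sw; rewrite vE /= size_cat /=; lia.
- move=> [cs [csc v2E]]; apply: not_sph; exists ((a :: rcons v1' a) :: cs); split.
    move=> u; rewrite inE => /predU1P[->|]; last exact: csc.
    by exists a, v1'.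
  by rewrite vE v2E /= cat_rcons.
exists c; first by rewrite inE mem_cat inE cv2 !orbT.
apply: cone_equiv_trans (cone_equiv_circular v2' av1) _.
have bc : b != c by apply: contraNneq bv2 => ->.
have ab : a != b by rewrite eq_sym.
apply: cone_equiv_trans (cone_equiv_suffix ab bv2 _ hc)
  (cone_equiv_double_letter ab bc).
by rewrite sub1seq.
Qed.

End Words.

(** * Cones over spheres *)

Section RowVectors.
Variable R : realType.

Lemma cont_on_row (T : topologicalType) (B : set T) k (f : T -> 'rV[R]_k) :
  (forall j, cont_on B (fun t => f t 0 j)) -> cont_on B f.
Proof.
move=> cf t Bt O [P nP PO].
have h : \forall t' \near t, forall j, B t' -> P 0 j (f t' 0 j).
  by apply: near_forall => j; apply: cf => //; exact: nP.
apply: (@filterS _ (nbhs t)) h => t' h Bt'; apply: PO => i j.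
by rewrite ord1; exact: h.
Qed.

Lemma coord_row_continuous k (j : 'I_k) : continuous (fun v : 'rV[R]_k => v 0 j).
Proof.
move=> v O nO; exists (fun _ j' => if j' == j then O else setT).
  by move=> i j' /=; rewrite ord1; case: eqP => [->//|_]; exact: filterT.
by move=> w /(_ 0 j) /=; rewrite eqxx.
Qed.

End RowVectors.

Section SphereType.
Variables (R : realType) (L : choiceType).
Implicit Types (P Q : pred (seq L)) (k : nat).

(** The open cone over the complex is equivalent to Euclidean space of
    dimension [k] by maps and homotopies under which apex and origin
    correspond. Hence the complex itself has the homotopy type of the sphere
    of dimension [k - 1]. *)
Definition sphere_like P k : Prop :=
  exists (f : wword R L -> 'rV[R]_k) (g : 'rV[R]_k -> wword R L),
    [/\ cont_on (cone P) f /\ (forall e, cone P e -> (f e = 0 <-> e = [::])),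
        cont_on setT g /\ (forall v, cone P (g v) /\ (g v = [::] <-> v = 0)),
        cone_homot P P id (g \o f) &
        homot R setT (fun v v' : 'rV[R]_k => v' = 0 <-> v = 0) id (f \o g)].

Lemma sphere_like_equivl P Q k : cone_equiv R P Q -> sphere_like Q k -> sphere_like P k.
Proof.
move=> [QP [j [cj Pj Qj]]] [f [g [[cf f0] [cg g0] gf fg]]].
have [cjc hj] := cj.
exists (f \o j), g; split.
- split; first by apply: cont_on_comp cjc _ cf => e /hj[].
  by move=> e /hj[Aj <-] /=; exact: f0.
- by split=> // v; have [Ag ?] := g0 v; split=> //; exact: cone_sub QP _ Ag.
- apply: cone_homot_trans Pj _; apply:
  (cone_homot_sub _ _ (cone_homot_pre cj gf)) => //.
- apply: homot_trans fg _.
  have := homot_post (D := fun v v' : 'rV[R]_k => v' = 0 <-> v = 0) cf _ _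
    (homot_pre (D := fun (v : 'rV[R]_k) e => cone Q e /\ (e = [::] <-> v = 0))
      cg (fun v _ => (g0 v).1) _ Qj).
  apply.
  + by move=> v e _ [].
  + by move=> v e _ [Ae <-]; exact: f0.
  + by move=> v e _ [Ae ->]; split=> //; exact: (g0 v).2.
Qed.

Lemma sphere_like_equivr P Q k : cone_equiv R P Q -> sphere_like P k -> sphere_like Q k.
Proof.
move=> [QP [j [cj Pj Qj]]] [f [g [[cf f0] [cg g0] gf fg]]].
have [cjc hj] := cj.
exists f, (j \o g); split.
- split; first exact: cont_on_sub (cone_sub QP) cf.
  by move=> e /(cone_sub QP); exact: f0.
- split; first by apply: cont_on_comp cg _ cjc => v _; exact: (g0 v).1.
  by move=> v; have [/hj[Aj zj] <-] := g0 v.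
- apply: cone_homot_trans Qj _.
  by apply: (cone_homot_sub _ _ (cone_homot_post cj gf)).
- apply: homot_trans fg _.
  have := homot_post (D := fun v v' : 'rV[R]_k => v' = 0 <-> v = 0) cf _ _
    (homot_pre (D := fun (v : 'rV[R]_k) e => cone P e /\ (e = [::] <-> v = 0))
      cg (fun v _ => (g0 v).1) _ Pj).
  apply.
  + by move=> v e _ [].
  + by move=> v e _ [Ae <-]; exact: f0.
  + by move=> v e _ [Ae ->]; split=> //; exact: (g0 v).2.
Qed.

(** The sphere of dimension [-1] is empty and the cone over the empty complex
    is its apex. *)
Lemma sphere_like_nil : sphere_like (subwords [::]) 0.
Proof.
have eE e : cone (subwords [::]) e -> e = [::] by move=> [_]; case: e.
have vE (v : 'rV[R]_0) : v = 0 by apply/rowP => -[].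
exists (fun=> 0), (fun=> [::]); split.
- by split=> [|e /eE->//]; apply: cont_onT; exact: cst_continuous.
- by split=> [|v]; [apply: cont_onT; exact: cst_continuous|rewrite (vE v)].
- have h : cone_homot (subwords [::]) (subwords [::]) (@id (wword R L)) id.
    by apply: cone_homot_refl; exact: cone_map_id.
  by apply: (homot_eq _ _ h) => // e /eE ->.
- have h : homot R setT (fun v v' : 'rV[R]_0 => v' = 0 <-> v = 0) id id.
    by apply: homot_refl => //; apply: cont_onT => v O.
  by apply: (homot_eq _ _ h) => // v _; rewrite /= (vE v).
Qed.

End SphereType.

(** * Weights of two equal letters as points of the plane *)

Section CirclePlane.
Variable R : realType.
Implicit Types (t s x y D m : R).

(** The open cone over the circle [b b] consists of the pairs of weights
    [t, s], with [t, 0] and [0, t] identified. In terms of the difference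
    [D = t - s] and of [m = 2 min(t, s)] these are the pairs with [m >= 0],
    where [D] and [- D] are identified when [m = 0]. The plane is obtained
    with the first coordinate [|D| - m] and, as second one, the point of the
    segment from [- m] to [m] closest to [D]. All formulas are piecewise
    linear. *)
Definition plane_x t s : R := `|t - s| - 2 * Num.min t s.
Definition plane_y t s : R :=
  Num.max (- (2 * Num.min t s)) (Num.min (2 * Num.min t s) (t - s)).

(** The pair of weights with difference [D] and twice the minimum equal to [m]
    is [(half D m, half (- D) m)]. *)
Definition half D m : R := m / 2 + Num.max D 0.
(** Together with [circ_up] for [y >= 0] and [circ_down] for [y <= 0], the
    inverse of the map to the plane: it returns [m] and [D]. The two values of
    [D] on the line [y = 0] are opposite; there [m = 0] for [x >= 0], where
    they are identified, and both are zero for [x <= 0]. *)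
Definition circ_m x y : R := `|y| + Num.max (- x) 0.
Definition circ_up x y : R := y + Num.max x 0.
Definition circ_down x y : R := y - Num.max x 0.

Lemma circ_m_ge0 x y : 0 <= circ_m x y.
Proof. by rewrite addr_ge0// le_max lexx orbT. Qed.

Lemma half_ge0 D m : 0 <= m -> 0 <= half D m.
Proof. by move=> m0; rewrite addr_ge0 ?divr_ge0// le_max lexx orbT. Qed.

Lemma half_sub D m : half D m - half (- D) m = D.
Proof.
rewrite /half; case/orP: (le_total 0 D) => D0.
  by rewrite (max_l D0) max_r ?oppr_le0//; lra.
by rewrite (max_r D0) max_l ?oppr_ge0//; lra.
Qed.

Lemma half_min D m : Num.min (half D m) (half (- D) m) = m / 2.
Proof.
rewrite /half; case/orP: (le_total 0 D) => D0.
  rewrite (max_l D0) max_r ?oppr_le0//; rewrite min_r; lra.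
rewrite (max_r D0) max_l ?oppr_ge0//; rewrite min_l; lra.
Qed.

(** [D] is one of the admissible differences of weights over the point
    [(x, y)]; there may be two of them when [y = 0]. *)
Definition side x y D : Prop :=
  (y <= 0 /\ D = circ_down x y) \/ (0 <= y /\ D = circ_up x y).

Lemma side_norm x y D : side x y D -> `|D| = `|y| + Num.max x 0.
Proof.
have m0 : 0 <= Num.max x 0 by rewrite le_max lexx orbT.
move=> [[y0 ->]|[y0 ->]].
  by rewrite /circ_down (ler0_norm y0) ler0_norm; lra.
by rewrite /circ_up (ger0_norm y0) ger0_norm; lra.
Qed.

Lemma plane_xK x y D : side x y D ->
  plane_x (half D (circ_m x y)) (half (- D) (circ_m x y)) = x.
Proof.
move=> /side_norm h; rewrite /plane_x half_sub half_min h /circ_m.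
case/orP: (le_total 0 x) => x0.
  by rewrite (max_l x0) max_r ?oppr_le0//; lra.
by rewrite (max_r x0) max_l ?oppr_ge0//; lra.
Qed.

Lemma plane_yK x y D : side x y D ->
  plane_y (half D (circ_m x y)) (half (- D) (circ_m x y)) = y.
Proof.
move=> h; rewrite /plane_y half_sub half_min /circ_m.
case/orP: (le_total 0 x) => x0.
  rewrite (@max_r _ _ (- x)) ?oppr_le0//.
  case: h => -[y0 ->]; rewrite /circ_down /circ_up (max_l x0).
    rewrite (ler0_norm y0) (@min_r _ _ _ (y - x)); last lra.
    by rewrite max_l; lra.
  rewrite (ger0_norm y0) (@min_l _ _ _ (y + x)); last lra.
  by rewrite max_r; lra.
rewrite (@max_l _ _ (- x)) ?oppr_ge0//.
case: h => -[y0 ->]; rewrite /circ_down /circ_up (max_r x0).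
  rewrite (ler0_norm y0) (@min_r _ _ _ (y - 0)); last lra.
  by rewrite max_r; lra.
rewrite (ger0_norm y0) (@min_r _ _ _ (y + 0)); last lra.
by rewrite max_r; lra.
Qed.

Lemma plane_sym0 t : 0 <= t ->
  [/\ plane_x t 0 = t, plane_x 0 t = t, plane_y t 0 = 0 & plane_y 0 t = 0].
Proof.
move=> t0; rewrite /plane_x /plane_y (min_r t0) (min_l t0) subr0 sub0r.
rewrite normrN ger0_norm// mulr0 subr0 oppr0 (min_l t0) (@min_r _ _ _ (- t)).
  by split=> //; [exact: maxxx|apply/max_idPl; rewrite oppr_le0].
by rewrite oppr_le0.
Qed.

Lemma plane_eq0 t s : 0 <= t -> 0 <= s ->
  plane_x t s = 0 -> plane_y t s = 0 -> t = 0 /\ s = 0.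
Proof.
rewrite /plane_x /plane_y; move=> t0 s0.
case/orP: (le_total t s) => ts; rewrite ?(min_l ts) ?(min_r ts).
  rewrite ler0_norm; last lra.
  rewrite (@min_r _ _ (2 * t)); last lra.
  have [h'|h'] := leP (- (2 * t)) (t - s); lra.
rewrite ger0_norm; last lra.
case/orP: (le_total (2 * s) (t - s)) => h; rewrite ?(min_l h) ?(min_r h).
  have [h'|h'] := leP (- (2 * s)) (2 * s); lra.
have [h'|h'] := leP (- (2 * s)) (t - s); lra.
Qed.

(** Only [|D|] and [m] can be recovered directly from the point of the plane.
    The sign of [D] is that of [y], which determines it unless [m = 0], and
    then the two weights may be exchanged without changing the word. *)
Lemma plane_inv t s D : 0 <= t -> 0 <= s ->
  side (plane_x t s) (plane_y t s) D ->
  let m := circ_m (plane_x t s) (plane_y t s) in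
  (half D m = t /\ half (- D) m = s) \/
  (half D m = s /\ half (- D) m = t /\ Num.min t s = 0).
Proof.
move=> t0 s0 h m; have hs := half_sub D m; have hm := half_min D m.
have m0 : 0 <= m by exact: circ_m_ge0.
have hn := side_norm h.
have mE : m = 2 * Num.min t s /\ `|D| = `|t - s|.
  rewrite /m {hs hm m0} hn {h hn} /circ_m /plane_x /plane_y.
  case/orP: (le_total t s) => ts; rewrite ?(min_l ts) ?(min_r ts).
    rewrite (@ler0_norm _ (t - s)); last lra.
    rewrite (@min_r _ _ (2 * t) (t - s)); last lra.
    case/orP: (le_total (- (2 * t)) (t - s)) => h.
      rewrite (max_r h) ler0_norm; last lra.
      by rewrite (@max_l _ _ (- _) 0) ?(@max_r _ _ _ 0); lra.
    rewrite (max_l h) ler0_norm; last lra.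
    by rewrite (@max_r _ _ (- _) 0) ?(@max_l _ _ _ 0); lra.
  rewrite (@ger0_norm _ (t - s)); last lra.
  case/orP: (le_total (2 * s) (t - s)) => h.
    rewrite (min_l h) (@max_r _ _ (- _) (2 * s)); last lra.
    rewrite ger0_norm; last lra.
    by rewrite (@max_r _ _ (- _) 0) ?(@max_l _ _ _ 0); lra.
  rewrite (min_r h) (@max_r _ _ (- _) (t - s)); last lra.
  rewrite ger0_norm; last lra.
  by rewrite (@max_l _ _ (- _) 0) ?(@max_r _ _ _ 0); lra.
have [m2 DE] := mE.
have y_pos : s <= t -> 0 <= plane_y t s /\ (plane_y t s = 0 -> s = 0 \/ t = s).
  move=> st; rewrite /plane_y (min_r st).
  case/orP: (le_total (2 * s) (t - s)) => k.
    by rewrite (min_l k) max_r; [split=> [|/eqP]; [lra|move/eqP=> ?; left]|]; lra.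
  by rewrite (min_r k) max_r; [split=> [|?]; [lra|right]|]; lra.
have y_neg : t <= s -> plane_y t s <= 0 /\ (plane_y t s = 0 -> t = 0 \/ t = s).
  move=> st; rewrite /plane_y (min_l st).
  rewrite (@min_r _ _ (2 * t)); last lra.
  case/orP: (le_total (- (2 * t)) (t - s)) => k.
    by rewrite (max_r k); split=> [|?]; [lra|right; lra].
  by rewrite (max_l k); split=> [|?]; [lra|left; lra].
have x0 : 0 <= Num.max (plane_x t s) 0 by rewrite le_max lexx orbT.
have good : D = t - s -> half D m = t /\ half (- D) m = s.
  move=> e; move: hs hm; rewrite m2 e.
  case/orP: (le_total t s) => ts; rewrite ?(min_l ts) ?(min_r ts) => h1 h2.
    have h3 : half (t - s) (2 * t) <= half (- (t - s)) (2 * t) by lra.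
    by move: h2; rewrite (min_l h3) => h2; split; lra.
  have h3 : half (- (t - s)) (2 * s) <= half (t - s) (2 * s) by lra.
  by move: h2; rewrite (min_r h3) => h2; split; lra.
have bad : D = s - t -> half D m = s /\ half (- D) m = t.
  move=> e; move: hs hm; rewrite m2 e.
  case/orP: (le_total t s) => ts; rewrite ?(min_l ts) ?(min_r ts) => h1 h2.
    have h3 : half (- (s - t)) (2 * t) <= half (s - t) (2 * t) by lra.
    by move: h2; rewrite (min_r h3) => h2; split; lra.
  have h3 : half (s - t) (2 * s) <= half (- (s - t)) (2 * s) by lra.
  by move: h2; rewrite (min_l h3) => h2; split; lra.
have [e|ne] := eqVneq D (t - s); first by left; exact: good.
have e : D = s - t.
  by move/eqP: DE; rewrite eqr_norm2 (negbTE ne) /= => /eqP ->; lra.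
have {good}[-> ->] := bad e; right; split=> //; split=> //.
have ts_ne : t <> s by move=> ts; move/eqP: ne; rewrite e ts; lra.
case/orP: (le_total t s) => ts.
  have [y0 yz] := y_neg ts; case: h => -[hy hD].
    exfalso; apply: ts_ne; move: hD; rewrite /circ_down e; lra.
  have /yz[->|//] : plane_y t s = 0 by lra.
  by apply/min_idPl.
have [y0 yz] := y_pos ts; case: h => -[hy hD].
  have /yz[->|//] : plane_y t s = 0 by lra.
  by apply/min_idPr.
exfalso; apply: ts_ne; move: hD; rewrite /circ_up e; lra.
Qed.

End CirclePlane.

(** * Joining a sphere with a circle *)

Section SphereJoin.
Variables (R : realType) (L : choiceType) (b : L) (x : seq L) (k : nat).
Hypothesis bx : b \notin x.
Implicit Types (e : wword R L) (X : weights R).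

Definition row_cons (r s : R) (u : 'rV[R]_k) : 'rV[R]_k.+2 :=
  \row_(i < k.+2) match fintype.split (i : 'I_(2 + k)) with
    | inl j => if j == 0 then r else s
    | inr j => u 0 j
    end.
Definition row_x (v : 'rV[R]_k.+2) : R := (v : 'rV_(2 + k)) 0 (lshift k 0).
Definition row_y (v : 'rV[R]_k.+2) : R := (v : 'rV_(2 + k)) 0 (lshift k 1).
Definition row_u (v : 'rV[R]_k.+2) : 'rV[R]_k :=
  \row_j (v : 'rV_(2 + k)) 0 (rshift 2 j).

Lemma row_cons_x r s u : row_x (row_cons r s u) = r.
Proof. by rewrite /row_x mxE (unsplitK (inl 0)). Qed.

Lemma row_cons_y r s u : row_y (row_cons r s u) = s.
Proof. by rewrite /row_y mxE (unsplitK (inl 1)). Qed.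

Lemma row_cons_u r s u : row_u (row_cons r s u) = u.
Proof. by apply/rowP => j; rewrite !mxE (unsplitK (inr j)). Qed.

Lemma row_consK v : row_cons (row_x v) (row_y v) (row_u v) = v.
Proof.
apply/rowP => i; rewrite mxE.
case: (splitP (i : 'I_(2 + k))) => j ij.
  have -> : i = lshift k j by apply: val_inj.
  case: eqP => [->//|/eqP j0]; rewrite /row_y; congr (v _ _).
  by apply: val_inj; move: j j0 {ij} => [[|[|?]] ?].
by rewrite mxE; congr (v _ _); apply: val_inj.
Qed.

Lemma row_cons_eq0 r s u : row_cons r s u = 0 <-> [/\ r = 0, s = 0 & u = 0].
Proof.
split=> [h|[-> -> ->]].
  split; [rewrite -(row_cons_x r s u)|rewrite -(row_cons_y r s u)|
    rewrite -(row_cons_u r s u)]; rewrite h; try by rewrite /row_x /row_y mxE.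
  by apply/rowP => j; rewrite !mxE.
by apply/rowP => i; rewrite !mxE; case: (fintype.split _) => j; rewrite ?mxE//;
  case: ifP.
Qed.

Lemma cont_on_row_cons (T : topologicalType) (B : set T) (r s : T -> R)
    (u : T -> 'rV[R]_k) :
  cont_on B r -> cont_on B s -> cont_on B u ->
  cont_on B (fun t => row_cons (r t) (s t) (u t)).
Proof.
move=> cr cs cu; apply: cont_on_row => i.
case E : (fintype.split (i : 'I_(2 + k))) => [j|j].
  have [j0|j0] := eqVneq j 0.
    by apply: cont_on_eq cr => t _; rewrite mxE E j0.
  by apply: cont_on_eq cs => t _; rewrite mxE E (negbTE j0).
apply: (@cont_on_eq _ _ _ (fun t => u t 0 j)) => [t _|]; first by rewrite mxE E.
have h := @cont_on_comp T _ _ B setT u (fun v : 'rV[R]_k => v 0 j) cu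
  (fun _ _ => I) (cont_onT (@coord_row_continuous R k j)).
exact: h.
Qed.

Lemma row_u_continuous : continuous row_u.
Proof.
apply: cont_on_setT; apply: cont_on_row => j.
apply: (@cont_on_eq _ _ _ (fun v : 'rV[R]_k.+2 => (v : 'rV_(2 + k)) 0 (rshift 2 j))).
  by move=> v _; rewrite mxE.
exact/cont_onT/(@coord_row_continuous R k.+2).
Qed.

Lemma row_x_continuous : continuous row_x.
Proof. exact: (@coord_row_continuous R k.+2). Qed.

Lemma row_y_continuous : continuous row_y.
Proof. exact: (@coord_row_continuous R k.+2). Qed.

Definition head_weight e i : R := nth 0 [seq p.2 | p <- heads b e] i.

(** The list of heads does not remember which of the two letters was dropped.
    The formulas agree in both cases since the plane identifies [t, 0] with
    [0, t]. *)
Lemma head_plane X : let e := cell (b :: b :: x) X in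
  let t := Num.max 0 ((X : nat -> R) 0%N) in
  let s := Num.max 0 ((X : nat -> R) 1%N) in
  plane_x (head_weight e 0) (head_weight e 1) = plane_x t s /\
  plane_y (head_weight e 0) (head_weight e 1) = plane_y t s.
Proof.
rewrite /= /head_weight heads_cell// !clean_cons.
have [X0|X0] := ltP 0 ((X : nat -> R) 0%N).
  by case: (ltP 0 ((X : nat -> R) 1%N)).
have [X1|X1] := ltP 0 ((X : nat -> R) 1%N); last by [].
by have [h1 h2 h3 h4] := plane_sym0 (ltW X1); rewrite /= h1 h2 h3 h4.
Qed.

Section Maps.
Variables (f : wword R L -> 'rV[R]_k) (g : 'rV[R]_k -> wword R L).
Hypothesis cf : cont_on (cone (subwords x)) f.
Hypothesis f0 : forall e, cone (subwords x) e -> (f e = 0 <-> e = [::]).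
Hypothesis cg : cont_on setT g.
Hypothesis g0 : forall v, cone (subwords x) (g v) /\ (g v = [::] <-> v = 0).

Definition join_to e : 'rV[R]_k.+2 :=
  row_cons (plane_x (head_weight e 0) (head_weight e 1))
    (plane_y (head_weight e 0) (head_weight e 1)) (f (tails b e)).

Definition join_m v : R := circ_m (row_x v) (row_y v).

Definition join_from_of (D : 'rV[R]_k.+2 -> R) v : wword R L :=
  clean ((b, half (D v) (join_m v)) :: clean ((b, half (- D v) (join_m v)) ::
    g (row_u v))).

(** The two branches give different pairs of weights on the half line [y = 0],
    [x > 0], but the same word, with a single leading [b]. *)
Definition join_from v : wword R L :=
  if row_y v <= 0 then join_from_of (fun v => circ_down (row_x v) (row_y v)) v
  else join_from_of (fun v => circ_up (row_x v) (row_y v)) v.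

Lemma join_from_side v : exists D, side (row_x v) (row_y v) D /\
  join_from v = clean ((b, half D (join_m v)) :: clean ((b, half (- D)
    (join_m v)) :: g (row_u v))).
Proof.
rewrite /join_from; case: (leP (row_y v) 0) => h.
  by exists (circ_down (row_x v) (row_y v)); split=> //; left.
by exists (circ_up (row_x v) (row_y v)); split=> //; right; split=> //; exact: ltW.
Qed.

Lemma join_from_cell v : exists D X, [/\ side (row_x v) (row_y v) D,
  join_from v = cell (b :: b :: x) X, (X : nat -> R) 0%N = half D (join_m v),
  (X : nat -> R) 1%N = half (- D) (join_m v) &
  cell x (shift_weights (shift_weights X)) = g (row_u v)].
Proof.
have [D [sD ->]] := join_from_side v.
have [[cgu wgu] _] := g0 (row_u v).
have [Y YE] := cell_surj cgu wgu.
exists D, (cons_weights (half D (join_m v)) (cons_weights (half (- D) (join_m v)) Y)).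
by split=> //; rewrite -YE cell_bbE.
Qed.

Lemma join_to_cont_on : cont_on (cone (subwords (b :: b :: x))) join_to.
Proof.
rewrite -[cone _]setIT; apply: cont_on_cell => [|X _]; first exact: openT.
apply: cont_on_setT.
pose t (X : weights R) := Num.max 0 ((X : nat -> R) 0%N).
pose s (X : weights R) := Num.max 0 ((X : nat -> R) 1%N).
apply: (@cont_on_eq _ _ _ (fun X : weights R =>
   row_cons (plane_x (t X) (s X)) (plane_y (t X) (s X))
     (f (cell x (shift_weights (shift_weights X)))))).
  by move=> X' _; rewrite /join_to tails_cell//; have [-> ->] := head_plane X'.
have pos i : continuous (fun X : weights R => Num.max 0 ((X : nat -> R) i)).
  by move=> Y; exact: (cont_max (@cst_continuous _ _ (0 : R) Y)
    (@coord_continuous R i Y)).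
have ct : continuous t := pos 0%N.
have cs : continuous s := pos 1%N.
have c2m : continuous (fun y => 2 * Num.min (t y) (s y)).
  move=> y; exact: (contM (@cst_continuous _ _ (2 : R) y) (cont_min (ct y) (cs y))).
apply: cont_on_row_cons.
- apply: cont_onT => y; apply: contB (c2m y).
  exact: (continuous_comp (contB (ct y) (cs y)) (@norm_continuous _ _ _)).
- apply: cont_onT => y.
  exact: (cont_max (contN (c2m y)) (cont_min (c2m y) (contB (ct y) (cs y)))).
- apply: cont_on_comp cf => [|y _].
    apply: cont_onT => y.
    have c2 := continuous_comp (@shift_weights_continuous R y)
      (@shift_weights_continuous R _).
    exact: (continuous_comp c2 (@cell_continuous R L x _)).
  by apply: cone_cell; [exact: down_subseq|exact: subseq_refl].
Qed.

Lemma join_from_cont_on : cont_on setT join_from.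
Proof.
have cx := row_x_continuous; have cy := row_y_continuous.
have cpx : continuous (fun v => Num.max (row_x v) 0).
  by move=> v; exact: (cont_max (cx v) (@cst_continuous _ _ (0 : R) v)).
have cnx : continuous (fun v => Num.max (- row_x v) 0).
  by move=> v; exact: (cont_max (contN (cx v)) (@cst_continuous _ _ (0 : R) v)).
have cm : continuous join_m.
  move=> v; exact: (contD (continuous_comp (cy v) (@norm_continuous _ _ _)) (cnx v)).
have ch (D : 'rV[R]_k.+2 -> R) B : continuous D ->
    cont_on B (fun v => half (D v) (join_m v)).
  move=> cD; apply: cont_onT => v.
  exact: (contD (contM (cm v) (@cst_continuous _ _ (2^-1 : R) v))
    (cont_max (cD v) (@cst_continuous _ _ (0 : R) v))).
have cj D B : continuous D -> cont_on B (join_from_of D).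
  move=> cD.
  have cN : continuous (fun v => - D v).
    by move=> v; exact: (contN (cD v)).
  apply: cont_on_cons_b (ch _ _ cD) _ _; last by move=> v _; exact: clean_id.
  apply: cont_on_cons_b (ch _ _ cN) _ _; last by move=> v _; have [[]] := g0 (row_u v).
  apply: cont_on_comp cg => //; apply: cont_onT; exact: row_u_continuous.
apply: cont_on_glue; first exact/cont_onT.
- by apply: cj => v; exact: (contB (cy v) (cpx v)).
- by apply: cj => v; exact: (contD (cy v) (cpx v)).
move=> v _ y0; rewrite /join_from_of /circ_down /circ_up /join_m /circ_m y0 normr0 !add0r.
case/orP: (le_total 0 (row_x v)) => x0; last first.
  by rewrite !(max_r x0) ?oppr0 ?add0r ?oppr0.
rewrite !(max_l x0) /half (@max_r _ _ (- row_x v)) ?oppr_le0// mul0r !add0r opprK.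
rewrite !(max_l x0).
rewrite !(@clean_cons _ _ b 0) ltxx clean_id !(@clean_cons _ _ b (row_x v)).
by rewrite clean_id.
Qed.

Lemma clean_max a (r : R) (o : wword R L) :
  clean ((a, Num.max 0 r) :: o) = clean ((a, r) :: o).
Proof. by rewrite !clean_cons; have [h|h] := ltP 0 r; rewrite ?h ?ltxx. Qed.

Lemma cell_bb_nil X : cell (b :: b :: x) X = [::] <->
  [/\ (X : nat -> R) 0%N <= 0, (X : nat -> R) 1%N <= 0 &
      cell x (shift_weights (shift_weights X)) = [::]].
Proof.
rewrite cell_bbE (@clean_cons _ _ b ((X : nat -> R) 0%N)) clean_id.
rewrite (@clean_cons _ _ b ((X : nat -> R) 1%N)) clean_cell.
have [X0|X0] := ltP 0 ((X : nat -> R) 0%N); first by split=> // -[].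
by have [X1|X1] := ltP 0 ((X : nat -> R) 1%N); split=> // -[].
Qed.

Lemma cone_cell_x X : cone (subwords x) (cell x X).
Proof. by apply: cone_cell; [exact: down_subseq|exact: subseq_refl]. Qed.

Lemma join_to_cell X :
  let t := Num.max 0 ((X : nat -> R) 0%N) in
  let s := Num.max 0 ((X : nat -> R) 1%N) in
  join_to (cell (b :: b :: x) X) = row_cons (plane_x t s) (plane_y t s)
    (f (cell x (shift_weights (shift_weights X)))).
Proof. by rewrite /join_to tails_cell//; have [-> ->] := head_plane X. Qed.

Lemma join_to_eq0 e : cone (subwords (b :: b :: x)) e -> (join_to e = 0 <-> e = [::]).
Proof.
move=> [ce we]; have [X <-] := cell_surj ce we.
rewrite join_to_cell row_cons_eq0 cell_bb_nil.
have fz := f0 (cone_cell_x (shift_weights (shift_weights X))).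
split=> -[h1 h2 /fz ->].
  have [] := plane_eq0 _ _ h1 h2; rewrite ?le_max ?lexx//.
  by move=> /max_idPl ? /max_idPl ?.
rewrite (max_l h1) (max_l h2).
by have [-> _ -> _] := plane_sym0 (lexx (0 : R)).
Qed.

Lemma cone_join_from v : cone (subwords (b :: b :: x)) (join_from v).
Proof.
have [D [X [_ -> _ _ _]]] := join_from_cell v.
by apply: cone_cell; [exact: down_subseq|exact: subseq_refl].
Qed.

Lemma join_from_eq0 v : join_from v = [::] <-> v = 0.
Proof.
have [D [X [sD -> X0 X1 XE]]] := join_from_cell v.
have m0 : 0 <= join_m v by exact: circ_m_ge0.
have gz := (g0 (row_u v)).2.
rewrite cell_bb_nil X0 X1 XE -[v in v = 0]row_consK row_cons_eq0.
split=> -[h1 h2 /gz h3]; split=> //.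
- rewrite -(plane_xK sD) -/(join_m v).
  have -> : half D (join_m v) = 0 by apply/eqP; rewrite eq_le h1 half_ge0.
  have -> : half (- D) (join_m v) = 0 by apply/eqP; rewrite eq_le h2 half_ge0.
  by have [->] := plane_sym0 (lexx (0 : R)).
- rewrite -(plane_yK sD) -/(join_m v).
  have -> : half D (join_m v) = 0 by apply/eqP; rewrite eq_le h1 half_ge0.
  have -> : half (- D) (join_m v) = 0 by apply/eqP; rewrite eq_le h2 half_ge0.
  by have [_ _ ->] := plane_sym0 (lexx (0 : R)).
- have D0 : D = 0.
    by case: sD => -[_ ->]; rewrite /circ_down /circ_up h1 h2 maxxx ?subr0 ?addr0.
  by rewrite /half /join_m /circ_m D0 h1 h2 normr0 oppr0 !maxxx !addr0 mul0r.
- have D0 : D = 0.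
    by case: sD => -[_ ->]; rewrite /circ_down /circ_up h1 h2 maxxx ?subr0 ?addr0.
  by rewrite /half /join_m /circ_m D0 h1 h2 normr0 oppr0 !maxxx !addr0 mul0r.
Qed.

Lemma join_fromK e : cone (subwords (b :: b :: x)) e -> join_from (join_to e)
  = lift_tails b (g \o f) e.
Proof.
move=> [ce we]; have [X <-] := cell_surj ce we.
have [D [sD ->]] := join_from_side (join_to (cell (b :: b :: x) X)).
rewrite lift_tails_cell//; last by move=> X'; have [[]] := g0 (f (cell x X')).
move: sD; rewrite /join_m join_to_cell row_cons_x row_cons_y row_cons_u /=.
set t := Num.max 0 ((X : nat -> R) 0%N); set s := Num.max 0 ((X : nat -> R) 1%N).
set o := g _.
have t0 : 0 <= t by rewrite le_max lexx.
have s0 : 0 <= s by rewrite le_max lexx.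
move=> sD; rewrite -(clean_max _ ((X : nat -> R) 0%N)) -/t.
rewrite -(clean_max _ ((X : nat -> R) 1%N)) -/s.
have /= [[-> ->]//|[-> [-> m0]]] := plane_inv t0 s0 sD.
case/orP: (le_total t s) m0 => ts; rewrite ?(min_l ts) ?(min_r ts) => ->.
  by rewrite !(@clean_cons _ _ b 0) ltxx clean_id !(@clean_cons _ _ b s) clean_id.
by rewrite !(@clean_cons _ _ b 0) ltxx clean_id !(@clean_cons _ _ b t) clean_id.
Qed.

Lemma join_toK v : join_to (join_from v) = row_cons (row_x v) (row_y v)
  (f (g (row_u v))).
Proof.
have [D [X [sD -> X0 X1 XE]]] := join_from_cell v.
have m0 : 0 <= join_m v by exact: circ_m_ge0.
rewrite join_to_cell X0 X1 XE !(@max_r _ _ 0) ?half_ge0//.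
by rewrite (plane_xK sD) (plane_yK sD).
Qed.

End Maps.

(** The open cone over a join is the product of the open cones. So the circle
    [b b] contributes a factor that is a plane, on which nothing moves. *)
Theorem sphere_like_circle_join : sphere_like R (subwords x) k ->
  sphere_like R (subwords (b :: b :: x)) k.+2.
Proof.
move=> [f [g [[cf f0] [cg g0] gf fg]]].
exists (join_to f), (join_from g); split.
- by split; [exact: join_to_cont_on|exact: join_to_eq0].
- split; first exact: (join_from_cont_on cg g0).
  by move=> v; split; [exact: cone_join_from|exact: join_from_eq0].
- apply: (homot_eq _ _ (lift_tails_cone_homot bx gf)) => e Ae; first exact:
  (lift_tails_id bx Ae).
  by rewrite /= (join_fromK f g0 Ae).
- have [K [cK hK K0 K1]] := fg.
  exists (fun y => row_cons (row_x y.1) (row_y y.1) (K (row_u y.1, y.2))); split.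
  + apply: cont_on_row_cons.
    * apply: cont_onT => y.
      exact: (continuous_comp (@continuous_fst _ _ y) (@row_x_continuous _)).
    * apply: cont_onT => y.
      exact: (continuous_comp (@continuous_fst _ _ y) (@row_y_continuous _)).
    * apply: (@cont_on_comp _ _ _ _ (setT `*` setT)
        (fun y : 'rV[R]_k.+2 * R => (row_u y.1, y.2)) K) => //.
      by apply: cont_onT => y; apply: continuous_lift_fst; exact: row_u_continuous.
  + move=> v s _ /=; rewrite row_cons_eq0 -[v in _ <-> v = 0]row_consK row_cons_eq0.
    by split=> -[-> ->] /(hK _ _ I) h.
  + by move=> v _ /=; rewrite K0// row_consK.
  + by move=> v _ /=; rewrite K1// (join_toK f g0).
Qed.

End SphereJoin.

(** * From equivalences to strong deformation retractions *)

Section StrongRetraction.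
Variables (R : realType) (T : topologicalType) (A : set T).
Variables (j k : T -> T) (u : T -> R).
Hypothesis hM : homot R setT (fun _ _ => True) id j.
Hypothesis hj : forall x, A (j x).
Hypothesis hN : homot R A (fun _ y => A y) id j.
Hypothesis cu : continuous u.
Hypothesis uA : forall x, A x -> u x = 0.
Hypothesis hk : homot R setT (fun x y => A x -> y = x) id k.
Hypothesis kA : forall x, u x <= 1 -> A (k x).

(** [j] is a homotopy inverse of the inclusion of [A], and [k] ends a
    deformation fixing [A] that brings the neighbourhood [u <= 1] into [A].
    First [j] is corrected to a retraction [r] that is the identity on [A], by
    using the homotopy from the identity of [A] to [j] on the neighbourhood. A
    homotopy [H] from the identity to [r] need not fix [A]. It is therefore
    followed at [k x] only up to the time [min(1, u x)], and then backwards at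
    [r (k x)] from the same time to the point [r (k x)]. The two paths meet:
    at time one both are at [r (k x)], and for [u x <= 1] they agree because
    [k x] is in [A]. On [A] nothing moves, since [u] vanishes there. *)
Lemma strong_retraction :
  exists2 r, (forall x, A (r x)) & homot R setT (fun x y => A x -> y = x) id r.
Proof.
have [N [cN AN N0 N1]] := hN.
have ck : cont_on setT k by exact: homot_contr hk.
have ck' : continuous k := cont_on_setT ck.
have cj : cont_on setT j by exact: homot_contr hM.
have kid x : A x -> k x = x by move=> Ax; exact: (homot_constr hk I Ax).
have cuw B : cont_on B u by exact: cont_onT.
(* On the neighbourhood the homotopy [N] is run up to the time [u x]: this
   time is zero on [A], where nothing moves, and [j] is reached at the
   boundary. *)
pose r x := if u x - 1 <= 0 then N (k x, u x) else j (k x).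
have cu1 (B : set T) : cont_on B (fun x => u x - 1).
  by apply: cont_onT => x; exact: (contB (@cu x) (@cst_continuous _ _ (1 : R) x)).
have kA' x : u x - 1 <= 0 -> A (k x) by rewrite subr_le0; exact: kA.
have cr : cont_on setT r.
  apply: cont_on_glue; first exact: cu1.
  - apply: (@cont_on_comp _ _ _ _ (A `*` setT) (fun x => (k x, u x)) N) => //.
      apply: cont_on_pair; last exact: cuw.
      by apply: cont_on_sub ck.
    by move=> x [_ /kA'].
  - by apply: (@cont_on_comp _ _ _ _ setT k j) => //; exact: cont_on_sub ck.
  - move=> x _ /eqP; rewrite subr_eq0 => /eqP ux; rewrite ux N1//.
    by apply: kA; rewrite ux.
have cr' : continuous r := cont_on_setT cr.
have Ar x : A (r x).
  by rewrite /r; case: ifP => [/kA' h|_]; [exact: AN|exact: hj].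
have rid x : A x -> r x = x.
  by move=> Ax; rewrite /r uA// sub0r oppr_le0 ler01 kid// N0.
have hr : homot R setT (fun _ _ => True) id r.
  have h1 : homot R setT (fun _ _ : T => True) id k by exact: homot_sub hk.
  have h2 : homot R setT (fun _ _ : T => True) k (j \o k).
    exact: (homot_pre ck (fun _ _ => I) (fun _ _ _ _ => I) hM).
  apply: homot_trans h1 (homot_trans h2 _).
  (* From [j \o k] to [r], by letting the time on the neighbourhood move from
     [1] to [u]. *)
  exists (fun y => if u y.1 - 1 <= 0 then N (k y.1, 1 - (1 - u y.1) * y.2)
                   else j (k y.1)); split => //.
  + have c1 (B : set (T * R)) : cont_on B (fun y : T * R => k y.1).
      apply: cont_onT => y.
      exact: (continuous_comp (@continuous_fst _ _ y) (ck' _)).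
    have cu2 (y : T * R) : {for y, continuous (fun y : T * R => u y.1)}.
      exact: (continuous_comp (@continuous_fst _ _ y) (@cu _)).
    have one (y : T * R) := @cst_continuous _ _ (1 : R) y.
    apply: cont_on_glue.
    * by apply: cont_onT => y; exact: (contB (cu2 y) (one y)).
    * apply: (@cont_on_comp _ _ _ _ (A `*` setT)
        (fun y : T * R => (k y.1, 1 - (1 - u y.1) * y.2)) N) => //.
        apply: cont_on_pair => //; apply: cont_onT => y.
        exact: (contB (one y) (contM (contB (one y) (cu2 y)) (@continuous_snd _ _ y))).
      by move=> y [_ /kA'].
    * by apply: (@cont_on_comp _ _ _ _ setT (fun y : T * R => k y.1) j).
    * move=> y _ /eqP; rewrite subr_eq0 => /eqP uy; rewrite uy subrr mul0r subr0 N1//.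
      by apply: kA; rewrite uy.
  + move=> x _ /=; rewrite mulr0 subr0; case: ifP => // /kA' h.
    by rewrite N1.
  + by move=> x _ /=; rewrite mulr1 subKr.
have [H [cH _ H0 H1]] := hr.
pose m x := Num.min 1 (u x).
have cm : continuous m.
  by move=> x; exact: (cont_min (@cst_continuous _ _ (1 : R) x) (@cu x)).
have mA x : A x -> m x = 0 by move=> /uA; rewrite /m => ->; apply/min_idPr.
exists (r \o k); first by move=> x /=.
have h1 : homot R setT (fun x y => A x -> y = x) k (fun x => H (k x, m x)).
  exists (fun y => H (k y.1, y.2 * m y.1)); split => //=.
  + apply: (@cont_on_comp _ _ _ _ (setT `*` setT)
      (fun y : T * R => (k y.1, y.2 * m y.1)) H) => //.
    apply: cont_on_pair; apply: cont_onT => y.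
      exact: (continuous_comp (@continuous_fst _ _ y) (ck' _)).
    exact: (contM (@continuous_snd _ _ y)
      (continuous_comp (@continuous_fst _ _ y) (cm _))).
  + by move=> x s _ Ax; rewrite mA// mulr0 H0// kid.
  + by move=> x _; rewrite mul0r H0.
  + by move=> x _; rewrite mul1r.
have h2 : homot R setT (fun x y => A x -> y = x)
    (fun x => H (k x, m x)) (r \o k).
  exists (fun y => H (r (k y.1), (1 - y.2) * m y.1)); split => //=.
  + apply: (@cont_on_comp _ _ _ _ (setT `*` setT)
      (fun y : T * R => (r (k y.1), (1 - y.2) * m y.1)) H) => //.
    apply: cont_on_pair; apply: cont_onT => y.
      have crk := continuous_comp (ck' y.1) (cr' _).
      exact: (continuous_comp (@continuous_fst _ _ y) crk).
    exact: (contM (contB (@cst_continuous _ _ (1 : R) y) (@continuous_snd _ _ y))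
      (continuous_comp (@continuous_fst _ _ y) (cm _))).
  + by move=> x s _ Ax; rewrite mA// mulr0 H0// kid// rid.
  + move=> x _; rewrite subr0 mul1r /m.
    have [ux|ux] := leP 1 (u x); first by rewrite !H1// (rid _ (Ar _)).
    by rewrite (rid _ (kA (ltW ux))).
  + by move=> x _; rewrite subrr mul0r H0.
exact: homot_trans hk (homot_trans h1 h2).
Qed.

End StrongRetraction.

Section SphericalWords.
Variables (R : realType) (L : choiceType) (b : L).

(** The letter [a] may occur in [x], so [a] is replaced by [b] as in
    [cone_equiv_double]. *)
Lemma sphere_like_circle a (x : seq L) k : a != b -> b \notin x ->
  sphere_like R (subwords x) k -> sphere_like R (subwords (a :: a :: x)) k.+2.
Proof.
move=> ab bx /(sphere_like_circle_join bx) h.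
have ba : b != a by rewrite eq_sym.
have Ka := cone_equiv_join R x ba; rewrite join_cxC in Ka.
exact: sphere_like_equivr Ka (sphere_like_equivl (cone_equiv_join R x ab) h).
Qed.

Lemma sphere_like_spherical w d : b \notin w -> circular_decomposition w d ->
  sphere_like R (subwords w) (2 * size d)%N.
Proof.
move=> bw dw; apply: sphere_like_equivl (cone_equiv_spherical R bw dw) _.
have : b \notin fundamental_subword d.
  by apply: contra bw; apply: mem_subseq; exact: fundamental_subseq dw.
elim: d {dw} => [|[a v] d IH] /=; first by rewrite muln0 => _; exact: sphere_like_nil.
rewrite !inE !negb_or => /and3P[ba _ bd].
by rewrite mulnS; apply: sphere_like_circle; rewrite 1?eq_sym//; exact: IH.
Qed.

End SphericalWords.

(** * Points of the realization as weighted words *)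

Section Coordinates.
Variables (R : realType) (S : choiceType) (w : seq S).

Local Notation K := (scrambled_simplex w).
Local Notation E := (wword R (option S)).

(** Letters are embedded in the option type, so that [None] is a letter that
    does not occur in [w]. *)
Definition cell_word l (s : K l) (x : std_simplex R l) : E :=
  [seq (Some (tnth (val s) i), coords x 0 i) | i <- enum 'I_l.+1].

Definition cells_word (c : cells R K) : E :=
  clean (cell_word (tagged (tag c)) (tagged c)).

Lemma coords_ge0 l (x : std_simplex R l) i : 0 <= coords x 0 i.
Proof. by have [h _] := set_valP x; exact: h. Qed.

Lemma coords_sum l (x : std_simplex R l) : \sum_i coords x 0 i = 1.
Proof. by have [_ h] := set_valP x. Qed.

Lemma enum_sorted n : sorted (fun i j : 'I_n => (i < j)%N) (enum 'I_n).
Proof. by have := iota_ltn_sorted 0 n; rewrite -val_enum_ord sorted_map. Qed.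

Lemma filter_enum_map m l (f : ordinj m l) (P : pred 'I_l) (Q : pred 'I_m) :
  (forall j, P j <-> exists2 i, Q i & f i = j) ->
  [seq j <- enum 'I_l | P j] = map f [seq i <- enum 'I_m | Q i].
Proof.
move=> PQ.
have ltn_tr n : transitive (fun i j : 'I_n => (i < j)%N).
  by move=> ? ? ?; exact: ltn_trans.
apply: (irr_sorted_eq (@ltn_tr l)) => [i|||j]; first exact: ltnn.
- exact: (sorted_filter (@ltn_tr l) _ (enum_sorted l)).
- rewrite sorted_map; apply: (@sub_sorted _ (fun i j : 'I_m => (i < j)%N)).
    by move=> i j; exact: ordinj_homo.
  exact: (sorted_filter (@ltn_tr m) _ (enum_sorted m)).
- rewrite mem_filter mem_enum andbT; apply/idP/mapP => [/PQ[i Qi <-]|[i + ->]].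
    by exists i => //; rewrite mem_filter Qi mem_enum.
  by rewrite mem_filter => /andP[Qi _]; apply/PQ; exists i.
Qed.

Lemma ordinj_inj m l (f : ordinj m l) : injective f.
Proof.
move=> i j fij; apply: val_inj.
by case: (ltngtP i j) => // /(ordinj_homo f); rewrite fij ltnn.
Qed.

Lemma coface_coords m l (f : ordinj m.+1 l.+1) (x : std_simplex R m) i :
  coords (coface f x) 0 (f i) = coords x 0 i.
Proof.
rewrite /coords /= mxE (bigD1 i)//= big1 ?addr0// => j /andP[/eqP fj ji].
by move: ji; rewrite (ordinj_inj fj) eqxx.
Qed.

Lemma coface_coords0 m l (f : ordinj m.+1 l.+1) (x : std_simplex R m) j :
  (forall i, f i != j) -> coords (coface f x) 0 j = 0.
Proof.
by move=> h; rewrite /coords /= mxE big_pred0// => i; exact/negbTE.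
Qed.

Lemma clean_cell_word l (s : K l) (x : std_simplex R l) :
  clean (cell_word s x) = [seq (Some (tnth (val s) i), coords x 0 i)
    | i <- [seq i <- enum 'I_l.+1 | 0 < coords x 0 i]].
Proof. by rewrite /clean /cell_word filter_map. Qed.

(** The gluing of faces only inserts letters of weight zero. *)
Lemma cell_word_face m l (f : ordinj m.+1 l.+1) (s : K l) (x : std_simplex R m) :
  clean (cell_word (face f s) x) = clean (cell_word s (coface f x)).
Proof.
have h : [seq j <- enum 'I_l.+1 | 0 < coords (coface f x) 0 j] =
    map f [seq i <- enum 'I_m.+1 | 0 < coords x 0 i].
  apply: filter_enum_map => j; split=> [xj|[i xi <-]]; last by rewrite coface_coords.
  have [i fi|h] := pickP (fun i => f i == j).
    by exists i; [rewrite -(coface_coords f) (eqP fi)|exact/eqP].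
  by move: xj; rewrite coface_coords0 ?ltxx// => i; rewrite h.
rewrite !clean_cell_word h -map_comp; apply: eq_map => i /=.
by rewrite coface_coords tnth_mktuple.
Qed.

Lemma cells_word_glue (p q : cells R K) :
  clos_refl_sym_trans _ (@face_glue R K) p q -> cells_word p = cells_word q.
Proof.
elim=> {p q} [p q [l m f s x]|//|p q _ ->//|p q r _ -> _ -> //].
by rewrite /cells_word /=; exact: cell_word_face.
Qed.

End Coordinates.

Section RealizationWords.
Variables (R : realType) (S : choiceType) (w : seq S).
Local Open Scope quotient_scope.

Local Notation K := (scrambled_simplex w).
Local Notation X := (realization R K).
Local Notation E := (wword R (option S)).

Definition to_word (p : X) : E := cells_word (repr p).

Lemma to_wordE l (s : K l) (x : std_simplex R l) :
  to_word (realization_point s x) = clean (cell_word s x).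
Proof.
rewrite /to_word; have : \pi_X (repr (realization_point s x)) = realization_point s x.
  exact: reprK.
by move/eqmodP/asboolP/cells_word_glue.
Qed.

Lemma cont_family_map (T : topologicalType) (t : T) (L : choiceType) (I : Type)
    (r : seq I) (a : I -> L) (g : I -> T -> R) :
  (forall i, {for t, continuous (g i)}) ->
  cont_family t (fun t' => [seq (a i, g i t') | i <- r]).
Proof.
move=> cg; elim: r => [|i r IH] /=; first exact: cont_family_nil.
exact: cont_family_cons.
Qed.

Lemma coords_continuous l (i : 'I_l.+1) :
  continuous (fun x : std_simplex R l => coords x 0 i).
Proof.
move=> x; have c1 : continuous (@coords R l) by exact: initial_continuous.
exact: (continuous_comp (c1 x) (@coord_row_continuous R l.+1 i _)).
Qed.

Lemma cells_word_continuous : continuous (@cells_word R S w).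
Proof.
move=> [[l s] x].
have c : {for x, continuous (fun x : std_simplex R l => clean (cell_word s x) : E)}.
  apply: cont_family_clean; apply: cont_family_map => i; exact: coords_continuous.
by move=> O /c.
Qed.

Lemma to_word_continuous : continuous to_word.
Proof.
apply: repr_comp_continuous; first exact: cells_word_continuous.
move=> p q /eqP /eqmodP /asboolP h; apply/eqP; exact: cells_word_glue.
Qed.

Lemma realization_rep (p : X) : exists l (s : K l) (x : std_simplex R l),
  p = realization_point s x.
Proof.
exists (tag (tag (repr p))), (tagged (tag (repr p))), (tagged (repr p)).
rewrite /realization_point -[LHS]reprK; congr (\pi_X _).
by case: (repr p) => -[l s] x.
Qed.

(** The face of [s] spanned by the positive coordinates of [x]: in this
    representation nothing is lost by cleaning, so the word determines the
    point ([to_word_inj]). *)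
Lemma to_word_pos l (s : K l) (x : std_simplex R l) :
  exists m (s' : K m) (x' : std_simplex R m),
    realization_point s x = realization_point s' x' /\
    clean (cell_word s x) = cell_word s' x'.
Proof.
pose u := [seq i <- enum 'I_l.+1 | 0 < coords x 0 i].
have su : sorted (fun i j : 'I_l.+1 => (i < j)%N) u.
  apply: (@sorted_filter _ (fun i j : 'I_l.+1 => (i < j)%N)) (enum_sorted _).
  by move=> ? ? ?; exact: ltn_trans.
have u0 : u != [::].
  apply/eqP => u0; have := coords_sum x; rewrite big1 => [|i _].
    by move/eqP; rewrite eq_sym oner_eq0.
  apply/eqP; rewrite eq_le coords_ge0 andbT leNgt; apply/negP => xi.
  have : i \in u by rewrite mem_filter xi mem_enum.
  by rewrite u0.
have [m um] : exists m, size u = m.+1.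
  by case: (u) u0 => // i v _; exists (size v).
pose f (i : 'I_m.+1) := nth ord0 u i.
have fh : {homo f : i j / (i < j)%N}.
  move=> i j ij; rewrite /f; apply: (sorted_ltn_nth _ _ su) => //.
  - by move=> ? ? ?; exact: ltn_trans.
  - by rewrite inE um.
  - by rewrite inE um.
pose F := OrdInj fh.
have fE : map f (enum 'I_m.+1) = u.
  apply: (@eq_from_nth _ ord0); first by rewrite size_map size_enum_ord um.
  rewrite size_map size_enum_ord => i im.
  by rewrite (nth_map ord0) ?size_enum_ord// /f nth_enum_ord.
pose y : 'rV[R]_m.+1 := \row_i coords x 0 (f i).
have finj : injective f := @ordinj_inj _ _ F.
have sumE (g : 'I_l.+1 -> R) : (forall i, i \notin u -> g i = 0) ->
    \sum_i g i = \sum_(i < m.+1) g (f i).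
  move=> g0; transitivity (\sum_(j <- u) g j); last by rewrite -fE big_map big_enum.
  rewrite /u big_filter big_enum_cond /=.
  rewrite (bigID (fun i => 0 < coords x 0 i)) /= addrC big1 ?add0r// => i xi.
  by apply: g0; rewrite mem_filter (negbTE xi).
have xu i : i \notin u -> coords x 0 i = 0.
  rewrite mem_filter mem_enum andbT -leNgt => xi.
  by apply/eqP; rewrite eq_le xi coords_ge0.
have yP : y \in barycentric R m.
  apply/mem_set; split=> [i|]; first by rewrite mxE coords_ge0.
  rewrite -(coords_sum x) (sumE _ xu); apply: eq_bigr => i _.
  by rewrite mxE.
pose x' : std_simplex R m := exist _ y yP.
have xE : coface F x' = x.
  apply: val_inj; apply/rowP => j; rewrite -[LHS]/(coords (coface F x') 0 j).
  rewrite -[RHS]/(coords x 0 j).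
  have [i fi|h] := pickP (fun i => f i == j).
    by rewrite -(eqP fi) (@coface_coords _ _ _ F) /coords /= mxE.
  rewrite coface_coords0 ?xu// => [|i]; last by rewrite h.
  apply/negP; rewrite -fE => /mapP[i _ ji].
  by have := h i; rewrite ji eqxx.
exists m, (face F s : K m), x'; split.
  apply/eqmodP/asboolP; apply: rst_sym; apply: rst_step.
  by rewrite -{1}xE; exact: FaceGlue.
rewrite -{1}xE -cell_word_face clean_cell_word /cell_word.
have -> : [seq i <- enum 'I_m.+1 | 0 < coords x' 0 i] = enum 'I_m.+1; last by [].
apply/all_filterP/allP => i _; rewrite /coords /= mxE.
have : f i \in u by rewrite -fE map_f// mem_enum.
by rewrite mem_filter => /andP[].
Qed.

Lemma cell_word_inj l m (s : K l) (x : std_simplex R l) (s' : K m)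
    (x' : std_simplex R m) :
  cell_word s x = cell_word s' x' ->
  realization_point s x = realization_point s' x'.
Proof.
move=> h; have lm : l = m.
  have := congr1 size h; rewrite /cell_word !size_map -!enumT !size_enum_ord.
  by case.
subst m.
have e i : (Some (tnth (val s) i), coords x 0 i) =
    (Some (tnth (val s') i), coords x' 0 i).
  by move/eq_in_map: h => /(_ i); apply; rewrite mem_enum.
have -> : s = s'.
  by apply/val_inj/eq_from_tnth => i; have [] := e i.
have -> : x = x'.
  by apply: val_inj; apply/rowP => i; have [] := e i.
by [].
Qed.

Lemma to_word_inj : injective to_word.
Proof.
move=> p q; have [l [s [x ->]]] := realization_rep p.
have [m [s' [x' ->]]] := realization_rep q.
have [l1 [s1 [x1 [-> h1]]]] := to_word_pos s x.
have [m1 [s1' [x1' [-> h1']]]] := to_word_pos s' x'.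
rewrite !to_wordE; rewrite -h1 -h1' !clean_id h1 h1'; exact: cell_word_inj.
Qed.

Lemma word_cell_word l (s : K l) (x : std_simplex R l) :
  word (cell_word s x) = map Some (val s).
Proof.
rewrite /word /cell_word -map_comp -[in RHS](map_tnth_enum (val s)) -map_comp.
exact: eq_map.
Qed.

Lemma cone_to_word p : cone (subwords (map Some w)) (to_word p).
Proof.
have [l [s [x ->]]] := realization_rep p.
rewrite to_wordE; split; first exact: clean_id.
apply: subseq_trans (clean_subword _) _; rewrite word_cell_word.
by apply: map_subseq; exact: (valP s).
Qed.

Lemma mass_to_word p : mass (to_word p) = 1.
Proof.
have [l [s [x ->]]] := realization_rep p.
rewrite to_wordE mass_clean /cell_word big_map big_enum /= -(coords_sum x).
by apply: eq_bigr => i _; apply/max_idPr; exact: coords_ge0.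
Qed.

Lemma to_word_neq_nil p : to_word p <> [::].
Proof.
move=> h; have := mass_to_word p; rewrite h /mass big_nil => /eqP.
by rewrite eq_sym oner_eq0.
Qed.

(** Any simplex through a point of the subcomplex may be replaced by the one
    spanned by its positive coordinates, which is a face and thus lies in the
    subcomplex. *)
Lemma subrealizationE v p :
  subrealization R (scrambled_subcomplex w v) p <-> cone (subwords (map Some v))
    (to_word p).
Proof.
split=> [[l [s [x [/= sv ->]]]]|].
  rewrite to_wordE; split; first exact: clean_id.
  apply: subseq_trans (clean_subword _) _; rewrite word_cell_word.
  exact: map_subseq.
have [l0 [s0 [x0 ->]]] := realization_rep p.
have [l [s [x [-> h]]]] := to_word_pos s0 x0.
rewrite to_wordE -h clean_id h => -[_ hv]; exists l, s, x; split=> //=.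
move: hv; rewrite word_cell_word => /subseqP[m sm mE].
apply/subseqP; exists m; first by rewrite sm size_map.
have Si : injective (@Some S) by move=> ? ? [].
have h1 : map Some (val s) = map Some (mask m v) by rewrite mE map_mask.
exact: (inj_map Si h1).
Qed.

End RealizationWords.

(** * Weighted words as points of the realization *)

Section Mass.
Variables (R : realType) (L : choiceType).
Implicit Types (e o : wword R L) (u : seq L).

Lemma mass_cell u (y : weights R) :
  mass (cell u y) = \sum_(i < size u) Num.max 0 ((y : nat -> R) i).
Proof.
rewrite mass_clean; elim: u y => [|a u IH] y; first by rewrite big_nil big_ord0.
by rewrite /= big_cons big_ord_recl IH.
Qed.

Lemma mass_cell_continuous u :
  continuous (fun y : weights R => mass (cell u y)).
Proof.
move=> y; have -> : (fun y : weights R => mass (cell u y)) =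
    (fun y : weights R => \sum_(i < size u) Num.max 0 ((y : nat -> R) i)).
  by apply/funext => z; rewrite mass_cell.
apply: cont_sum => i.
exact: (cont_max (@cst_continuous _ _ (0 : R) y) (@coord_continuous R i y)).
Qed.

Lemma mass_gt0 e : clean e = e -> e <> [::] -> 0 < mass e.
Proof.
move=> ce; have := clean_pos ce; case: e {ce} => [//|p e] h _.
rewrite /mass big_cons ltr_pwDl ?h ?mem_head// big_seq; apply: sumr_ge0 => q qe.
by apply: ltW; apply: h; rewrite inE qe orbT.
Qed.

Definition normalize e : wword R L := [seq (p.1, p.2 / mass e) | p <- e].

Lemma word_normalize e : word (normalize e) = word e.
Proof. by rewrite /word /normalize -map_comp. Qed.

Lemma cone_normalize P e : cone P e -> e <> [::] -> cone P (normalize e).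
Proof.
move=> [ce Pe] e0; split; last by rewrite word_normalize.
apply: pos_clean => p /mapP[q qe ->] /=.
by rewrite divr_gt0 ?(clean_pos ce qe)// mass_gt0.
Qed.

Lemma normalize_mass1 e : mass e = 1 -> normalize e = e.
Proof. by move=> m1; rewrite /normalize m1; elim: e {m1} => //= -[a t] e ->;
  rewrite divr1. Qed.

Definition nonzero : set (wword R L) := [set e | e <> [::]].

Lemma nonzero_open : open nonzero.
Proof.
move=> u; rewrite openE => y /= /(mass_gt0 (clean_cell u y)) my.
have := @mass_cell_continuous u y _ (lt_nbhsr my); apply: (@filterS _ (nbhs y))
  => z /= mz z0.
by move: mz; rewrite z0 /mass big_nil ltxx.
Qed.

Lemma weigh_enum n (t : n.-tuple L) (y : nat -> R) :
  weigh t y = [seq (tnth t i, y i) | i <- enum 'I_n].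
Proof.
have h a0 u (z : nat -> R) : weigh u z = [seq (nth a0 u i, z i) | i <- iota 0 (size u)].
  elim: u z => [//|a u IH] z /=; congr (_ :: _).
  by rewrite IH (iotaDl 1 0) -map_comp.
case: n t => [|n] t; first by rewrite (tuple0 t) (size0nil (size_enum_ord 0)).
rewrite (h (thead t)) size_tuple -val_enum_ord -map_comp; apply: eq_map => i /=.
by rewrite (tnth_nth (thead t)).
Qed.

End Mass.

Section FromWord.
Variables (R : realType) (S : choiceType) (w : seq S) (n : nat).
Hypothesis sw : size w == n.+1.

Local Notation K := (scrambled_simplex w).
Local Notation X := (realization R K).
Local Notation L := (option S).
Local Notation E := (wword R L).
Local Notation W := (map Some w).

Definition top_simplex : K n := exist _ (Tuple sw) (subseq_refl w).

Definition total (y : weights R) : R := \sum_(i < n.+1) Num.max 0 ((y : nat -> R) i).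

(** The vertex in the second branch is an arbitrary value for total weight
    zero. *)
Definition bary_row (y : weights R) : 'rV[R]_n.+1 :=
  if 0 < total y then \row_i (Num.max 0 ((y : nat -> R) i) / total y)
  else \row_i (i == ord0)%:R.

Lemma bary_subproof y : bary_row y \in barycentric R n.
Proof.
apply/mem_set; rewrite /bary_row; case: ifP => y0; split=> [i|].
- by rewrite mxE divr_ge0 ?(ltW y0)// le_max lexx.
- under eq_bigr do rewrite mxE.
  by rewrite -mulr_suml divff// gt_eqF.
- by rewrite mxE ler0n.
- under eq_bigr do rewrite mxE.
  by rewrite (bigD1 ord0)//= big1 ?addr0// => i /negbTE ->.
Qed.

Definition bary (y : weights R) : std_simplex R n :=
  exist _ (bary_row y) (bary_subproof y).

Lemma coords_bary y : coords (bary y) = bary_row y.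
Proof. by []. Qed.

(** The point of the top simplex [w] with the given weights, normalized. Every
    point of the realization has this form, since all simplices are faces of
    [w]. *)
Definition top_point (y : weights R) : X := realization_point top_simplex (bary y).

Lemma mass_cell_top y : mass (cell W y) = total y.
Proof. by rewrite mass_cell size_map (eqP sw). Qed.

Lemma to_word_top_point y : 0 < total y -> to_word (top_point y) = normalize (cell W y).
Proof.
move=> y0; rewrite to_wordE /normalize mass_cell_top.
have -> : cell W y = clean [seq (Some (tnth (Tuple sw) i), (y : nat -> R) i)
    | i <- enum 'I_n.+1].
  have := weigh_enum (map_tuple Some (Tuple sw)) y => /= h.
  by rewrite /cell h; congr clean; apply: eq_map => i; rewrite tnth_map.
have -> : clean [seq (Some (tnth (Tuple sw) i), (y : nat -> R) i) | i <- enum 'I_n.+1]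
    = [seq (Some (tnth (Tuple sw) i), (y : nat -> R) i)
      | i <- [seq i <- enum 'I_n.+1 | 0 < (y : nat -> R) (nat_of_ord i)]].
  by rewrite /clean filter_map.
rewrite clean_cell_word -[RHS]map_comp.
have -> : [seq i <- enum 'I_n.+1 | 0 < coords (bary y) 0 i] =
    [seq i <- enum 'I_n.+1 | 0 < (y : nat -> R) (nat_of_ord i)].
  apply: eq_filter => i; rewrite coords_bary /bary_row y0 mxE.
  by rewrite pmulr_lgt0 ?invr_gt0// lt_max ltxx.
apply/eq_in_map => i; rewrite mem_filter => /andP[/= yi _].
by rewrite coords_bary /bary_row y0 mxE max_r// ltW.
Qed.

(** The weights are chosen arbitrarily among those that parametrize [e]; by
    [from_word_cell] the point does not depend on them, so continuity can be
    tested on the parametrization. *)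
Definition from_word (e : E) : X :=
  top_point (xget (fun=> 0) [set y : weights R | cell W y = e]).

Lemma from_word_cell y : from_word (cell W y) = top_point y.
Proof.
rewrite /from_word; set y' := xget _ _.
have yE : cell W y' = cell W y by exact: (@xgetPex _ _ [set z | cell W z = cell W y])
  (ex_intro _ y erefl).
have tE : total y' = total y by rewrite -!mass_cell_top yE.
have [y0|y0] := ltP 0 (total y).
  by apply: to_word_inj; rewrite !to_word_top_point ?tE// yE.
rewrite /top_point; congr realization_point; apply: val_inj.
by rewrite /= /bary_row tE ltNge y0.
Qed.

Lemma cone_cell_exists (e : E) : cone (subwords W) e -> exists y, e = cell W y.
Proof. by move=> [ce we]; have [y yE] := cell_surj ce we; exists y. Qed.

Lemma to_wordK : cancel (@to_word R S w) from_word.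
Proof.
move=> p; have [y yE] := cone_cell_exists (cone_to_word p).
have y0 : 0 < total y by rewrite -mass_cell_top -yE mass_to_word.
apply: to_word_inj; rewrite yE from_word_cell to_word_top_point// -yE.
by rewrite normalize_mass1// mass_to_word.
Qed.

Lemma from_wordK (e : E) : cone (subwords W) e -> e <> [::] ->
  to_word (from_word e) = normalize e.
Proof.
move=> Ae e0; have [y yE] := cone_cell_exists Ae;
  rewrite yE from_word_cell to_word_top_point//.
by rewrite -mass_cell_top -yE mass_gt0//; case: Ae.
Qed.

Lemma total_continuous : continuous total.
Proof.
move=> y; apply: cont_sum => i.
exact: (cont_max (@cst_continuous _ _ (0 : R) y) (@coord_continuous R i y)).
Qed.

Lemma top_point_continuous y : 0 < total y -> {for y, continuous top_point}.
Proof.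
move=> y0.
have cr : {for y, continuous bary_row}.
  have near0 : \forall z \near y, 0 < total z.
    exact: (@total_continuous y _ (lt_nbhsr y0)).
  pose g (z : weights R) : 'rV[R]_n.+1 :=
    \row_i (Num.max 0 ((z : nat -> R) i) / total z).
  have h : cont_on [set z | 0 < total z] g.
    apply: cont_on_row => i z z0.
    have c0 : {for z, continuous (fun z : weights R => Num.max 0 ((z : nat -> R)
      i) / total z)}.
      apply: contM.
        exact: (cont_max (@cst_continuous _ _ (0 : R) z) (@coord_continuous R i z)).
      apply: (continuousV _ (@total_continuous z)).
      by rewrite gt_eqF.
    move=> O; rewrite mxE => /c0; apply: (@filterS _ (nbhs z)) => z' + _ /=.
    by rewrite mxE.
  have cg : {for y, continuous g}.
    move=> O /(h y y0) hO.
    by apply: (@filterS2 _ (nbhs y) _ _ _ _ _ near0 hO) => z z0 /(_ z0).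
  apply: near_eq_continuous cg; apply: (@filterS _ (nbhs y)) near0 => z z0.
  by rewrite /bary_row z0.
have c1 : {for y, continuous bary}.
  by apply: continuous_set_type; exact: cr.
have c2 : continuous (@realization_point R K n top_simplex).
  move=> x; apply: (@continuous_comp _ _ _ (@cell_point R K n top_simplex)
     (\pi_X)%qT); last exact: pi_continuous.
  exact: existT_continuous.
exact: (continuous_comp c1 (c2 _)).
Qed.

Lemma from_word_cont_on : cont_on (cone (subwords W) `&` @nonzero R L) from_word.
Proof.
apply: cont_on_cell; first exact: nonzero_open.
move=> y /(mass_gt0 (clean_cell W y)); rewrite mass_cell_top => y0.
have -> : (fun y : weights R => from_word (cell W y)) = top_point.
  by apply/funext => y'; rewrite from_word_cell.
exact: top_point_continuous.
Qed.

End FromWord.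

(** * Contractibility and strong deformation retraction *)

Section Assembly.
Variables (R : realType) (S : choiceType) (w : seq S) (n : nat).
Hypothesis sw : size w == n.+1.

Local Notation K := (scrambled_simplex w).
Local Notation X := (realization R K).
Local Notation L := (option S).
Local Notation E := (wword R L).
Local Notation W := (map Some w).
Local Notation from := (from_word sw).
Local Notation to := (@to_word R S w).

Lemma homot_homotopic (T U : topologicalType) C (f g : T -> U) :
  homot R setT C f g -> homotopic R f g.
Proof.
move=> [H [cH _ H0 H1]]; exists H; split=> [|x|x]; [|exact: H0|exact: H1].
by apply: cont_on_within; apply: cont_on_sub cH => -[x s].
Qed.

Lemma to_cont_on (B : set X) : cont_on B to.
Proof. exact/cont_onT/to_word_continuous. Qed.

(** Since nonzero words stay nonzero, a homotopy of cones may be conjugated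
    with the passage to words and back. *)
Lemma homot_realization (B : set X) P (Q : pred (seq L)) (f g : E -> E) :
  (forall p, B p -> cone P (to p)) -> (forall u, Q u -> subwords W u) ->
  cone_homot P Q f g ->
  homot R B (fun p q => exists2 e, cone Q e /\ e <> [::] & q = from e)
    (from \o f \o to) (from \o g \o to).
Proof.
move=> BP QW fg.
have h1 : homot R B (fun p e => cone Q e /\ e <> [::]) (f \o to) (g \o to).
  apply: homot_pre (@to_cont_on B) BP _ fg => p e Bp [Ae e0]; split=> //.
  by move=> /e0; exact: to_word_neq_nil.
have h2 := @homot_post R _ _ _ B _ (fun p e => cone Q e /\ e <> [::])
  (fun p q => exists2 e, cone Q e /\ e <> [::] & q = from e) from (f \o to) (g \o to)
  (@from_word_cont_on R S w n sw).
apply: h2 h1 => p e _ [Ae e0]; last by exists e.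
by split=> //; exact: cone_sub QW _ Ae.
Qed.

Lemma from_to_id (B : set X) C g :
  homot R B C (from \o id \o to) g -> homot R B C id g.
Proof. by apply: homot_eq => // p _; exact: to_wordK. Qed.

(** The open cone over a vertex is a half line, and all its points except the
    apex normalize to the same point. *)
Lemma contractible_of_cone_equiv c : c \in W -> cone_equiv R (subwords W)
  (subwords [:: c]) ->
  contractible R X.
Proof.
move=> cW [_ [j [[_ hj] hM _]]].
have Ac (t : R) : 0 < t -> cone (subwords W) [:: (c, t)].
  by move=> t0; split; [rewrite clean_cons t0|rewrite /subwords sub1seq].
exists (from [:: (c, 1)]).
apply: (@homot_homotopic _ _ (fun _ _ => True)); apply: from_to_id.
have h := @homot_realization setT _ _ _ _ (fun p _ => cone_to_word p) (fun u h => h) hM.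
apply: (homot_eq (f := from \o id \o to) (g := from \o j \o to)) => //; last first.
  exact: homot_sub h.
move=> p _ /=.
have [[cj wj] j0] := hj _ (cone_to_word p).
have jn : j (to p) <> [::] by move=> /j0; exact: to_word_neq_nil.
have [t [t0 ->]] : exists t, 0 < t /\ j (to p) = [:: (c, t)].
  case: (j (to p)) cj wj jn => [//|[a t] [|[a' t'] e]] ce we _.
    exists t; split; first by apply: (clean_pos ce (p := (a, t))); rewrite mem_head.
    by have : subseq [:: a] [:: c] := we; rewrite sub1seq inE => /eqP ->.
  by have := size_subseq we.
have A1 := Ac _ ltr01; have At := Ac _ t0.
apply: to_word_inj; rewrite !from_wordK// /normalize /mass /= !big_seq1 /=.
by rewrite !divff ?oner_neq0// gt_eqF.
Qed.

(** Truncation towards the subcomplex of [v]. A point of mass one with at most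
    [n + 1] letters has a weight of at least [1 / (n + 1)], so subtracting at
    most half of this never empties the word. *)
Definition shrink (v : seq S) (y : E * R) : E :=
  trunc (clip y.2 * Num.min (trunc_dist (subwords (map Some v)) y.1)
    (2 * n.+1%:R)^-1) y.1.

Lemma shrink_cont_on v : cont_on (cone (subwords W) `*` setT) (shrink v).
Proof.
apply: cont_on_cylinder => y z.
have k0 : 0 <= (2 * n.+1%:R)^-1 :> R by rewrite invr_ge0 mulr_ge0.
pose d (y : weights R * R) := clip y.2 *
  Num.min (trunc_dist (subwords (map Some v)) (weigh W y.1)) (2 * n.+1%:R)^-1.
have -> : (fun y : weights R * R => shrink v (cell W y.1, y.2)) =
    (fun y : weights R * R => clean (shift (d y) (weigh W y.1)) : E).
  apply/funext => y'; rewrite /shrink /= trunc_dist_clean; last exact: down_subseq.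
  by rewrite trunc_clean// mulr_ge0 ?clip_ge0// le_min trunc_dist_ge0.
have fw : cont_family (y, z) (fun y : weights R * R => weigh W y.1).
  exact: (cont_family_weigh W (@continuous_fst _ _ (y, z))).
apply: cont_family_clean; apply: (cont_family_shift _ fw).
apply: (contM (@clip_snd_continuous R _ (y, z))).
exact: (cont_min (cont_family_trunc_dist fw) (@cst_continuous _ _ _ (y, z))).
Qed.

Lemma trunc_nil (e : E) d : trunc d e = [::] -> mass e <= (size e)%:R * d.
Proof.
rewrite /mass; elim: e => [|[a t] e IH]; first by rewrite big_nil mul0r.
rewrite trunc_cons big_cons /=; case: (leP t d) => // td /IH h.
by rewrite -natr1 mulrDl mul1r addrC lerD.
Qed.

Lemma shrink_neq_nil v p s : shrink v (to p, s) <> [::].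
Proof.
move=> /trunc_nil; rewrite mass_to_word /=.
have [_ wp] := cone_to_word p; have := size_subseq wp.
rewrite !size_map (eqP sw) => sp; set m := Num.min _ _ => h.
have m0 : 0 <= m by rewrite le_min trunc_dist_ge0 invr_ge0 mulr_ge0.
have d0 : 0 <= clip s * m by rewrite mulr_ge0 ?clip_ge0.
have d1 : clip s * m <= (2 * n.+1%:R)^-1.
  apply: (@le_trans _ _ m); last by rewrite ge_min lexx orbT.
  by rewrite -subr_ge0 -[X in X - _]mul1r -mulrBl mulr_ge0 ?subr_ge0 ?clip_le1.
have : 1 <= n.+1%:R * (2 * n.+1%:R)^-1 :> R.
  by apply: le_trans h _; apply: ler_pM => //; rewrite ler_nat.
rewrite invfM mulrCA divff ?pnatr_eq0// mulr1; lra.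
Qed.

Lemma cone_shrink v e s : cone (subwords W) e -> cone (subwords W) (shrink v (e, s)).
Proof.
move=> [ce we]; split; first exact: clean_id.
exact: subseq_trans (word_trunc _ _) we.
Qed.

Lemma cone_to_from P e : cone (subwords W) e -> e <> [::] -> cone P e ->
  cone P (to (from e)).
Proof. by move=> Ae e0 Pe; rewrite from_wordK//; exact: cone_normalize. Qed.

Lemma sdr_of_cone_equiv v : subseq v w -> cone_equiv R (subwords W)
  (subwords (map Some v)) ->
  strong_deformation_retract R (subrealization R (scrambled_subcomplex w v)).
Proof.
move=> vw [_ [j [[_ hj] hM hN]]].
have VW u : subwords (map Some v) u -> subwords W u.
  by move=> h; apply: subseq_trans h _; exact: map_subseq.
pose B := subrealization R (scrambled_subcomplex w v).
have BE p : B p <-> cone (subwords (map Some v)) (to p) by exact: subrealizationE.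
have Bfrom e : cone (subwords (map Some v)) e -> e <> [::] -> B (from e).
  by move=> Ae e0; apply/BE; apply: cone_to_from => //; exact: cone_sub VW _ Ae.
pose N2 : R := 2 * n.+1%:R.
have N20 : 0 < N2 by rewrite mulr_gt0.
(* Scaled so that [u p <= 1] holds when the bound in [shrink] is not reached,
   that is, when [p] is brought into the subcomplex. *)
pose u p := N2 * trunc_dist (subwords (map Some v)) (to p).
pose k p := from (shrink v (to p, 1)).
have dstc : continuous u.
  apply: cont_on_setT.
  have c : cont_on (cone (subwords W)) (fun e : E =>
    trunc_dist (subwords (map Some v)) e).
    apply: (@cont_on_sub _ _ _ (cone (subwords W) `&` setT)) => [e //|].
    apply: cont_on_cell => [|y _]; first exact: openT.
    have -> : (fun y : weights R => trunc_dist (subwords (map Some v)) (cell W y)) =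
      (fun y : weights R => trunc_dist (subwords (map Some v)) (weigh W y)).
      by apply/funext => y'; rewrite trunc_dist_clean//; exact: down_subseq.
    exact: trunc_dist_continuous.
  have c' : continuous (fun p : X => trunc_dist (subwords (map Some v)) (to p)).
    apply: cont_on_setT; apply: (cont_on_comp (@to_cont_on setT) _ c) => p _.
    exact: cone_to_word.
  by apply: cont_onT => p; exact: (contM (@cst_continuous _ _ N2 p) (c' p)).
have uB p : B p -> u p = 0.
  move=> /BE[_ wp]; rewrite /u trunc_dist_in ?mulr0//; exact: down_subseq.
have hk : homot R setT (fun p q => B p -> q = p) id k.
  exists (fun y => from (shrink v (to y.1, y.2))); split.
  - apply: (@cont_on_comp _ _ _ _ (cone (subwords W) `&` @nonzero R L)
      (fun y : X * R => shrink v (to y.1, y.2)) from).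
    + apply: (@cont_on_comp _ _ _ _ (cone (subwords W) `*` setT)
        (fun y : X * R => (to y.1, y.2)) (shrink v)).
      * apply: cont_onT => y; apply: continuous_lift_fst; exact: to_word_continuous.
      * by move=> y _; split=> //; exact: cone_to_word.
      * exact: shrink_cont_on.
    + move=> y _; split; last exact: shrink_neq_nil.
      by apply: cone_shrink; exact: cone_to_word.
    + exact: from_word_cont_on.
  - move=> p s _ /BE[cp wp]; rewrite /shrink /= trunc_dist_in//; last exact:
    down_subseq.
    rewrite min_l ?invr_ge0 ?mulr_ge0// mulr0 /trunc shift0 cp.
    exact: to_wordK.
  - move=> p _; rewrite /shrink /= clip0 mul0r /trunc shift0.
    by have [-> _] := cone_to_word p; exact: to_wordK.
  - by [].
have kB p : u p <= 1 -> B (k p).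
  move=> up; apply: Bfrom; last exact: shrink_neq_nil.
  rewrite /shrink /= clip1 mul1r min_l; last first.
    by rewrite -[leRHS]mul1r ler_pdivlMr// mulrC.
  split; first exact: clean_id.
  by apply: trunc_in => //; [exact: down_subseq|exact: sub0seq].
have h1 : homot R setT (fun _ _ : X => True) id (from \o j \o to).
  apply: from_to_id.
  have h := @homot_realization setT _ _ _ _ (fun p _ => cone_to_word p)
    (fun u h => h) hM.
  exact: homot_sub h.
have h2 p : B ((from \o j \o to) p).
  have [Aj j0] := hj _ (cone_to_word p).
  by apply: Bfrom => //; move=> /j0; exact: to_word_neq_nil.
have h3 : homot R B (fun _ q => B q) id (from \o j \o to).
  apply: from_to_id.
  have h := @homot_realization B _ _ _ _ (fun p => (BE p).1) VW hN.
  by apply: homot_sub h => // p q _ [e [Ae e0] ->]; exact: Bfrom.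
have [r rB [H [cH CH H0 H1]]] := strong_retraction h1 h2 h3 dstc uB hk kB.
exists H; split.
- by apply: cont_on_within; apply: cont_on_sub cH => -[x s].
- by move=> x; exact: (H0 x I).
- by move=> x; rewrite (H1 x I); exact: rB.
- by move=> a s Ba _; exact: (CH a s I Ba).
Qed.

End Assembly.

(** * Radial projection onto the sphere *)

Section UnitSphere.
Variables (R : realType) (m : nat).
Implicit Types (v : 'rV[R]_m.+1) (q : sphere R m).

Definition norm2 v : R := Num.sqrt (\sum_i v 0 i ^+ 2).

Lemma norm2_continuous : continuous norm2.
Proof.
move=> v; have c : {for v, continuous (fun v => \sum_i v 0 i ^+ 2)}.
  apply: cont_sum => i; have ci := @coord_row_continuous R m.+1 i v.
  have -> : (fun v : 'rV[R]_m.+1 => v 0 i ^+ 2) = (fun v => v 0 i * v 0 i).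
    by apply/funext => u; rewrite expr2.
  exact: contM.
exact: (continuous_comp c (@sqrt_continuous R _)).
Qed.

Lemma norm2_gt0 v : v <> 0 -> 0 < norm2 v.
Proof.
move=> v0; rewrite sqrtr_gt0 lt_neqAle sumr_ge0 ?andbT => [|i _]; last exact: sqr_ge0.
apply/negP; rewrite eq_sym psumr_eq0 => [/allP h|i _]; last exact: sqr_ge0.
apply: v0; apply/rowP => i; rewrite mxE; apply/eqP.
by rewrite -sqrf_eq0; exact: (h i (mem_index_enum i)).
Qed.

Lemma sphere_norm2 q : norm2 (set_val q) = 1.
Proof. by rewrite /norm2; have -> := set_valP q; rewrite sqrtr1. Qed.

Lemma sphere_neq0 q : set_val q <> 0 :> 'rV[R]_m.+1.
Proof.
move=> q0; have := sphere_norm2 q; rewrite q0 /norm2 big1 ?sqrtr0 => [/eqP|i _].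
  by rewrite eq_sym oner_eq0.
by rewrite mxE expr0n.
Qed.

(** The value at the origin is arbitrary. *)
Definition proj_row v : 'rV[R]_m.+1 :=
  if 0 < norm2 v then (norm2 v)^-1 *: v else \row_i (i == ord0)%:R.

Lemma proj_subproof v : proj_row v \in unit_sphere R m.
Proof.
apply/mem_set; rewrite /unit_sphere /= /proj_row; case: ifP => v0.
  under eq_bigr do rewrite mxE exprMn.
  rewrite -mulr_sumr -[X in _ * X]sqr_sqrtr; last first.
    by apply: sumr_ge0 => i _; exact: sqr_ge0.
  by rewrite -/(norm2 v) -exprMn mulVf ?expr1n// gt_eqF.
under eq_bigr do rewrite mxE.
by rewrite (bigD1 ord0)//= big1 ?expr1n ?addr0// => i /negbTE ->; rewrite expr0n.
Qed.

Definition proj v : sphere R m := exist _ (proj_row v) (proj_subproof v).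

Lemma proj_val q : proj (set_val q) = q.
Proof.
apply: val_inj; rewrite /= /proj_row sphere_norm2 ltr01 invr1 scale1r.
by [].
Qed.

Lemma val_proj v : v <> 0 -> set_val (proj v) = (norm2 v)^-1 *: v.
Proof. by move=> /norm2_gt0 v0; rewrite -[LHS]/(proj_row v) /proj_row v0. Qed.

Lemma cont_on_scale (T : topologicalType) (B : set T) (k : T -> R)
    (v : T -> 'rV[R]_m.+1) :
  cont_on B k -> cont_on B v -> cont_on B (fun t => k t *: v t).
Proof.
move=> ck cv; apply: cont_on_row => j.
apply: (@cont_on_eq _ _ _ (fun t => k t * v t 0 j)) => [t _|]; first by rewrite mxE.
have cj := @cont_on_comp T _ _ B setT v (fun v : 'rV[R]_m.+1 => v 0 j) cv
  (fun _ _ => I) (cont_onT (@coord_row_continuous R m.+1 j)).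
move=> t Bt; exact: (@cvgM _ _ (within B (nbhs t)) _ _ _ _ _ (ck t Bt) (cj t Bt)).
Qed.

Lemma cont_on_inv (T : topologicalType) (B : set T) (k : T -> R) :
  cont_on B k -> (forall t, B t -> k t != 0) -> cont_on B (fun t => (k t)^-1).
Proof.
move=> ck k0 t Bt.
exact: (@cvgV _ _ (within B (nbhs t)) _ _ _ (k0 t Bt) (ck t Bt)).
Qed.

Lemma proj_cont_on : cont_on [set v : 'rV[R]_m.+1 | v <> 0] proj.
Proof.
move=> v v0; have near0 : \forall u \near v, 0 < norm2 u.
  exact: (@norm2_continuous v _ (lt_nbhsr (norm2_gt0 v0))).
have h : cont_on [set v : 'rV[R]_m.+1 | 0 < norm2 v] (fun v : 'rV[R]_m.+1 =>
  (norm2 v)^-1 *: v).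
  apply: cont_on_scale; last by apply: cont_onT => ? O.
  apply: cont_on_inv; first exact/cont_onT/norm2_continuous.
  by move=> u u0; rewrite gt_eqF.
have c : {for v, continuous proj_row}.
  apply: (@near_eq_continuous _ _ _ (fun v : 'rV[R]_m.+1 => (norm2 v)^-1 *: v)).
    apply: (@filterS _ (nbhs v)) near0 => u u0.
    by rewrite /proj_row u0.
  move=> O /(h v (norm2_gt0 v0)) hO.
  by apply: (@filterS2 _ (nbhs v) _ _ _ _ _ near0 hO) => u u0 /(_ u0).
have c' : {for v, continuous proj} by apply: continuous_set_type; exact: c.
by move=> O /c'; apply: (@filterS _ (nbhs v)) => u + _; apply.
Qed.

Lemma radial_homot : homot R [set v : 'rV[R]_m.+1 | v <> 0] (fun _ (v' :
  'rV[R]_m.+1) => v' <> 0)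
  id (fun v : 'rV[R]_m.+1 => (norm2 v)^-1 *: v).
Proof.
exists (fun y : 'rV[R]_m.+1 * R => ((1 - clip y.2) + clip y.2 / norm2 y.1) *:
  y.1); split.
- apply: cont_on_scale; last by apply: cont_onT => y; exact: continuous_fst.
  have c1 (B : set ('rV[R]_m.+1 * R)) : cont_on B (fun y : 'rV[R]_m.+1 * R => clip y.2).
    by apply: cont_onT => y; exact: clip_snd_continuous.
  have c2 : cont_on ([set v : 'rV[R]_m.+1 | v <> 0] `*` setT)
      (fun y : 'rV[R]_m.+1 * R => (norm2 y.1)^-1).
    apply: cont_on_inv => [|y [y0 _]]; last by rewrite gt_eqF// norm2_gt0.
    apply: cont_onT => y.
    exact: (continuous_comp (@continuous_fst _ _ y) (@norm2_continuous _)).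
  move=> y By; apply: (@cvgD _ _ _ (within _ (nbhs y))).
    by apply: (@cvgB _ _ _ (within _ (nbhs y))); [exact: cvg_cst|exact: c1].
  by apply: (@cvgM _ _ (within _ (nbhs y))); [exact: c1|exact: c2].
- move=> v s v0 /= /eqP; rewrite scaler_eq0 => /orP[|/eqP//].
  have n0 := norm2_gt0 v0; rewrite paddr_eq0 ?subr_ge0 ?clip_le1//; last first.
    by rewrite divr_ge0 ?clip_ge0// ltW.
  move=> /andP[/eqP h1 /eqP h2].
  have s1 : clip s = 1 by lra.
  by move: h2; rewrite s1 mul1r => /eqP; rewrite invr_eq0 gt_eqF.
- by move=> v _ /=; rewrite clip0 subr0 mul0r addr0 scale1r.
- by move=> v _ /=; rewrite clip1 subrr add0r mul1r.
Qed.

End UnitSphere.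

(** * The homotopy type *)

Section Normalization.
Variables (R : realType) (L : choiceType) (w : seq L).
Implicit Types (e : wword R L) (k s : R).

Lemma mass_cont_on : cont_on (cone (subwords w)) (@mass R L).
Proof.
rewrite -[cone _]setIT; apply: cont_on_cell => [|y _]; first exact: openT.
exact: mass_cell_continuous.
Qed.

(** Clipping the factor at zero makes this defined and continuous on the whole
    cylinder. *)
Definition scale (y : wword R L * R) : wword R L :=
  clean [seq (p.1, Num.max 0 y.2 * p.2) | p <- y.1].

Lemma scale_pos e k : clean e = e -> 0 < k ->
  scale (e, k) = [seq (p.1, k * p.2) | p <- e].
Proof.
move=> ce k0; rewrite /scale /= max_r ?(ltW k0)//; apply: pos_clean => p.
by move=> /mapP[q qe ->]; rewrite mulr_gt0// (clean_pos ce qe).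
Qed.

Lemma scale_cont_on : cont_on (cone (subwords w) `*` setT) scale.
Proof.
apply: cont_on_cylinder => x z.
pose f (y : weights R * R) : weights R :=
  fun i => Num.max 0 y.2 * Num.max 0 ((y.1 : nat -> R) i).
have -> : (fun y : weights R * R => scale (cell w y.1, y.2)) =
    (fun y : weights R * R => clean (weigh w (f y)) : wword R L).
  apply/funext => y; rewrite /scale scale_clean ?le_max ?lexx//; congr clean.
  rewrite /f; move: (Num.max 0 y.2) => k; elim: w (y.1 : nat -> R) => //= a u IH X.
  by rewrite IH.
apply: cont_family_clean; apply: cont_family_weigh; apply: cvg_weights => i.
have c2 := cont_max (@cst_continuous _ _ (0 : R) (x, z)) (@continuous_snd _ _ (x, z)).
exact: (contM c2 (@pos_coord_continuous R i (x, z))).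
Qed.

Lemma normalize_homot :
  homot R (cone (subwords w) `&` @nonzero R L) (fun _ e => cone (subwords w) e /\
    e <> [::])
    id (@normalize R L).
Proof.
have k0 e s : clean e = e -> e <> [::] -> 0 < (1 - clip s) + clip s / mass e.
  move=> ce e0; have m0 := mass_gt0 ce e0.
  have [s0|s0] := eqVneq (clip s) 0; first by rewrite s0 subr0 mul0r addr0.
  by rewrite ltr_wpDl ?subr_ge0 ?clip_le1// divr_gt0// lt_neqAle eq_sym s0 clip_ge0.
exists (fun y => scale (y.1, (1 - clip y.2) + clip y.2 / mass y.1)); split.
- apply: (@cont_on_comp _ _ _ _ (cone (subwords w) `*` setT) (fun y : wword R L * R =>
    (y.1, (1 - clip y.2) + clip y.2 / mass y.1))) scale_cont_on => [|y [[]]//].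
  apply: cont_on_pair; first by apply: cont_onT => y; exact: continuous_fst.
  pose B := (cone (subwords w) `&` @nonzero R L) `*` [set: R].
  have c1 : cont_on B (fun y : wword R L * R => clip y.2).
    by apply: cont_onT => y; exact: clip_snd_continuous.
  have c2 : cont_on B (fun y : wword R L * R => (mass y.1)^-1).
    apply: cont_on_inv => [|[e s] [[/= [ce _] e0] _]].
      apply: (@cont_on_comp _ _ _ _ (cone (subwords w)) fst) mass_cont_on =>
        [|y [[]]//].
      by apply: cont_onT => y; exact: continuous_fst.
    by rewrite gt_eqF// mass_gt0.
  move=> y By; apply: (@cvgD _ _ _ (within B (nbhs y))).
    by apply: (@cvgB _ _ _ (within B (nbhs y))); [exact: cvg_cst|exact: c1].
  by apply: (@cvgM _ _ (within B (nbhs y))); [exact: c1|exact: c2].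
- move=> e s [[ce we] e0] /=; rewrite scale_pos ?k0//; split; first split.
  + apply: pos_clean => p /mapP[q qe ->] /=.
    by rewrite mulr_gt0 ?k0// (clean_pos ce qe).
  + by rewrite /word -map_comp.
  + by case: (e) e0.
- move=> e [[ce we] e0] /=; rewrite scale_pos ?k0// clip0 subr0 mul0r addr0.
  by elim: (e) => //= -[a t] e' ->; rewrite mul1r.
- move=> e [[ce we] e0] /=; rewrite scale_pos ?k0// clip1 subrr add0r mul1r.
  by apply: eq_map => p; rewrite mulrC.
Qed.

End Normalization.

Section Sphere.
Variables (R : realType) (S : choiceType) (w : seq S) (n : nat).
Hypothesis sw : size w == n.+1.

Local Notation K := (scrambled_simplex w).
Local Notation X := (realization R K).
Local Notation L := (option S).
Local Notation E := (wword R L).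
Local Notation W := (map Some w).
Local Notation from := (from_word sw).
Local Notation to := (@to_word R S w).

Lemma homotopic_sym_of (T U : topologicalType) (f g : T -> U) :
  homot R setT (fun _ _ => True) g f -> homotopic R f g.
Proof. by move=> /homot_sym; exact: homot_homotopic. Qed.

(** Apex and origin are removed, mass and norm are normalized. In both
    composites the normalization in the middle is homotopic to the identity
    among nonzero vectors or words ([radial_homot] and [normalize_homot]). *)
Lemma sphere_of_sphere_like m : sphere_like R (subwords W) m.+1 ->
  homotopy_equivalent R X (sphere R m).
Proof.
move=> [f [g [[cf f0] [cg g0] gf fg]]].
pose N0 : set 'rV[R]_m.+1 := [set v | v <> 0].
have cfrom := @from_word_cont_on R S w n sw.
have ft0 p : f (to p) <> 0.
  by move=> /(f0 _ (cone_to_word p)); exact: to_word_neq_nil.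
have cft : cont_on setT (f \o to).
  by apply: cont_on_comp (@to_cont_on R S w setT) _ cf => p _; exact: cone_to_word.
have gA v : v <> 0 -> (cone (subwords W) `&` @nonzero R L) (g v).
  by move=> v0; have [Ag gz] := g0 v; split=> // /gz.
have cfg : cont_on N0 (from \o g).
  by apply: cont_on_comp cfrom => //; exact: cont_on_sub cg.
have cval : cont_on setT (fun q : sphere R m => set_val q : 'rV[R]_m.+1).
  exact/cont_onT/initial_continuous.
have cpf : cont_on (cone (subwords W) `&` @nonzero R L) (@proj R m \o f).
  apply: cont_on_comp (@proj_cont_on R m); first by apply: cont_on_sub cf => e [].
  by move=> e [Ae e0] /(f0 _ Ae).
exists (@proj R m \o (f \o to)), ((from \o g) \o set_val); split.
- apply: cont_on_setT.
  exact: (cont_on_comp cft (fun p _ => ft0 p) (@proj_cont_on R m)).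
- apply: cont_on_setT; apply: cont_on_comp cval _ cfg => q _; exact: sphere_neq0.
- apply: homotopic_sym_of.
  have h1 : homot R setT (fun _ _ : X => True) id (from \o (g \o f) \o to).
    apply: (@from_to_id R S w n sw).
    have h := @homot_realization R S w n sw setT _ _ _ _ (fun p _ => cone_to_word p)
      (fun u h => h) gf.
    exact: homot_sub h.
  have h2 : homot R setT (fun (_ : X) (v : 'rV[R]_m.+1) => v <> 0)
      (id \o (f \o to)) ((fun v : 'rV[R]_m.+1 => (norm2 v)^-1 *: v) \o (f \o to)).
    exact: (homot_pre cft (fun p _ => ft0 p) (fun _ _ _ h => h) (@radial_homot R m)).
  have h3 := @homot_post R _ _ _ setT N0 (fun _ (v : 'rV[R]_m.+1) => v <> 0)
    (fun _ _ => True)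
    (from \o g) _ _ cfg (fun _ _ _ h => h) (fun _ _ _ _ => I) h2.
  apply: homot_trans h1 _; apply: (homot_eq _ _ h3) => // p _.
  by rewrite /= val_proj.
- apply: homotopic_sym_of.
  have h1 : homot R setT (fun (_ : sphere R m) (v : 'rV[R]_m.+1) => v <> 0)
    (id \o set_val) ((f \o g) \o set_val).
    apply: (homot_pre cval (fun _ _ => I) _ fg) => q v _ vz vz0.
    by apply: (@sphere_neq0 R m q); apply/vz.
  have h2 := @homot_post R _ _ _ setT N0 (fun _ (v : 'rV[R]_m.+1) => v <> 0)
    (fun _ _ => True)
    (@proj R m) _ _ (@proj_cont_on R m) (fun _ _ _ h => h) (fun _ _ _ _ => I) h1.
  have h3 : homot R setT (fun (_ : sphere R m) (e : E) => cone (subwords W) e /\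
    e <> [::])
      (id \o (g \o set_val)) (@normalize R L \o (g \o set_val)).
    apply: homot_pre (@normalize_homot R L W) => //.
      by apply: cont_on_comp cval _ cg.
    by move=> q _; apply: gA; exact: sphere_neq0.
  have h4 := @homot_post R _ _ _ setT _ (fun _ (e : E) => cone (subwords W) e /\
    e <> [::])
    (fun _ _ => True) (@proj R m \o f) _ _ cpf (fun _ _ _ h => h) (fun _ _ _ _ => I) h3.
  apply: (@homot_trans _ _ _ _ _ _ (@proj R m \o ((f \o g) \o set_val))).
    by apply: (homot_eq _ _ h2) => // q _; exact: proj_val.
  apply: (homot_eq _ _ h4) => // q _ /=.
  have [Ag gn] := gA _ (@sphere_neq0 R m q).
  by rewrite from_wordK.
Qed.

End Sphere.

Lemma circular_decomposition_map (S : choiceType) (w : seq S) d :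
  circular_decomposition w d ->
  circular_decomposition (map Some w) [seq (Some p.1, map Some p.2) | p <- d].
Proof.
have Si : injective (@Some S) by move=> ? ? [].
move=> [dN ->]; split=> [_ /mapP[p pd ->]|] /=; first by rewrite (mem_map Si) dN.
rewrite map_flatten -!map_comp; congr flatten; apply: eq_map => p /=.
by rewrite map_rcons.
Qed.

Lemma fundamental_subword_map (S : choiceType) (d : seq (S * seq S)) :
  fundamental_subword [seq (Some p.1, map Some p.2) | p <- d] =
  map Some (fundamental_subword d).
Proof.
by rewrite /fundamental_subword map_flatten -!map_comp; congr flatten.
Qed.

Lemma spherical_map (S : choiceType) (w : seq S) :
  spherical (map Some w) -> spherical w.
Proof.
move=> [cs [csc wE]]; exists (map (pmap id) cs); split.
  move=> _ /mapP[u ucs ->]; have [a [v [av uE]]] := csc u ucs.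
  have uw : {subset u <= map Some w}.
    by move=> c cu; rewrite wE; apply/flattenP; exists u.
  have /mapP[a' _ aE] : a \in map Some w by apply: uw; rewrite uE mem_head.
  have vE : v = map Some (pmap id v).
    have : all isSome v.
      apply/allP => c cv.
      have /mapP[c' _ ->//] : c \in map Some w.
      by apply: uw; rewrite uE inE mem_rcons inE cv !orbT.
    elim: v {uE av} => // -[c|//] v IH /= /IH {1}->.
    by [].
  exists a', (pmap id v); split.
    by apply: contra av => h; rewrite aE vE map_f.
  by rewrite uE aE /= -cats1 pmap_cat /= cats1.
have <- : pmap id (map Some w) = w by elim: (w) => //= a u ->.
rewrite wE; elim: (cs) => //= u us IH.
by rewrite pmap_cat IH.
Qed.

Theorem theorem5p14 (R : realType) (S : choiceType) (w : seq S)
    (w_neq0 : w <> [::]) :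
  (~ spherical w ->
     contractible R (realization R (scrambled_simplex w))) /\
  (spherical w ->
     forall d : seq (S * seq S), circular_decomposition w d ->
       strong_deformation_retract R
         (subrealization R (scrambled_subcomplex w (fundamental_subword d))) /\
       homotopy_equivalent R
         (realization R (scrambled_simplex w))
         (sphere R (2 * size d - 1))).
Proof.
have [n sw] : exists n, size w == n.+1.
  by case: (w) w_neq0 => // a u _; exists (size u).
have Nw : None \notin map Some w by apply/mapP => -[].
split=> [nsph|_ d wd].
  have [c cw hc] := cone_equiv_not_spherical R Nw (fun h => nsph (spherical_map h)).
  exact: (contractible_of_cone_equiv sw cw hc).
have wd' := circular_decomposition_map wd; split.
  apply: (sdr_of_cone_equiv sw); first exact: fundamental_subseq.
  by rewrite -fundamental_subword_map; exact: (cone_equiv_spherical R Nw wd').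
apply: (sphere_of_sphere_like sw); have := sphere_like_spherical R Nw wd';
  rewrite size_map.
have d0 : (0 < size d)%N.
  by case: (d) wd => // -[_ wE]; case: w_neq0; rewrite wE.
have e : (2 * size d - 1).+1 = (2 * size d)%N by lia.
by rewrite e.
Qed.
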